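(* For integers $n\ge 2$, $m\ge 1$ let $\Lambda_0(n,m)$ and $\Lambda_1(n,m)$ be the even and odd Steklov eigenvalues of the $n$-dimensional critical catenoid in the $m$-th harmonic mode. There exists $A>0$ such that, for $1\le m<\dfrac{n}{A\,\mathrm{Log}(n)}$, $$\Lambda_0(n,m)=-\frac{n}{m}+m+O\!\left(\mathrm{Log}(n)+\frac{m^2\,\mathrm{Log}(n)}{n}\right),\qquad \Lambda_1(n,m)=m+O\!\left(\frac{m^2\,\mathrm{Log}(n)}{n}\right),$$ where the implied constants are independent of $n$ and $m$.
   Context: The $n$-dimensional critical catenoid $M_n$ is the unique rotationally symmetric free boundary minimal hypersurface (zero mean curvature, meeting the unit sphere orthogonally along its boundary, interior in the open ball) of non-trivial topology embedded in the closed unit ball of $\mathbb{R}^{n+1}$. Explicitly (up to rotation): let $f:]-L,L[\to\mathbb{R}$ be the maximal solution of $f''=(n-1)f^{2n-3}$, $f(0)=1$, $f'(0)=0$ (so $f$ is even, $(f')^2=f^{2(n-1)}-1$, and $L\in]0,+\infty]$), let $W\in]0,L[$ be the unique point with $Wf'(W)=f(W)$, and let $R>0$ with $R^2=W^2+f(W)^2$; then $M_n$ is the image of $F:[-W,W]\times S^{n-1}\to\mathbb{R}\times\mathbb{R}^n$, $F(x,\omega)=(x/R,\,f(x)\omega/R)$. Let $M=M_n$, $A_M$ its shape operator, $\Delta$ its Laplace–Beltrami operator, $\mathrm{J}\phi=-\Delta\phi-\mathrm{Tr}(A_M^2)\phi$, and $\partial_\nu$ the outward unit conormal derivative along $\partial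 M$. Let $\mathrm{Ker}(\mathrm{J})$ be the space of smooth $\phi$ on $M$ with $\mathrm{J}\phi=0$ and $\phi|_{\partial M}=0$. Let $V\subset C^\infty(\partial M)$ be the $L^2$-orthogonal complement of $\{\partial_\nu\phi\mid\phi\in\mathrm{Ker}(\mathrm{J})\}$, and $\pi:C^\infty(\partial M)\to V$ the $L^2$-orthogonal projection. For $\phi\in V$ let $\hat\phi$ be the unique function $L^2$-orthogonal to $\mathrm{Ker}(\mathrm{J})$ with $\mathrm{J}\hat\phi=0$ and $\hat\phi|_{\partial M}=\phi$. The Dirichlet to Neumann operator is $\mathrm{DN}:V\to V$, $\mathrm{DN}\phi=\pi(\partial_\nu\hat\phi)$; its eigenvalues are the Steklov eigenvalues of $M$. The boundary $\partial M$ consists of two components ($x=-W$ and $x=W$), each identified with $S^{n-1}$ via $\omega$, so functions on $\partial M$ are pairs $(g,h)$ of functions on $S^{n-1}$. Let $\mathcal{H}(n,m)$ be the space of spherical harmonics of order $m$ on $S^{n-1}$ (the eigenspace of the Laplace–Beltrami operator of $S^{n-1}$ with eigenvalue $-m(n+m-2)$). Then $\Lambda_0(n,m)$ is the unique eigenvalue of $\mathrm{DN}$ on $\{(g,g)\mid g\in\mathcal{H}(n,m)\}$ and $\Lambda_1(n,m)$ is the unique eigenvalue of $\mathrm{DN}$ on $\{(g,-g)\mid g\in\mathcal{H}(n,m)\}$. $\mathrm{Log}$ is the natural logarithm. *)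

(* Defs.v *)
From HB Require Import structures.
From mathcomp Require Import all_boot all_order all_algebra.
From mathcomp Require Import all_classical all_reals all_analysis.
Set Implicit Arguments.
Unset Strict Implicit.
Unset Printing Implicit Defensive.
Import Order.TTheory GRing.Theory Num.Theory.
Import numFieldNormedType.Exports.
Local Open Scope classical_set_scope.
Local Open Scope ring_scope.

(** * Submanifolds of Euclidean space in local parametrizations

    Points of R^d are row vectors.  The norm that the library puts on ['rV_d]
    is the sup norm; it is used for the topology only, lengths and angles are
    those of [dot]. *)

Definition dot (R : realType) (d : nat) (u v : 'rV[R]_d) : R :=
  \sum_(i < d) u 0 i * v 0 i.

Definition partial (R : realType) (k : nat) (V : normedModType R) (i : 'I_k)
    (h : 'rV[R]_k -> V) (u : 'rV[R]_k) : V :=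
  'D_(delta_mx 0 i) h u.

(** C^oo on the open set [U]: all iterated directional derivatives are
    (Frechet) differentiable at every point of [U]. *)
Definition smooth_on (R : realType) (k : nat) (V : normedModType R)
    (U : set 'rV[R]_k) (h : 'rV[R]_k -> V) : Prop :=
  forall (s : seq 'rV[R]_k) (u : 'rV[R]_k), U u ->
    differentiable (foldr (fun v g => 'D_v g) h s) u.

Definition gram (R : realType) (k d : nat) (X : 'rV[R]_k -> 'rV[R]_d)
    (u : 'rV[R]_k) : 'M[R]_k :=
  \matrix_(i, j) dot (partial i X u) (partial j X u).

(** When [S] is a [k]-dimensional submanifold with boundary, [X] is a local
    diffeomorphism from the open set [U] of R^k to the interior of [S]. *)
Definition local_param (R : realType) (k d : nat) (S : set 'rV[R]_d)
    (U : set 'rV[R]_k) (X : 'rV[R]_k -> 'rV[R]_d) : Prop :=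
  [/\ open U, smooth_on U X,
      (forall u, U u -> S (X u)) &
      (forall u, U u -> gram X u \in unitmx)].

(** |g|^(-1/2) d_i (|g|^(1/2) g^(ij) d_j (phi o X)), with g the metric induced
    by [X]. *)
Definition laplace_beltrami (R : realType) (k d : nat)
    (X : 'rV[R]_k -> 'rV[R]_d) (phi : 'rV[R]_d -> R) (u : 'rV[R]_k) : R :=
  (Num.sqrt (\det (gram X u)))^-1 *
  \sum_(i < k) partial (V := R) i (fun w => \sum_(j < k)
     Num.sqrt (\det (gram X w)) * invmx (gram X w) i j *
     partial (V := R) j (fun z => phi (X z)) w) u.

Definition unit_normal (R : realType) (k d : nat) (X : 'rV[R]_k -> 'rV[R]_d)
    (u : 'rV[R]_k) (N : 'rV[R]_d) : Prop :=
  dot N N = 1 /\ forall i : 'I_k, dot N (partial i X u) = 0.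

Definition second_form (R : realType) (k d : nat) (X : 'rV[R]_k -> 'rV[R]_d)
    (u : 'rV[R]_k) (N : 'rV[R]_d) : 'M[R]_k :=
  \matrix_(i, j) dot (partial i (partial j X) u) N.

Definition shape_operator (R : realType) (k d : nat)
    (X : 'rV[R]_k -> 'rV[R]_d) (u : 'rV[R]_k) (N : 'rV[R]_d) : 'M[R]_k :=
  invmx (gram X u) *m second_form X u N.

(** J phi = - Delta phi - Tr(A^2) phi. *)
Definition jacobi (R : realType) (k d : nat) (X : 'rV[R]_k -> 'rV[R]_d)
    (phi : 'rV[R]_d -> R) (u : 'rV[R]_k) (N : 'rV[R]_d) : R :=
  - laplace_beltrami X phi u
  - \tr (shape_operator X u N *m shape_operator X u N) * phi (X u).

(** Iterated integral over the box [I 0 x I 1 x ... x I (k-1)] of R^k. *)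
Fixpoint box_integral (R : realType) (k : nat) (I : nat -> set R) :
    ('rV[R]_k -> R) -> R :=
  match k return ('rV[R]_k -> R) -> R with
  | 0 => fun h => h 0
  | k'.+1 => fun h =>
      \int[lebesgue_measure]_(t in I 0%N)
        box_integral (fun j => I j.+1)
          (fun v : 'rV[R]_k' => h (row_mx (t%:M : 'rV[R]_1) v))
  end.

(** Integral, against the Riemannian volume, of a function on a submanifold
    which is parametrized by the restriction of [X] to a box, bijectively up to
    null sets; [h] is the function read in the parametrization. *)
Definition volume_integral (R : realType) (k d : nat) (I : nat -> set R)
    (X : 'rV[R]_k -> 'rV[R]_d) (h : 'rV[R]_k -> R) : R :=
  box_integral I (fun u => h u * Num.sqrt (\det (gram X u))).

(** * The unit sphere S^(n-1) of R^n *)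

Definition sphere (R : realType) (n : nat) : set 'rV[R]_n :=
  [set w | dot w w = 1].

(** Spherical coordinates
    (cos t0, sin t0 cos t1, sin t0 sin t1 cos t2, ..., sin t0 ... sin t(n-2)),
    with all angles in [0, pi] but the last one, which is in [0, 2 pi]. *)
Definition sph (R : realType) (n : nat) (t : 'rV[R]_n.-1) : 'rV[R]_n :=
  \row_(i < n) ((\prod_(j < n.-1 | (j < i)%N) sin (t 0 j)) *
    (if insub (val i) is Some j then cos (t 0 (j : 'I_n.-1)) else 1)).

Definition sph_range (R : realType) (n j : nat) : set R :=
  if (j.+1 < n.-1)%N then `[0, pi]%classic else `[0, 2 * pi]%classic.

(** The spherical harmonics of order [m].  Functions on a compact submanifold
    are represented here and below by functions on the ambient space: the
    smooth ones are exactly the restrictions of smooth functions on the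
    ambient space, and every notion used depends only on the restriction. *)
Definition harmonics (R : realType) (n m : nat) : set ('rV[R]_n -> R) :=
  [set g | smooth_on setT g /\
    forall (U : set 'rV[R]_n.-1) (X : 'rV[R]_n.-1 -> 'rV[R]_n),
      local_param (@sphere R n) U X -> forall u, U u ->
      laplace_beltrami X g u = - (m%:R * (n%:R + m%:R - 2)) * g (X u)].

(** * The critical catenoid *)

Definition profile_solution (R : realType) (n : nat) (f : R -> R)
    (L : \bar R) : Prop :=
  [/\ f 0 = 1, derive1 f 0 = 0 &
    forall x : R, (`|x|%:E < L)%E ->
      [/\ derivable f x 1, derivable (derive1 f) x 1 &
          derive1 (derive1 f) x = (n%:R - 1) * f x ^+ (2 * n - 3)]].

(** The profile curve [cat_f] on its maximal interval ]-L, L[, the half-width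
    W and the radius R of the catenoid.  Since x f' - f is strictly increasing
    on ]0, L[, [cat_WE] determines [cat_W]. *)
Record profile (R : realType) (n : nat) := Profile {
  cat_f : R -> R;
  cat_L : \bar R;
  cat_W : R;
  cat_R : R;
  cat_L_gt0 : (0 < cat_L)%E;
  cat_f_sol : profile_solution n cat_f cat_L;
  cat_f_max : forall (g : R -> R) (L' : \bar R), profile_solution n g L' ->
    (forall x : R, (`|x|%:E < cat_L)%E -> g x = cat_f x) -> (L' <= cat_L)%E;
  cat_W_gt0 : 0 < cat_W;
  cat_W_lt : (cat_W%:E < cat_L)%E;
  cat_WE : cat_W * derive1 cat_f cat_W = cat_f cat_W;
  cat_R_gt0 : 0 < cat_R;
  cat_RE : cat_R ^+ 2 = cat_W ^+ 2 + cat_f cat_W ^+ 2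
}.

(** F(x, w) = (x / R, f(x) w / R) in R x R^n. *)
Definition catF (R : realType) (n : nat) (c : profile R n) (x : R)
    (w : 'rV[R]_n) : 'rV[R]_(1 + n) :=
  row_mx ((x / cat_R c)%:M : 'rV[R]_1) ((cat_f c x / cat_R c) *: w).

Definition catenoid (R : realType) (n : nat) (c : profile R n) :
    set 'rV[R]_(1 + n) :=
  [set p | exists x w, [/\ - cat_W c <= x <= cat_W c, sphere w &
    p = catF c x w]].

Definition cat_integral (R : realType) (n : nat) (c : profile R n)
    (h : 'rV[R]_(1 + n) -> R) : R :=
  let X := fun u : 'rV[R]_(1 + n.-1) =>
    catF c (lsubmx u 0 0) (sph (rsubmx u)) in
  volume_integral
    (fun j => if j is j'.+1 then sph_range n j'
              else `[- cat_W c, cat_W c]%classic)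
    X (fun u => h (X u)).

(** Functions on the boundary: pairs of functions of [w] in S^(n-1), for the
    components x = - W and x = W, in this order. *)
Definition bfun (R : realType) (n : nat) : Type :=
  (('rV[R]_n -> R) * ('rV[R]_n -> R))%type.

Definition beq (R : realType) (n : nat) (b b' : bfun R n) : Prop :=
  forall w, sphere w -> b.1 w = b'.1 w /\ b.2 w = b'.2 w.

Definition bscale (R : realType) (n : nat) (l : R) (b : bfun R n) : bfun R n :=
  (fun w => l * b.1 w, fun w => l * b.2 w).

Definition bsmooth (R : realType) (n : nat) (b : bfun R n) : Prop :=
  smooth_on setT b.1 /\ smooth_on setT b.2.

Definition boundary_integral (R : realType) (n : nat) (c : profile R n)
    (x : R) (h : 'rV[R]_n -> R) : R :=
  volume_integral (sph_range n)
    (fun t : 'rV[R]_n.-1 => catF c x (sph t)) (fun t => h (sph t)).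

Definition bdot (R : realType) (n : nat) (c : profile R n)
    (b b' : bfun R n) : R :=
  boundary_integral c (- cat_W c) (fun w => b.1 w * b'.1 w) +
  boundary_integral c (cat_W c) (fun w => b.2 w * b'.2 w).

Definition trace (R : realType) (n : nat) (c : profile R n)
    (phi : 'rV[R]_(1 + n) -> R) : bfun R n :=
  (fun w => phi (catF c (- cat_W c) w), fun w => phi (catF c (cat_W c) w)).

(** The unit tangent of the meridian x |-> F(x, w); the meridians are
    orthogonal to the spheres x = const, so that the outward unit conormal is
    its opposite at x = - W and itself at x = W. *)
Definition meridian (R : realType) (n : nat) (c : profile R n) (x : R)
    (w : 'rV[R]_n) : 'rV[R]_(1 + n) :=
  let T := derive1 (fun y => catF c y w) x in (Num.sqrt (dot T T))^-1 *: T.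

Definition conormal_derivative (R : realType) (n : nat) (c : profile R n)
    (phi : 'rV[R]_(1 + n) -> R) : bfun R n :=
  (fun w => 'D_(- meridian c (- cat_W c) w) phi (catF c (- cat_W c) w),
   fun w => 'D_(meridian c (cat_W c) w) phi (catF c (cat_W c) w)).

(** * The Dirichlet to Neumann operator *)

(** Smooth solutions of J phi = 0 on M.  Parametrizations by open sets only
    reach the interior of M; on the boundary J phi = 0 follows by continuity.
    Tr(A^2) does not depend on the choice of the unit normal. *)
Definition jacobi_function (R : realType) (n : nat) (c : profile R n)
    (phi : 'rV[R]_(1 + n) -> R) : Prop :=
  smooth_on setT phi /\
  forall (U : set 'rV[R]_n) (X : 'rV[R]_n -> 'rV[R]_(1 + n)),
    local_param (catenoid c) U X -> forall u N, U u -> unit_normal X u N ->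
    jacobi X phi u N = 0.

Definition kerJ (R : realType) (n : nat) (c : profile R n) :
    set ('rV[R]_(1 + n) -> R) :=
  [set phi | jacobi_function c phi /\
             beq (trace c phi) (fun=> 0, fun=> 0)].

Definition steklovV (R : realType) (n : nat) (c : profile R n) :
    set (bfun R n) :=
  [set b | bsmooth b /\
    forall phi, kerJ c phi -> bdot c b (conormal_derivative c phi) = 0].

(** [b' = pi b]: [b'] is in V and [b - b'] is in the finite dimensional space
    of the conormal derivatives of Ker J. *)
Definition steklov_proj (R : realType) (n : nat) (c : profile R n)
    (b b' : bfun R n) : Prop :=
  steklovV c b' /\
  exists2 psi, kerJ c psi &
    beq b (fun w => b'.1 w + (conormal_derivative c psi).1 w,
           fun w => b'.2 w + (conormal_derivative c psi).2 w).

Definition jacobi_extension (R : realType) (n : nat) (c : profile R n)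
    (b : bfun R n) (phi : 'rV[R]_(1 + n) -> R) : Prop :=
  [/\ jacobi_function c phi, beq (trace c phi) b &
      forall psi, kerJ c psi -> cat_integral c (fun p => phi p * psi p) = 0].

(** The graph of DN : V -> V. *)
Definition DN (R : realType) (n : nat) (c : profile R n)
    (b b' : bfun R n) : Prop :=
  steklovV c b /\
  exists2 phi, jacobi_extension c b phi &
    steklov_proj c (conormal_derivative c phi) b'.

Definition DN_eigenvalue_on (R : realType) (n : nat) (c : profile R n)
    (E : set (bfun R n)) (l : R) : Prop :=
  exists b, [/\ E b, ~ beq b (fun=> 0, fun=> 0) & DN c b (bscale l b)].

Definition is_Lambda0 (R : realType) (n : nat) (c : profile R n) (m : nat)
    (l : R) : Prop :=
  DN_eigenvalue_on c [set b | exists2 g, @harmonics R n m g & b = (g, g)] l.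

Definition is_Lambda1 (R : realType) (n : nat) (c : profile R n) (m : nat)
    (l : R) : Prop :=
  DN_eigenvalue_on c
    [set b | exists2 g, @harmonics R n m g & b = (g, fun w => - g w)] l.

(* Main.v *)
Require Import Defs.
From HB Require Import structures.
From mathcomp Require Import all_boot all_order all_algebra.
From mathcomp Require Import all_classical all_reals all_analysis.
From mathcomp Require Import perm ring lra zify.
Set Implicit Arguments.
Unset Strict Implicit.
Unset Printing Implicit Defensive.
Import Order.TTheory GRing.Theory Num.Theory.
Import numFieldNormedType.Exports.
Local Open Scope classical_set_scope.
Local Open Scope ring_scope.

(** The proof rests on an explicit Jacobi function.  Let N = n - 1,
    z = f' / f ^ N and let H be the power series solution, even or odd, of the
    Gegenbauer equation
      (1 - z^2) H'' = (2 + gam) z H' + eta H,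
      gam = (N + 2 m - 1) / N,   eta = ((m - 1) / N) (2 + m / N).
    Then psi(x) = f(x) ^ (- (N + m - 1)) H(z(x)) solves the equation to which the
    Jacobi equation reduces for functions psi(x) g(w), with g a spherical harmonic
    of order m ([derive_rad_psi1], [cat_separated_jacobi]).  For the
    reduction, the Laplace-Beltrami operator of a hypersurface is written in
    terms of derivatives in the ambient space ([hypersurface_laplace]); the
    sphere and the catenoid are then treated alike, by implicit equations
    ([harmonics_pde], [cat_jacobi]).

    Uniqueness of Dirichlet extensions may fail, and the operator is only defined
    modulo the kernel; but the separated solution and the extension used by the
    operator differ by an element of the kernel, whose conormal derivative is
    (l - W psi'(W) / psi(W)) b on the boundary.  As b is orthogonal to such
    derivatives and has positive norm, l = W psi'(W) / psi(W)
    ([steklov_eigenvalue], [boundary_integral_gt0]).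

    Because W f'(W) = f(W), this number is m - N Y(W) / (z(W) H(z(W))) with
    Y = gam z H - (1 - z^2) H', and Y' = (gam - eta) N f ^ (- N - 1) H
    ([rad_eigenvalue], [derive_Y]).  Let rho = m Log(n) / n, which is small by
    assumption.  One has N W <= 2 f(W) and f(W) ^ (N - 1) <= n ([NW_le],
    [F_pow_le]), so that f(W) ^ (2 m) = 1 + O(rho), z(W) = 1 + O(1 / N) and
    f'(W) >= N / 2.  In the odd case H is close to f', so that H >= N / 2 at W,
    while Y(0) = -1 and Y(W) = -1 + (1 + O(rho)) = O(rho) ([odd_Y]): the
    eigenvalue is m + O(rho).  In the even case Y(0) = 0 and
    Y(W) = 1 + O(rho), while H(z(W)) = m (1 + O(rho)), because
    H - 1 is close to eta (N W / 2) f' at W, and eta N / 2 is close to m - 1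
    ([even_Y_le], [even_P_W_le], [even_P_W_ge], [even_h_W_le],
    [even_h_W_ge]): the eigenvalue is m - (n / m) (1 + O(rho)). *)

(** * Directional derivatives *)

Section Directional.
Variable R : realType.

Lemma derive_scale (V W : normedModType R) (f : V -> W) (a v : V) (t : R) :
  differentiable f a -> 'D_(t *: v) f a = t *: 'D_v f a.
Proof. by move=> df; rewrite !deriveE// linearZ. Qed.

Lemma derive_partial k (W : normedModType R) (f : 'rV[R]_k -> W) (a v : 'rV[R]_k) :
  differentiable f a -> 'D_v f a = \sum_i v 0 i *: partial i f a.
Proof.
move=> df; rewrite deriveE// {1}(row_sum_delta v) linear_sum; apply: eq_bigr => i _.
by rewrite linearZ /partial deriveE.
Qed.

Lemma derive_comp (U V W : normedModType R) (f : U -> V) (g : V -> W) (a v : U) :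
  differentiable f a -> differentiable g (f a) ->
  'D_v (g \o f) a = 'D_('D_v f a) g (f a).
Proof.
move=> df dg; rewrite !deriveE//; last exact: differentiable_comp.
by rewrite diff_comp.
Qed.

Lemma derive_coord m n (V : normedModType R) (M : V -> 'M[R]_(m, n)) t v i j :
  derivable M t v -> 'D_v M t i j = 'D_v (fun s => M s i j) t.
Proof. by move=> dM; rewrite derive_mx// mxE. Qed.

Lemma differentiable_entry m n (V : normedModType R) (M : V -> 'M[R]_(m, n)) t i j :
  differentiable M t -> differentiable (fun s => M s i j) t.
Proof.
move=> dM; apply: (@differentiable_comp _ _ _ _ M (fun N : 'M[R]_(m, n) => N i j)) => //.
exact: differentiable_coord.
Qed.

Lemma differentiable_mx m n (V : normedModType R) (M : V -> 'M[R]_(m, n)) t :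
  (forall i j, differentiable (fun s => M s i j) t) -> differentiable M t.
Proof.
move=> dM.
have -> : M = \sum_(i < m) \sum_(j < n) (fun s => M s i j *: delta_mx i j).
  apply/funext => s; rewrite [LHS]matrix_sum_delta fct_sumE; apply: eq_bigr => i _.
  by rewrite fct_sumE.
apply: differentiable_sum => i; apply: differentiable_sum => j.
exact: differentiableZl.
Qed.

Lemma differentiable_near_eq (V W : normedModType R) (f g : V -> W) a :
  (\near a, f a = g a) -> differentiable f a -> differentiable g a.
Proof.
move=> fg df.
have cdf : continuous ('d f a) by exact: diff_continuous.
have fga : f a = g a by exact: nbhs_singleton fg.
have E : g \o shift a = cst (g a) + 'd f a +o_ 0 id.
  apply/eqaddoP => e e0.
  have /eqaddoP/(_ e e0) := diff_locally df.
  have : \forall x \near (0 : V), f (x + a) = g (x + a).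
    by rewrite (near_shift a)/=; near do rewrite /= sub0r subrK.
  apply: filter_app2; near=> x => E.
  by rewrite /= !fctE/= E fga.
have dE := diff_unique cdf E.
by apply/diff_locallyP; rewrite dE.
Unshelve. all: by end_near. Qed.

End Directional.

Section Schwarz.
Variables (R : realType) (V : normedModType R).

(** Taylor's formula for the second difference: the mean value theorem applied to
    s |-> f (p + t v + s w) - f (p + s w) reduces it to an increment of the
    derivative, which is controlled by the differentiability of ['D_w f] at [p]. *)
Lemma second_difference (f : V -> R) (p v w : V) (e : R) :
  0 < e -> (\forall x \near p, differentiable f x) -> differentiable ('D_w f) p ->
  \forall t \near (0 : R), 0 < t ->
    `|f (p + t *: v + t *: w) - f (p + t *: v) - f (p + t *: w) + f p
       - t ^+ 2 * 'D_v ('D_w f) p| <= e * t ^+ 2.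
Proof.
move=> e0 df dg.
pose k := `|v| + 2 * `|w| + 1.
have k0 : 0 < k by rewrite /k; have := normr_ge0 v; have := normr_ge0 w; lra.
have := diff_locally dg => /eqaddoP/(_ (e / k)) /(_ (divr_gt0 e0 k0)) rem.
have df0 : \forall h \near (0 : V), differentiable f (h + p).
  by rewrite (near_shift p)/=; near do rewrite /= sub0r subrK.
have : \forall h \near (0 : V), differentiable f (h + p) /\
    `|'D_w f (h + p) - 'D_w f p - 'd ('D_w f) p h| <= e / k * `|h|.
  near=> h; split; first by near: h.
  have : `| ('D_w f \o shift p - (cst ('D_w f p) + 'd ('D_w f) p)) h| <= e / k * `|h|.
    by near: h.
  by rewrite !fctE /= opprD addrA.
move=> /nbhs_ballP[d /= d0 dP].
near=> t => t0.
have tk : t * k < d.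
  rewrite -ltr_pdivlMr//; apply: le_lt_trans (ler_norm _) _.
  near: t; apply/nbhs_ballP; exists (d / k); first exact: divr_gt0.
  by move=> x; rewrite -ball_normE /= sub0r normrN.
have small s : 0 <= s <= t -> `|t *: v + s *: w| <= t * `|v| + t * `|w| /\ `|s *: w| <= t * `|w|.
  move=> /andP[s0 st]; split.
    rewrite (le_trans (ler_normD _ _))// !normrZ (ger0_norm s0) (gtr0_norm t0).
    by rewrite lerD2l ler_wpM2r.
  by rewrite normrZ ger0_norm// ler_wpM2r.
have v0 := normr_ge0 v; have w0 := normr_ge0 w.
have tkE : t * k = t * `|v| + 2 * (t * `|w|) + t by rewrite /k; ring.
have tv0 : 0 <= t * `|v| by rewrite mulr_ge0// ltW.
have tw0 : 0 <= t * `|w| by rewrite mulr_ge0// ltW.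
have dP1 s : 0 <= s <= t -> differentiable f (t *: v + s *: w + p) /\
  `|'D_w f (t *: v + s *: w + p) - 'D_w f p - 'd ('D_w f) p (t *: v + s *: w)|
    <= e / k * (t * `|v| + t * `|w|).
  move=> /small[s1 s2]; have [|? H] := dP (t *: v + s *: w).
    by rewrite -ball_normE /= sub0r normrN; lra.
  by split=> //; rewrite (le_trans H)// ler_wpM2l// divr_ge0// ltW.
have dP2 s : 0 <= s <= t -> differentiable f (s *: w + p) /\
  `|'D_w f (s *: w + p) - 'D_w f p - 'd ('D_w f) p (s *: w)|
    <= e / k * (t * `|w|).
  move=> /small[s1 s2]; have [|? H] := dP (s *: w).
    by rewrite -ball_normE /= sub0r normrN; lra.
  by split=> //; rewrite (le_trans H)// ler_wpM2l// divr_ge0// ltW.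
have line q s : differentiable f (s *: w + q) ->
    is_derive s 1 (fun s => f (s *: w + q)) ('D_w f (s *: w + q)).
  move=> dfs.
  have dl : is_diff s (fun s : R => s *: w + q) (fun s : R => s *: w).
    have -> : (fun s : R => s *: w) = ( *:%R ^~ w) + 0 by rewrite addr0.
    exact: is_diffD.
  have dd : differentiable (f \o (fun s : R => s *: w + q)) s.
    exact: differentiable_comp.
  apply: DeriveDef; first exact: diff_derivable.
  rewrite [LHS](@derive_comp _ _ _ _ (fun s : R => s *: w + q) f)//.
  by congr ('D__ _ _); rewrite deriveE// diff_val scale1r.
pose phi s : R := f (s *: w + (t *: v + p)) - f (s *: w + p).
have dphi s : 0 <= s <= t ->
    is_derive s 1 phi ('D_w f (s *: w + (t *: v + p)) - 'D_w f (s *: w + p)).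
  move=> st; apply: is_deriveB; apply: line.
    by rewrite addrA [s *: w + _]addrC; exact: (dP1 _ st).1.
  exact: (dP2 _ st).1.
have [c c0t] : exists2 c, c \in `]0, t[ & phi t - phi 0 =
    ('D_w f (c *: w + (t *: v + p)) - 'D_w f (c *: w + p)) * (t - 0).
  apply: MVT => // [x|].
    by rewrite in_itv/= => /andP[? ?]; apply: dphi; rewrite !ltW.
  apply: derivable_within_continuous => x.
  by rewrite in_itv/= => ?; exact: (@ex_derive _ _ _ _ _ _ _ (dphi _ _)).
rewrite subr0 /phi !scale0r !add0r => E.
have c01 : 0 <= c <= t by move: c0t; rewrite in_itv/= => /andP[? ?]; rewrite !ltW.
have [_ H1] := dP1 _ c01; have [_ H2] := dP2 _ c01.
have E2 : 'd ('D_w f) p (t *: v + c *: w) = t * 'D_v ('D_w f) p + 'd ('D_w f) p (c *: w).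
  by rewrite linearD linearZ/= deriveE.
have -> : f (p + t *: v + t *: w) = f (t *: w + (t *: v + p)).
  by congr f; rewrite addrC [t *: v + p]addrC.
have -> : f (p + t *: v) = f (t *: v + p) by congr f; rewrite addrC.
have -> : f (p + t *: w) = f (t *: w + p) by congr f; rewrite addrC.
rewrite [c *: w + (t *: v + p)]addrA [c *: w + t *: v]addrC in E.
have -> : forall a b c d r : R, a - b - c + d - r = (a - c - (b - d)) - r by move=> *; ring.
rewrite E.
set A := 'D_w f _ in H1 E *; set B := 'D_w f (c *: w + p) in H2 E *.
set C := 'D_w f p in H1 H2; set D := 'D_v _ p in E2 *.
rewrite E2 in H1; set L := 'd _ p _ in H1 H2.
have -> : (A - B) * t - t ^+ 2 * D = t * ((A - C - (t * D + L)) - (B - C - L)) by ring.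
rewrite normrM (gtr0_norm t0) expr2 mulrCA ler_pM2l//.
rewrite (le_trans (ler_normB _ _))// (le_trans (lerD H1 H2))//.
rewrite -mulrDr mulrAC ler_pdivrMr// -mulrA ler_wpM2l ?ltW// tkE; lra.
Unshelve. all: by end_near. Qed.

Lemma quotient_close (K : realFieldType) (a D1 D2 T e : K) : 0 < T ->
  `|a - T * D1| <= e / 2 * T -> `|a - T * D2| <= e / 2 * T -> `|D1 - D2| <= e.
Proof.
move=> T0 H1 H2; rewrite -(@ler_pM2r _ T)//.
rewrite -[X in _ * X <= _](@gtr0_norm _ T)// -normrM.
have -> : (D1 - D2) * T = (a - T * D2) - (a - T * D1) by ring.
rewrite (le_trans (ler_normB _ _))// (le_trans (lerD H2 H1))//.
by rewrite -mulrDl -splitr.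
Qed.

(** Both iterated derivatives are the limit of the same symmetric second
    difference quotient. *)
Lemma derive_swap (f : V -> R) (p v w : V) :
  (\forall x \near p, differentiable f x) ->
  differentiable ('D_w f) p -> differentiable ('D_v f) p ->
  'D_v ('D_w f) p = 'D_w ('D_v f) p.
Proof.
move=> df dw dv; apply/eqP; rewrite -subr_eq0 -normr_le0.
suff close e : 0 < e -> `|'D_v ('D_w f) p - 'D_w ('D_v f) p| <= e.
  rewrite leNgt; apply/negP => d0; have := close _ (divr_gt0 d0 (ltr0Sn R 1)).
  by rewrite leNgt ltr_pdivrMr// ltr_pMr// ltr1n.
move=> e0.
have e20 : 0 < e / 2 by rewrite divr_gt0.
have Hw := second_difference v e20 df dw.
have Hv := second_difference w e20 df dv.
have [t [t0 [/(_ t0) Htw /(_ t0) Htv]]] : exists t : R, 0 < t /\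
   ((0 < t -> `|f (p + t *: v + t *: w) - f (p + t *: v) - f (p + t *: w) + f p
       - t ^+ 2 * 'D_v ('D_w f) p| <= e / 2 * t ^+ 2) /\
    (0 < t -> `|f (p + t *: w + t *: v) - f (p + t *: w) - f (p + t *: v) + f p
       - t ^+ 2 * 'D_w ('D_v f) p| <= e / 2 * t ^+ 2)).
  have [d /= d0 dP] := (nbhs_ballP _ _).1 (filterI Hw Hv).
  exists (d / 2); split; first by rewrite divr_gt0.
  apply: dP; rewrite -ball_normE /= sub0r normrN gtr0_norm ?divr_gt0//.
  by rewrite ltr_pdivrMr// mulr_natr mulr2n ltrDl.
have E : p + t *: w + t *: v = p + t *: v + t *: w by rewrite addrAC.
rewrite E [X in X + f p]addrAC in Htv.
exact: quotient_close (exprn_gt0 2 t0) Htw Htv.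
Qed.
End Schwarz.

(** * Determinants and Gram matrices *)

Section DetDerivative.
Variables (R : realType) (V : normedModType R).

Lemma differentiable_mul (f g : V -> R) x : differentiable f x -> differentiable g x ->
  differentiable (fun y => f y * g y) x.
Proof. exact: differentiableM. Qed.

Lemma is_derive_mul (f g : V -> R) x v (df dg : R) :
  is_derive x v f df -> is_derive x v g dg ->
  is_derive x v (fun y => f y * g y) (f x * dg + g x * df).
Proof. exact: is_deriveM. Qed.

Lemma is_derive_cmul (c : R) (f : V -> R) x v (df : R) :
  is_derive x v f df -> is_derive x v (fun y => c * f y) (c * df).
Proof. exact: is_deriveZ. Qed.

Lemma differentiable_bigsum (W : normedModType R) (I : Type) (r : seq I) (P : pred I)
    (F : I -> V -> W) x :
  (forall i, differentiable (F i) x) -> differentiable (fun y => \sum_(i <- r | P i) F i y) x.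
Proof.
move=> dF; rewrite -fct_sumE.
elim/big_ind : _ => [|f g df dg|i _]; last exact: dF.
  exact: differentiable_cst.
exact: differentiableD.
Qed.

Lemma is_derive_bigsum (W : normedModType R) (I : Type) (r : seq I) (P : pred I)
    (F : I -> V -> W) (dF : I -> W) x v :
  (forall i, is_derive x v (F i) (dF i)) ->
  is_derive x v (fun y => \sum_(i <- r | P i) F i y) (\sum_(i <- r | P i) dF i).
Proof.
move=> H; elim: r => [|i r IH].
  have -> : (fun y => \sum_(i <- [::] | P i) F i y) = cst 0.
    by apply/funext => y; rewrite big_nil.
  by rewrite big_nil; exact: is_derive_cst.
have -> : (fun y => \sum_(j <- i :: r | P j) F j y) =
    (if P i then F i else 0) + (fun y => \sum_(j <- r | P j) F j y).
  apply/funext => y; rewrite big_cons fctE; case: (P i) => //.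
  by rewrite [(0 : V -> W) y]/(0) add0r.
rewrite big_cons; case: (P i); first exact: is_deriveD.
by rewrite add0r.
Qed.

Lemma differentiable_bigprod (I : Type) (r : seq I) (P : pred I) (F : I -> V -> R) x :
  (forall i, differentiable (F i) x) -> differentiable (fun y => \prod_(i <- r | P i) F i y) x.
Proof.
move=> dF; rewrite -fct_prodE.
elim/big_ind : _ => [|f g df dg|i _]; last exact: dF.
  exact: differentiable_cst.
exact: differentiableM.
Qed.

Lemma is_derive_bigprod (I : eqType) (r : seq I) (F : I -> V -> R) (dF : I -> R) x v :
  uniq r -> (forall i, is_derive x v (F i) (dF i)) ->
  is_derive x v (fun y => \prod_(i <- r) F i y)
    (\sum_(i <- r) dF i * \prod_(j <- r | j != i) F j x).
Proof.
move=> + H; elim: r => [_|i r IH /= /andP[ir ur]].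
  have -> : (fun y => \prod_(i <- [::]) F i y) = cst 1.
    by apply/funext => y; rewrite big_nil.
  by rewrite big_nil; exact: is_derive_cst.
have -> : (fun y => \prod_(j <- i :: r) F j y) = F i * (fun y => \prod_(j <- r) F j y).
  by apply/funext => y; rewrite big_cons.
apply: (is_derive_eq (is_deriveM (H i) (IH ur))).
have Ep : \prod_(j <- r | j != i) F j x = \prod_(j <- r) F j x.
  rewrite big_seq_cond [RHS]big_seq; apply: eq_bigl => j.
  by case: eqVneq => [->|]; rewrite ?andbT// (negbTE ir).
rewrite big_cons big_cons eqxx /= Ep addrC mulrC; congr (_ + _).
rewrite [LHS]mulr_sumr [LHS]big_seq [RHS]big_seq; apply: eq_bigr => j jr.
rewrite big_cons; have -> : i != j by apply: contraNneq ir => ->.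
by rewrite mulrCA.
Qed.

Lemma differentiable_det k (G : V -> 'M[R]_k) x :
  (forall i j, differentiable (fun y => G y i j) x) ->
  differentiable (fun y => \det (G y)) x.
Proof.
move=> dG; apply: differentiable_bigsum => s.
apply: differentiable_mul; first exact: differentiable_cst.
exact: differentiable_bigprod.
Qed.

(** Jacobi's formula. *)
Lemma is_derive_det k (G : V -> 'M[R]_k) (dG : 'M[R]_k) x v :
  (forall i j, is_derive x v (fun y => G y i j) (dG i j)) ->
  is_derive x v (fun y => \det (G y)) (\tr (\adj (G x) *m dG)).
Proof.
move=> H.
pose row_repl i := \matrix_(a, b) (if a == i then dG i b else G x a b).
have : is_derive x v (fun y => \det (G y)) (\sum_(s : 'S_k) (-1) ^+ s *
    \sum_i dG i (s i) * \prod_(j | j != i) G x j (s j)).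
  apply: is_derive_bigsum => s.
  have Hp := is_derive_bigprod (index_enum_uniq 'I_k) (fun i => H i (s i)).
  exact: is_derive_cmul.
move=> Hd; apply: (is_derive_eq Hd).
under eq_bigr do rewrite mulr_sumr.
rewrite exchange_big /= mxtrace_mulC /mxtrace; apply: eq_bigr => i _.
transitivity (\det (row_repl i)).
  apply: eq_bigr => s _; congr (_ * _); rewrite [RHS](bigD1 i)//= mxE eqxx.
  by congr (_ * _); apply: eq_bigr => j /negbTE ji; rewrite mxE ji.
rewrite (expand_det_row _ i) mxE; apply: eq_bigr => j _.
rewrite mxE eqxx mxE; congr (_ * _); rewrite /cofactor; congr (_ * \det _).
apply/matrixP => a b; rewrite !mxE.
by rewrite eq_sym (negbTE (neq_lift _ _)).
Qed.

Lemma differentiable_cofactor k (G : V -> 'M[R]_k) x i j :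
  (forall i j, differentiable (fun y => G y i j) x) ->
  differentiable (fun y => cofactor (G y) i j) x.
Proof.
move=> dG; apply: differentiable_mul; first exact: differentiable_cst.
apply: differentiable_det => a b.
by under eq_fun do rewrite !mxE.
Qed.

End DetDerivative.

(** * The Laplace-Beltrami operator of a parametrized hypersurface *)

Section Dot.
Variables (R : realType) (d : nat).
Implicit Types u v w : 'rV[R]_d.

Lemma dotE u v : dot u v = (u *m v^T) 0 0.
Proof. by rewrite mxE; apply: eq_bigr => i _; rewrite mxE. Qed.

Lemma dotC u v : dot u v = dot v u.
Proof. by apply: eq_bigr => i _; rewrite mulrC. Qed.

Lemma dotDl u v w : dot (u + v) w = dot u w + dot v w.
Proof. by rewrite /dot -big_split; apply: eq_bigr => i _; rewrite mxE mulrDl. Qed.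

Lemma dotZl (t : R) u v : dot (t *: u) v = t * dot u v.
Proof. by rewrite /dot mulr_sumr; apply: eq_bigr => i _; rewrite mxE mulrA. Qed.

Lemma dotZr (t : R) u v : dot u (t *: v) = t * dot u v.
Proof. by rewrite dotC dotZl dotC. Qed.

Lemma dotDr u v w : dot u (v + w) = dot u v + dot u w.
Proof. by rewrite dotC dotDl !(dotC u). Qed.

Lemma dot0l u : dot 0 u = 0.
Proof. by rewrite -(scale0r u) dotZl mul0r. Qed.

Lemma dot0r u : dot u 0 = 0.
Proof. by rewrite dotC dot0l. Qed.

Lemma dot_suml (I : finType) (F : I -> 'rV[R]_d) w :
  dot (\sum_i F i) w = \sum_i dot (F i) w.
Proof.
rewrite /dot [RHS]exchange_big; apply: eq_bigr => i _.
by rewrite summxE mulr_suml.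
Qed.

Lemma dot_ge0 u : 0 <= dot u u.
Proof. by apply: sumr_ge0 => i _; exact: sqr_ge0. Qed.

Lemma dot_eq0 u : (dot u u == 0) = (u == 0).
Proof.
apply/idP/eqP => [|->]; last by rewrite /dot big1// => i _; rewrite mxE mul0r.
rewrite psumr_eq0 => [/allP H|i _]; last exact: sqr_ge0.
apply/rowP => i; rewrite mxE; apply/eqP; have := H i; rewrite mem_index_enum.
by move=> /(_ isT); rewrite mulf_eq0 orbb.
Qed.

Lemma differentiable_dot (V : normedModType R) (F G : V -> 'rV[R]_d) x :
  differentiable F x -> differentiable G x -> differentiable (fun y => dot (F y) (G y)) x.
Proof.
move=> dF dG; apply: differentiable_bigsum => i.
by apply: differentiable_mul; exact: differentiable_entry.
Qed.

Lemma is_derive_entry m n (V : normedModType R) (M : V -> 'M[R]_(m, n)) x (v : V) i j :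
  differentiable M x -> is_derive x v (fun y => M y i j) ('D_v M x i j).
Proof.
move=> dM; apply: DeriveDef; first by apply: diff_derivable; exact: differentiable_entry.
by rewrite derive_coord//; exact: diff_derivable.
Qed.

Lemma is_derive_dot (V : normedModType R) (F G : V -> 'rV[R]_d) x (v : V) :
  differentiable F x -> differentiable G x ->
  is_derive x v (fun y => dot (F y) (G y)) (dot ('D_v F x) (G x) + dot (F x) ('D_v G x)).
Proof.
move=> dF dG.
have H i := is_derive_mul (is_derive_entry v 0 i dF) (is_derive_entry v 0 i dG).
apply: (is_derive_eq (is_derive_bigsum _ _ H)).
rewrite /dot -big_split; apply: eq_bigr => i _ /=.
by rewrite addrC; congr (_ + _); rewrite mulrC.
Qed.

End Dot.

Lemma sum_delta (R : pzRingType) (k : nat) (F : 'I_k -> R) l :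
  \sum_i F i * (i == l)%:R = F l.
Proof.
rewrite (bigD1 l)//= eqxx mulr1 big1 ?addr0// => i /negbTE ->.
by rewrite mulr0.
Qed.

Lemma trace_sym (R : comPzRingType) (k : nat) (M : 'M[R]_k) (b : 'I_k -> 'I_k -> R) :
  M^T = M -> \tr (M *m \matrix_(i, j) (b i j + b j i)) =
             2 * \sum_i \sum_j M i j * b i j.
Proof.
move=> Ms; have Mji i j : M j i = M i j by rewrite -[in LHS]Ms mxE.
transitivity (\sum_i \sum_j (M i j * b i j + M j i * b j i)).
  rewrite /mxtrace; apply: eq_bigr => i _; rewrite mxE; apply: eq_bigr => j _.
  by rewrite mxE mulrDr addrC Mji.
under eq_bigr do rewrite big_split.
rewrite big_split mulr2n mulrDl mul1r; congr (_ + _); exact: exchange_big.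
Qed.

Section Parametrization.
Variables (R : realType) (k d : nat) (U : set 'rV[R]_k) (X : 'rV[R]_k -> 'rV[R]_d).
Hypotheses (oU : open U) (sX : smooth_on U X).

Lemma smooth_differentiable u : U u -> differentiable X u.
Proof. exact: (sX [::]). Qed.

Lemma smooth_differentiable2 v u : U u -> differentiable ('D_v X) u.
Proof. exact: (sX [:: v]). Qed.

Lemma near_open u : U u -> \forall w \near u, U w.
Proof. by move=> Uu; apply: open_nbhs_nbhs. Qed.

Lemma partial_swap i j u : U u -> partial i (partial j X) u = partial j (partial i X) u.
Proof.
move=> Uu; apply/rowP => a.
have P v w : 'D_v ('D_w X) u 0 a = 'D_v ('D_w (fun y => X y 0 a)) u.
  rewrite derive_coord; last by apply: diff_derivable; exact: smooth_differentiable2.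
  apply: near_eq_derive; near=> y; rewrite derive_coord//.
  apply/diff_derivable/smooth_differentiable.
  by near: y; exact: near_open.
have D v : differentiable ('D_v (fun y => X y 0 a)) u.
  apply: (@differentiable_near_eq _ _ _ (fun y => 'D_v X y 0 a)).
    near=> y; rewrite derive_coord//; apply/diff_derivable/smooth_differentiable.
    by near: y; exact: near_open.
  by apply: differentiable_entry; exact: smooth_differentiable2.
rewrite [LHS]P [RHS]P.
apply: (@derive_swap _ _ (fun y => X y 0 a)); [|exact: D|exact: D].
near=> y; apply: differentiable_entry; apply: smooth_differentiable.
by near: y; exact: near_open.
Unshelve. all: by end_near. Qed.

Lemma differentiable_gram i j u : U u -> differentiable (fun w => gram X w i j) u.
Proof.
move=> Uu; under eq_fun do rewrite mxE.
by apply: differentiable_dot; exact: smooth_differentiable2.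
Qed.

Lemma is_derive_gram v i j u : U u -> is_derive u v (fun w => gram X w i j)
  (dot ('D_v (partial i X) u) (partial j X u) + dot (partial i X u) ('D_v (partial j X) u)).
Proof.
move=> Uu; under eq_fun do rewrite mxE.
by apply: is_derive_dot; exact: smooth_differentiable2.
Qed.

Lemma gramE i j u : gram X u i j = dot (partial i X u) (partial j X u).
Proof. exact: mxE. Qed.

Lemma gram_sym u : (gram X u)^T = gram X u.
Proof. apply/matrixP => i j; rewrite [LHS]mxE (gramE j i) (gramE i j); exact: dotC. Qed.

Hypothesis gram_det : forall u, U u -> 0 < \det (gram X u).

(** The matrix |g|^(1/2) g^(ij), which is differentiable and satisfies
    C g = |g|^(1/2). *)
Let C u := Num.sqrt (\det (gram X u)) *: invmx (gram X u).
Let sq u := Num.sqrt (\det (gram X u)).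

Let gram_unit u : U u -> gram X u \in unitmx.
Proof. by move=> Uu; rewrite unitmxE unitfE gt_eqF// gram_det. Qed.

Lemma is_derive_sqrt_gram u v : U u -> is_derive u v sq
   (2^-1 * sq u * \tr (invmx (gram X u) *m \matrix_(i, j) 'D_v (fun w => gram X w i j) u)).
Proof.
move=> Uu; have d0 := gram_det Uu.
have Hd : is_derive u v (fun w => \det (gram X w)) (\tr (\adj (gram X u) *m \matrix_(i, j) 'D_v (fun w => gram X w i j) u)).
  apply: is_derive_det => i j; rewrite mxE; apply: derivableP.
  exact: (@ex_derive _ _ _ _ _ _ _ (is_derive_gram _ _ _ _)).
have dd : differentiable (fun w => \det (gram X w)) u.
  by apply: differentiable_det => i j; exact: differentiable_gram.
have ds : differentiable Num.sqrt (\det (gram X u)).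
  by apply/derivable1_diffP; exact: (@ex_derive _ _ _ _ _ _ _ (is_derive1_sqrt d0)).
have -> : sq = Num.sqrt \o (fun w => \det (gram X w)) by [].
apply: DeriveDef; first by apply: diff_derivable; exact: differentiable_comp.
rewrite derive_comp// derive_val.
rewrite -[X in 'D_X _ _]mulr1 derive_scale// derive_sqrt// /invmx gram_unit// -scalemxAl mxtraceZ.
rewrite /GRing.scale/= /sq.
move: (\tr _) (\det _) d0 => T D D0.
have s0 : Num.sqrt D != 0 by rewrite gt_eqF// sqrtr_gt0.
have DE : Num.sqrt D * Num.sqrt D = D by rewrite -expr2 sqr_sqrtr ?ltW.
move: (Num.sqrt D) s0 DE {D0} => s s0 <-.
by field; exact: s0.
Qed.

Lemma differentiable_sqrt_gram u : U u -> differentiable sq u.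
Proof.
move=> Uu; have -> : sq = Num.sqrt \o (fun w => \det (gram X w)) by [].
apply: differentiable_comp; first by apply: differentiable_det => i j; exact: differentiable_gram.
by apply/derivable1_diffP; exact: (@ex_derive _ _ _ _ _ _ _ (is_derive1_sqrt (gram_det Uu))).
Qed.

Lemma differentiable_C i j u : U u -> differentiable (fun w => C w i j) u.
Proof.
move=> Uu.
apply: (@differentiable_near_eq _ _ _ 
   (fun w => sq w * ((\det (gram X w))^-1 * cofactor (gram X w) j i))).
  near=> w; rewrite /C mxE /invmx gram_unit ?mxE//.
  by near: w; exact: near_open.
have dg a b := differentiable_gram a b Uu.
apply: differentiable_mul; first exact: differentiable_sqrt_gram.
apply: differentiable_mul; last exact: differentiable_cofactor.
apply: differentiableV; first exact: differentiable_det.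
by rewrite gt_eqF// gram_det.
Unshelve. all: by end_near. Qed.


Let V i w : 'rV[R]_d := \sum_j C w i j *: partial j X w.

Lemma differentiable_V i u : U u -> differentiable (V i) u.
Proof.
move=> Uu; apply: differentiable_mx => a b.
have -> : (fun w => V i w a b) = (fun w => \sum_j C w i j * partial j X w a b).
  by apply/funext => w; rewrite /V summxE; apply: eq_bigr => j _; rewrite mxE.
apply: differentiable_bigsum => j; apply: differentiable_mul; first exact: differentiable_C.
by apply: differentiable_entry; exact: smooth_differentiable2.
Qed.

Lemma dot_V i l u : U u -> dot (V i u) (partial l X u) = sq u * (i == l)%:R.
Proof.
move=> Uu; rewrite dot_suml.
transitivity ((C u *m gram X u) i l).
  by rewrite mxE; apply: eq_bigr => j _; rewrite dotZl gramE.
by rewrite /C -scalemxAl mulVmx ?gram_unit// !mxE.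
Qed.

(** The mean curvature vector, that is the Laplace-Beltrami operator applied
    to the coordinates of [X]. *)
Definition mean_curvature u : 'rV[R]_d :=
  (sq u)^-1 *: \sum_i partial i (V i) u.

Let sq_neq0 u : U u -> sq u != 0.
Proof. by move=> Uu; rewrite gt_eqF// sqrtr_gt0 gram_det. Qed.

Let VE i u : U u -> (sq u)^-1 *: V i u = \sum_j invmx (gram X u) i j *: partial j X u.
Proof.
move=> Uu; rewrite /V scaler_sumr; apply: eq_bigr => j _.
by rewrite scalerA mxE mulKf// sq_neq0.
Qed.

(** By Jacobi's formula and the symmetry of second derivatives, the derivative of
    the volume factor cancels the tangential part of the second derivatives of
    [X]. *)
Lemma mean_curvature_normal u l : U u -> dot (mean_curvature u) (partial l X u) = 0.
Proof.
move=> Uu; rewrite dotZl; apply/eqP; rewrite mulf_eq0; apply/orP; right; apply/eqP.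
rewrite dot_suml.
have E i : dot (partial i (V i) u) (partial l X u) =
    'D_(delta_mx 0 i) sq u * (i == l)%:R - dot (V i u) (partial i (partial l X) u).
  have H1 := is_derive_dot (delta_mx 0 i) (differentiable_V i Uu)
    (smooth_differentiable2 (delta_mx 0 l) Uu).
  have -> : 'D_(delta_mx 0 i) sq u * (i == l)%:R =
     'D_(delta_mx 0 i) (fun y => dot (V i y) (partial l X y)) u.
    have H2 : is_derive u (delta_mx 0 i) (fun w => (i == l)%:R * sq w) ((i == l)%:R * 'D_(delta_mx 0 i) sq u).
      by apply: is_derive_cmul; apply: derivableP; apply: diff_derivable; exact: differentiable_sqrt_gram.
    rewrite mulrC -(@derive_val _ _ _ _ _ _ _ H2); apply: near_eq_derive; near=> w.
    rewrite dot_V 1?mulrC//; near: w; exact: near_open.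
  by rewrite (@derive_val _ _ _ _ _ _ _ H1) addrK.
transitivity ('D_(delta_mx 0 l) sq u - \sum_i dot (V i u) (partial i (partial l X) u)).
  rewrite (eq_bigr _ (fun i _ => E i)) sumrB; congr (_ - _).
  exact: (sum_delta (fun i => 'D_(delta_mx 0 i) sq u)).
rewrite (@derive_val _ _ _ _ _ _ _ (is_derive_sqrt_gram _ Uu)).
pose b i j := dot (partial i (partial l X) u) (partial j X u).
have EV i : dot (V i u) (partial i (partial l X) u) =
    sq u * \sum_j invmx (gram X u) i j * b i j.
  have -> : V i u = sq u *: ((sq u)^-1 *: V i u) by rewrite scalerA mulfV ?scale1r// sq_neq0.
  rewrite VE// dotZl dot_suml; congr (_ * _); apply: eq_bigr => j _.
  by rewrite dotZl /b dotC.
have ED : \matrix_(i, j) 'D_(delta_mx 0 l) (fun w => gram X w i j) u =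
    \matrix_(i, j) (b i j + b j i).
  apply/matrixP => i j; rewrite [LHS]mxE [RHS]mxE.
  rewrite (@derive_val _ _ _ _ _ _ _ (is_derive_gram _ _ _ Uu)).
  have PS a : 'D_(delta_mx 0 l) (partial a X) u = partial a (partial l X) u.
    exact: (partial_swap l a Uu).
  exact: (f_equal2 +%R (f_equal2 (@dot R d) (PS i) erefl)
     (etrans (dotC _ _) (f_equal2 (@dot R d) (PS j) erefl))).
rewrite ED trace_sym ?trmx_inv ?gram_sym//.
rewrite (eq_bigr _ (fun i _ => EV i)) -mulr_sumr.
by move: (sq u) (\sum_i \sum_j _) => s B; field.
Unshelve. all: by end_near. Qed.

Lemma mean_curvature_shape u N : U u -> unit_normal X u N ->
  dot (mean_curvature u) N = \tr (shape_operator X u N).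
Proof.
move=> Uu [_ NX]; rewrite dotZl dot_suml /shape_operator /mxtrace mulr_sumr.
apply: eq_bigr => i _; rewrite mxE.
have H j : is_derive u (delta_mx 0 i) (fun w => C w i j * dot (partial j X w) N)
    (C u i j * dot (partial i (partial j X) u) N).
  have dC : is_derive u (delta_mx 0 i) (fun w => C w i j) ('D_(delta_mx 0 i) (fun w => C w i j) u).
    by apply: derivableP; apply: diff_derivable; exact: differentiable_C.
  have dX := is_derive_dot (delta_mx 0 i) (smooth_differentiable2 (delta_mx 0 j) Uu)
    (differentiable_cst N u).
  apply: (is_derive_eq (is_derive_mul dC dX)).
  by rewrite [dot (partial j X u) N]dotC NX mul0r addr0 derive_cst dot0r addr0.
have H1 := is_derive_dot (delta_mx 0 i) (differentiable_V i Uu) (differentiable_cst N u).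
have -> : dot (partial i (V i) u) N = 'D_(delta_mx 0 i) (fun w => dot (V i w) N) u.
  by rewrite (@derive_val _ _ _ _ _ _ _ H1) derive_cst dot0r addr0.
have -> : (fun w => dot (V i w) N) = (fun w => \sum_j C w i j * dot (partial j X w) N).
  by apply/funext => w; rewrite dot_suml; apply: eq_bigr => j _; rewrite dotZl.
rewrite (@derive_val _ _ _ _ _ _ _ (is_derive_bigsum _ _ H)) mulr_sumr; apply: eq_bigr => j _.
rewrite mulrA; congr (_ * _); last by rewrite mxE partial_swap.
by rewrite mxE mulKf// sq_neq0.
Qed.

(** The chain rule: the first order part is the derivative along the mean
    curvature vector, the second order part is the Hessian contracted with the
    projection to the tangent space. *)
Lemma laplace_beltramiE (phi : 'rV[R]_d -> R) u : U u -> 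
  (forall p, differentiable phi p) -> (forall v p, differentiable ('D_v phi) p) ->
  laplace_beltrami X phi u = 'D_(mean_curvature u) phi (X u) +
    \sum_a \sum_b (\sum_i \sum_j invmx (gram X u) i j * partial i X u 0 b * partial j X u 0 a) *
      partial b (partial a phi) (X u).
Proof.
move=> Uu d1 d2.
have dX := smooth_differentiable Uu.
pose q a w := partial a phi (X w).
have dq a : differentiable (q a) u.
  by apply: (@differentiable_comp _ _ _ _ X (partial a phi)) => //; exact: d2.
have H i : partial (V := R) i (fun w => \sum_(j < k) Num.sqrt (\det (gram X w)) *
      invmx (gram X w) i j * partial (V := R) j (fun z => phi (X z)) w) u =
    \sum_a (V i u 0 a * 'D_(partial i X u) (partial a phi) (X u) + 
       partial a phi (X u) * partial i (V i) u 0 a).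
  have HV a : is_derive u (delta_mx 0 i) (fun w => V i w 0 a * q a w)
     (V i u 0 a * 'D_(partial i X u) (partial a phi) (X u) + 
       partial a phi (X u) * partial i (V i) u 0 a).
    apply: is_derive_mul.
      by apply: is_derive_entry; exact: differentiable_V.
    rewrite -derive_comp//; last exact: d2.
    by apply: derivableP; apply: diff_derivable; exact: dq.
  rewrite -(@derive_val _ _ _ _ _ _ _ (is_derive_bigsum _ _ HV)).
  apply: near_eq_derive; near=> w.
  have Uw : U w by near: w; exact: near_open.
  transitivity ('D_(V i w) phi (X w)).
    rewrite deriveE// /V linear_sum; apply: eq_bigr => j _.
    rewrite linearZ/= /C mxE; congr (_ * _).
    rewrite /partial -deriveE//.
    exact: (derive_comp _ (smooth_differentiable Uw) (d1 _)).
  by rewrite derive_partial//.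
rewrite /laplace_beltrami (eq_bigr _ (fun i _ => H i)) -/(sq u).
rewrite exchange_big /= mulr_sumr derive_partial// -big_split; apply: eq_bigr => a _ /=.
rewrite big_split mulrDr addrC; congr (_ + _); last first.
  rewrite -mulr_sumr mulrCA mulrC; congr (_ * _).
  by rewrite /mean_curvature mxE summxE.
have -> : \sum_b (\sum_i \sum_j invmx (gram X u) i j * partial i X u 0 b *
      partial j X u 0 a) * partial b (partial a phi) (X u) =
    \sum_i \sum_b (\sum_j invmx (gram X u) i j * partial i X u 0 b *
      partial j X u 0 a) * partial b (partial a phi) (X u).
  by rewrite [RHS]exchange_big; apply: eq_bigr => b _; rewrite mulr_suml.
rewrite mulr_sumr; apply: eq_bigr => i _.
have := VE i Uu => /rowP/(_ a); rewrite mxE => E.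
rewrite mulrA E derive_partial; last exact: d2.
rewrite mulr_sumr; apply: eq_bigr => b _.
rewrite /GRing.scale/= mulrA; congr (_ * _).
rewrite summxE mulr_suml; apply: eq_bigr => j _.
by rewrite mxE mulrAC.
Unshelve. all: by end_near. Qed.

End Parametrization.

Section Hypersurface.
Variables (R : realType) (k : nat).
Implicit Types (D : 'M[R]_(k, 1 + k)) (N : 'rV[R]_(1 + k)).

Lemma det_frame D N : N *m N^T = 1%:M -> D *m N^T = 0 ->
  \det (D *m D^T) = \det (col_mx N D) ^+ 2.
Proof.
move=> NN DN; have ND : N *m D^T = 0 by rewrite -[N]trmxK -trmx_mul DN trmx0.
rewrite expr2 -{2}[\det (col_mx N D)]det_tr -det_mulmx tr_col_mx mul_col_row NN DN ND.
by rewrite det_lblock det1 mul1r.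
Qed.

(** The square matrix whose rows are a unit normal and a basis of the tangent
    space is invertible, and inverting it decomposes the identity into the two
    orthogonal projections. *)
Lemma tangent_projection D N : N *m N^T = 1%:M -> D *m N^T = 0 ->
  D *m D^T \in unitmx -> D^T *m invmx (D *m D^T) *m D = 1%:M - N^T *m N.
Proof.
move=> NN DN ug; have ND : N *m D^T = 0 by rewrite -[N]trmxK -trmx_mul DN trmx0.
set g := D *m D^T in ug *.
pose B := col_mx N D; pose Y := (block_mx 1%:M 0 0 (invmx g) : 'M[R]_(1 + k)).
have BY : B *m (B^T *m Y) = 1%:M.
  rewrite mulmxA tr_col_mx mul_col_row NN DN ND mulmx_block !mulmx1 !mulmx0 !mul0mx.
  by rewrite !addr0 !add0r mulmxV// -scalar_mx_block.
have := mulmx1C BY; rewrite /B /Y tr_col_mx mul_row_block mul_row_col.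
rewrite !mulmx1 !mulmx0 addr0 add0r => E.
by rewrite -[in RHS]E addrAC subrr add0r.
Qed.

Variables (U : set 'rV[R]_k) (X : 'rV[R]_k -> 'rV[R]_(1 + k)).

Definition tangent_frame u : 'M[R]_(k, 1 + k) := \matrix_(i, a) partial i X u 0 a.

Lemma gram_frame u : gram X u = tangent_frame u *m (tangent_frame u)^T.
Proof.
apply/matrixP => i j; rewrite gramE mxE; apply: eq_bigr => a _.
by rewrite [in RHS]mxE [X in _ = _ * X]mxE mxE.
Qed.

Lemma unit_normal_mx u N : unit_normal X u N ->
  N *m N^T = 1%:M /\ tangent_frame u *m N^T = 0.
Proof.
move=> [N1 NX]; split; first by rewrite [LHS]mx11_scalar -dotE N1.
apply/matrixP => i j; rewrite !mxE -[RHS](NX i) dotC; apply: eq_bigr => a _.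
by rewrite !mxE ord1.
Qed.

Lemma gram_det_gt0 u N : gram X u \in unitmx -> unit_normal X u N -> 0 < \det (gram X u).
Proof.
move=> ug /unit_normal_mx[NN DN]; rewrite lt0r -unitfE -unitmxE ug/=.
by rewrite gram_frame (det_frame NN DN) sqr_ge0.
Qed.

Lemma derive2_partial (phi : 'rV[R]_(1 + k) -> R) v w p :
  (forall p, differentiable phi p) -> (forall v p, differentiable ('D_v phi) p) ->
  'D_v ('D_w phi) p = \sum_a \sum_b (w 0 a * v 0 b) * partial b (partial a phi) p.
Proof.
move=> d1 d2.
have -> : 'D_w phi = fun y => \sum_a w 0 a * partial a phi y.
  by apply/funext => y; rewrite derive_partial.
have H a : is_derive p v (fun y => w 0 a * partial a phi y)
    (\sum_b (w 0 a * v 0 b) * partial b (partial a phi) p).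
  have Ha : is_derive p v (partial a phi) ('D_v (partial a phi) p).
    by apply: derivableP; apply: diff_derivable; exact: d2.
  apply: (is_derive_eq (is_derive_cmul (w 0 a) Ha)).
  rewrite derive_partial; last exact: d2.
  by rewrite mulr_sumr; apply: eq_bigr => b _; rewrite mulrA.
by rewrite (@derive_val _ _ _ _ _ _ _ (is_derive_bigsum _ _ H)).
Qed.

Hypothesis lp : open U /\ smooth_on U X.
Hypothesis unit_gram : forall u, U u -> gram X u \in unitmx.
Hypothesis normals : forall u, U u -> exists N, unit_normal X u N.

(** In codimension one the mean curvature vector is the trace of the shape
    operator times the normal and the tangential projection is the identity minus
    the normal one.  Laplace-Beltrami operators thus become explicit operators on
    the ambient space. *)
Lemma hypersurface_laplace phi u N : U u -> unit_normal X u N ->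
  (forall p, differentiable phi p) -> (forall v p, differentiable ('D_v phi) p) ->
  laplace_beltrami X phi u = \tr (shape_operator X u N) * 'D_N phi (X u) +
    (\sum_a partial a (partial a phi) (X u) - 'D_N ('D_N phi) (X u)).
Proof.
move=> Uu nN d1 d2; have [oU sX] := lp.
have gd v : U v -> 0 < \det (gram X v).
  by move=> Uv; have [N' /gram_det_gt0] := normals Uv; apply; exact: unit_gram.
have [NN DN] := unit_normal_mx nN.
have P := tangent_projection NN DN; rewrite -gram_frame in P.
have {}P := P (unit_gram Uu).
rewrite (laplace_beltramiE oU sX gd Uu d1 d2); congr (_ + _).
  set H := mean_curvature X u.
  have HX l : dot H (partial l X u) = 0 by exact: (mean_curvature_normal oU sX gd).
  have <- : dot H N = \tr (shape_operator X u N) by exact: (mean_curvature_shape oU sX gd).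
  have HD : H *m (tangent_frame u)^T = 0.
    apply/matrixP => i j; rewrite ord1 [RHS]mxE -[RHS](HX j) mxE; apply: eq_bigr => a _.
    by rewrite !mxE.
  have : H *m (1%:M - N^T *m N) = 0 by rewrite -P !mulmxA HD !mul0mx.
  rewrite mulmxBr mulmx1 mulmxA [H *m N^T]mx11_scalar -dotE mul_scalar_mx => /eqP.
  rewrite subr_eq0 => /eqP {1}->.
  by rewrite derive_scale.
rewrite (derive2_partial _ _ _ d1 d2) -sumrB; apply: eq_bigr => a _.
rewrite -(@sum_delta R _ (fun b => partial b (partial a phi) (X u)) a) -sumrB.
apply: eq_bigr => b _.
transitivity ((1%:M - N^T *m N) b a * partial b (partial a phi) (X u)).
  congr (_ * _); rewrite -P mxE exchange_big; apply: eq_bigr => j _.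
  rewrite mxE mulr_suml; apply: eq_bigr => i _.
  by rewrite !mxE; congr (_ * _); rewrite mulrC.
rewrite !mxE big_ord1 !mxE mulrBl mulrC; congr (_ - _ * _); last by rewrite mulrC.
Qed.

End Hypersurface.

(** * Smooth functions *)

Section Smooth.
Variable R : realType.

Lemma is_derive_derivable (V W : normedModType R) (f : V -> W) x v df :
  is_derive x v f df -> derivable f x v.
Proof. by move=> H; exact: ex_derive. Qed.

(** Being [n + 1] times differentiable, for functions of one real variable, on
    a set that need not be open: the derivatives are given as functions which
    may be arbitrary outside [A]. *)
Fixpoint ndiff1 (A : set R) (n : nat) (a : R -> R) : Prop :=
  if n is n'.+1 then exists a', (forall x, A x -> is_derive x 1 a (a' x)) /\ ndiff1 A n' a'
  else forall x, A x -> derivable a x 1.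

Lemma ndiff1_derivable A n a x : ndiff1 A n a -> A x -> derivable a x 1.
Proof.
case: n => [Ha /Ha//|n [a' [Ha _]] /Ha]; exact: is_derive_derivable.
Qed.

Lemma ndiff1S A n a : ndiff1 A n.+1 a -> ndiff1 A n a.
Proof.
elim: n a => [|n IH] a [a' [Ha Ha']]; first by move=> x /Ha; exact: is_derive_derivable.
by exists a'; split => //; exact: IH.
Qed.

Lemma ndiff1_cst A n c : ndiff1 A n (cst c).
Proof.
elim: n c => [|n IH] c; first by move=> x _; exact: derivable_cst.
by exists (cst 0); split => // x _; exact: is_derive_cst.
Qed.

Lemma ndiff1_id A n : ndiff1 A n id.
Proof.
case: n => [x _|n]; first exact: derivable_id.
by exists (cst 1); split => [x _|]; [exact: is_derive_id|exact: ndiff1_cst].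
Qed.

Lemma ndiff1D A n a b : ndiff1 A n a -> ndiff1 A n b -> ndiff1 A n (fun x => a x + b x).
Proof.
elim: n a b => [|n IH] a b; first by move=> Ha Hb x Ax; apply: derivableD; [exact: Ha|exact: Hb].
move=> [a' [Ha Ha']] [b' [Hb Hb']]; exists (fun x => a' x + b' x); split; last exact: IH.
by move=> x Ax; apply: is_deriveD; [exact: Ha|exact: Hb].
Qed.

Lemma ndiff1M A n a b : ndiff1 A n a -> ndiff1 A n b -> ndiff1 A n (fun x => a x * b x).
Proof.
elim: n a b => [|n IH] a b; first by move=> Ha Hb x Ax; apply: derivableM; [exact: Ha|exact: Hb].
move=> da db; have := (da, db) => -[[a' [Ha Ha']] [b' [Hb Hb']]].
exists (fun x => a x * b' x + b x * a' x); split.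
  by move=> x Ax; apply: is_derive_mul; [exact: Ha|exact: Hb].
by apply: ndiff1D; apply: IH => //; exact: ndiff1S.
Qed.

Lemma ndiff1X A n a p : ndiff1 A n a -> ndiff1 A n (fun x => a x ^+ p).
Proof.
move=> Ha; elim: p => [|p IH]; first exact: ndiff1_cst.
have -> : (fun x => a x ^+ p.+1) = (fun x => a x * a x ^+ p).
  by apply/funext => x; rewrite exprS.
exact: ndiff1M.
Qed.

Lemma is_derive_comp1 (a b : R -> R) x (da db : R) :
  is_derive (b x) 1 a da -> is_derive x 1 b db -> is_derive x 1 (fun y => a (b y)) (da * db).
Proof.
move=> Ha Hb; have dda : differentiable a (b x) by apply/derivable1_diffP; exact: (@ex_derive _ _ _ _ _ _ _ Ha).
have ddb : differentiable b x by apply/derivable1_diffP; exact: (@ex_derive _ _ _ _ _ _ _ Hb).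
apply: DeriveDef; first by apply: diff_derivable; exact: (differentiable_comp ddb dda).
rewrite [LHS](@derive_comp _ _ _ _ b a)// derive_val -[db]mulr1 derive_scale//.
by rewrite derive_val mulr1 mulrC.
Qed.

Lemma ndiff1_comp A B n a b : (forall x, B x -> A (b x)) ->
  ndiff1 A n a -> ndiff1 B n b -> ndiff1 B n (fun x => a (b x)).
Proof.
move=> BA; elim: n a b BA => [|n IH] a b BA.
  move=> Ha Hb x Bx.
  have /derivableP Ha' := Ha _ (BA _ Bx); have /derivableP Hb' := Hb _ Bx.
  exact: (@ex_derive _ _ _ _ _ _ _ (is_derive_comp1 Ha' Hb')).
move=> [a' [Ha Ha']] /[dup] /ndiff1S sb [b' [Hb Hb']].
exists (fun x => a' (b x) * b' x); split.
  by move=> x Bx; apply: is_derive_comp1; [exact/Ha/BA|exact: Hb].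
by apply: ndiff1M => //; exact: IH.
Qed.

Lemma is_derive_inv1 (b : R -> R) x (db : R) : b x != 0 ->
  is_derive x 1 b db -> is_derive x 1 (fun y => (b y)^-1) (- (b x) ^- 2 * db).
Proof. by move=> b0 Hb; apply: (is_derive_eq (is_deriveV b0 Hb)). Qed.

Lemma ndiff1V A n a : (forall x, A x -> a x != 0) -> ndiff1 A n a ->
  ndiff1 A n (fun x => (a x)^-1).
Proof.
move=> a0; elim: n => [|n IH].
  by move=> Ha x Ax; apply: derivableV; [exact: a0|exact: Ha].
move=> /[dup] /ndiff1S sa [a' [Ha Ha']].
exists (fun x => (-1) * ((a x)^-1 * (a x)^-1) * a' x); split.
  move=> x Ax; apply: (is_derive_eq (is_derive_inv1 (a0 _ Ax) (Ha _ Ax))).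
  by rewrite mulN1r -invfM -expr2.
apply: ndiff1M => //; apply: ndiff1M; first exact: ndiff1_cst.
by apply: ndiff1M; exact: IH.
Qed.

Section Several.
Variable k : nat.
Local Notation V := ('rV[R]_k).

(** [n + 1] times differentiable on the whole space, by induction on the
    order: unlike [smooth_on], it can be proved for products and composites one
    order at a time. *)
Fixpoint ndiff (W : normedModType R) (n : nat) (h : V -> W) : Prop :=
  (forall u, differentiable h u) /\ if n is n'.+1 then forall v, ndiff n' ('D_v h) else True.

Lemma smooth_ndiff (W : normedModType R) (h : V -> W) :
  smooth_on setT h <-> forall n, ndiff n h.
Proof.
split=> [sh n|H s u _].
  elim: n h sh => [|n IH] h sh.
    by split=> // u; exact: (sh [::]).
  split=> [u|v]; first exact: (sh [::]).
  by apply: IH => s u _; have := sh (rcons s v) u I; rewrite foldr_rcons.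
have := H (size s); elim/last_ind: s h {H} => [|s v IH] h; first by move=> [].
by rewrite size_rcons foldr_rcons => -[_ /(_ v)]; exact: IH.
Qed.

Lemma ndiffS (W : normedModType R) n (h : V -> W) : ndiff n.+1 h -> ndiff n h.
Proof.
elim: n h => [|n IH] h [dh H]; split => // v.
exact: IH.
Qed.

Lemma ndiff_diff (W : normedModType R) n (h : V -> W) u : ndiff n h -> differentiable h u.
Proof. by case: n => [|n] []. Qed.

Lemma ndiff_cst (W : normedModType R) n (c : W) : ndiff n (cst c : V -> W).
Proof.
elim: n c => [|n IH] c; split => // v.
have -> : 'D_v (cst c : V -> W) = cst 0 by apply/funext => u; rewrite derive_cst.
exact: IH.
Qed.

Lemma ndiffD (W : normedModType R) n (g h : V -> W) :
  ndiff n g -> ndiff n h -> ndiff n (fun u => g u + h u).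
Proof.
elim: n g h => [|n IH] g h [dg Hg] [dh Hh]; (split; first by move=> u; exact: differentiableD) => // v.
have -> : 'D_v (fun u => g u + h u) = (fun u => 'D_v g u + 'D_v h u).
  by apply/funext => u; rewrite deriveD//; exact: diff_derivable.
by apply: IH; [exact: Hg|exact: Hh].
Qed.

Lemma ndiffM n (g h : V -> R) : ndiff n g -> ndiff n h -> ndiff n (fun u => g u * h u).
Proof.
elim: n g h => [|n IH] g h Hg Hh.
  by split=> // u; apply: differentiable_mul; [exact: (ndiff_diff _ Hg)|exact: (ndiff_diff _ Hh)].
split=> [u|v]; first by apply: differentiable_mul; [exact: (ndiff_diff _ Hg)|exact: (ndiff_diff _ Hh)].
have -> : 'D_v (fun u => g u * h u) = (fun u => g u * 'D_v h u + h u * 'D_v g u).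
  apply/funext => u; rewrite [LHS]deriveM//; apply: diff_derivable.
    exact: (ndiff_diff _ Hg).
  exact: (ndiff_diff _ Hh).
by apply: ndiffD; apply: IH; [exact: ndiffS|exact: Hh.2|exact: ndiffS|exact: Hg.2].
Qed.

Lemma ndiff_sum (W : normedModType R) (I : Type) (r : seq I) n (h : I -> V -> W) :
  (forall i, ndiff n (h i)) -> ndiff n (fun u => \sum_(i <- r) h i u).
Proof.
move=> H; elim: r => [|i r IH].
  have -> : (fun u => \sum_(i <- [::]) h i u) = cst 0 by apply/funext => u; rewrite big_nil.
  exact: ndiff_cst.
have -> : (fun u => \sum_(j <- i :: r) h j u) = fun u => h i u + \sum_(j <- r) h j u.
  by apply/funext => u; rewrite big_cons.
exact: ndiffD.
Qed.

Lemma derive_coord_fun (i : 'I_k) v (u : V) : 'D_v (fun u : V => u 0 i) u = v 0 i.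
Proof.
rewrite -[LHS](@derive_coord _ _ _ _ id); last exact: derivable_id.
by rewrite derive_id.
Qed.

Lemma ndiff_coord n (i : 'I_k) : ndiff n (fun u : V => u 0 i).
Proof.
have dc (u : V) : differentiable (fun u : V => u 0 i) u by exact: differentiable_coord.
case: n => [|n]; split=> // v.
have -> : 'D_v (fun u : V => u 0 i) = cst (v 0 i).
  by apply/funext => u; exact: derive_coord_fun.
exact: ndiff_cst.
Qed.

Lemma derive_comp_real (a : R -> R) (h : V -> R) (da : R) u v :
  is_derive (h u) 1 a da -> differentiable h u -> is_derive u v (fun w => a (h w)) (da * 'D_v h u).
Proof.
move=> Ha dh; have dda : differentiable a (h u) by apply/derivable1_diffP; exact: (@ex_derive _ _ _ _ _ _ _ Ha).
apply: DeriveDef; first by apply: diff_derivable; exact: (differentiable_comp dh dda).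
rewrite [LHS](@derive_comp _ _ _ _ h a)// -['D_v h u]mulr1 derive_scale//.
by rewrite derive_val mulr1 mulrC.
Qed.

Lemma ndiff_comp1 (A : set R) n a (h : V -> R) : (forall u, A (h u)) ->
  ndiff1 A n a -> ndiff n h -> ndiff n (fun u => a (h u)).
Proof.
move=> hA; elim: n a => [|n IH] a Ha Hh.
  split=> // u; apply: (differentiable_comp (ndiff_diff u Hh)).
  by apply/derivable1_diffP; exact: Ha.
have [a' [Ha1 Ha2]] := Ha.
split=> [u|v].
  apply: (differentiable_comp (ndiff_diff u Hh)).
  by apply/derivable1_diffP; exact: (ndiff1_derivable Ha).
have -> : 'D_v (fun u => a (h u)) = (fun u => a' (h u) * 'D_v h u).
  apply/funext => u.
  exact: (@derive_val _ _ _ _ _ _ _ (derive_comp_real v (Ha1 _ (hA u)) (ndiff_diff u Hh))).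
apply: ndiffM; last exact: Hh.2.
by apply: IH => //; exact: ndiffS.
Qed.

Lemma ndiff_mx m p n (Y : V -> 'M[R]_(m, p)) :
  (forall i j, ndiff n (fun u => Y u i j)) -> ndiff n Y.
Proof.
elim: n Y => [|n IH] Y H.
  by split=> // u; apply: differentiable_mx => i j; exact: (ndiff_diff u (H i j)).
have dY u : differentiable Y u by apply: differentiable_mx => i j; exact: (ndiff_diff u (H i j)).
split=> // v; apply: IH => i j.
have -> : (fun u => 'D_v Y u i j) = 'D_v (fun u => Y u i j).
  by apply/funext => u; rewrite derive_coord//; exact: diff_derivable.
exact: (H i j).2.
Qed.

End Several.

Lemma ndiff_compmap k d n (g : 'rV[R]_d -> R) (Y : 'rV[R]_k -> 'rV[R]_d) :
  ndiff n g -> (forall i, ndiff n (fun u => Y u 0 i)) -> ndiff n (fun u => g (Y u)).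
Proof.
elim: n g => [|n IH] g Hg HY.
  split=> // u; apply: (@differentiable_comp _ _ _ _ Y g); last exact: (ndiff_diff _ Hg).
  by apply: differentiable_mx => i j; rewrite ord1; exact: (ndiff_diff _ (HY j)).
have dY u : differentiable Y u.
  by apply: differentiable_mx => i j; rewrite ord1; exact: (ndiff_diff _ (HY j)).
split=> [u|v]; first by apply: (@differentiable_comp _ _ _ _ Y g) => //; exact: (ndiff_diff _ Hg).
have -> : 'D_v (fun u => g (Y u)) = (fun u => \sum_i 'D_v (fun w => Y w 0 i) u * partial i g (Y u)).
  apply/funext => u; rewrite [LHS](@derive_comp _ _ _ _ Y g)//; last exact: (ndiff_diff _ Hg).
  rewrite derive_partial; last exact: (ndiff_diff _ Hg).
  apply: eq_bigr => i _; rewrite derive_coord//; exact: diff_derivable.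
apply: ndiff_sum => i; apply: ndiffM; first exact: (HY i).2.
by apply: IH => [|j]; [exact: Hg.2|exact: ndiffS].
Qed.

End Smooth.

(** * Spherical harmonics *)

Section Sphere.
Variables (R : realType) (k : nat).

Lemma dot_deltar (d : nat) (u : 'rV[R]_d) j : dot u (delta_mx 0 j) = u 0 j.
Proof.
rewrite -[RHS](sum_delta (fun i => u 0 i)).
by apply: eq_bigr => i _; rewrite mxE eqxx.
Qed.

Lemma dot_row_mx (d : nat) (a b : R) (u v : 'rV[R]_d) :
  dot (row_mx (a%:M : 'rV[R]_1) u) (row_mx (b%:M : 'rV[R]_1) v) = a * b + dot u v.
Proof.
rewrite /dot big_split_ord big_ord1; congr (_ + _).
  by rewrite !row_mxEl !mxE.
by apply: eq_bigr => i _; rewrite !row_mxEr.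
Qed.

Section ImageInSphere.
Variables (U : set 'rV[R]_k) (X : 'rV[R]_k -> 'rV[R]_(1 + k)).
Hypotheses (oU : open U) (sX : smooth_on U X) (XS : forall u, U u -> dot (X u) (X u) = 1).

Lemma sphere_unit_normal u : U u -> unit_normal X u (X u).
Proof.
move=> Uu; split=> [|i]; first exact: XS.
have dX := smooth_differentiable sX Uu.
have H := is_derive_dot (delta_mx 0 i) dX dX.
have : 'D_(delta_mx 0 i) (fun y => dot (X y) (X y)) u = 0.
  rewrite -(derive_cst (1 : R) u (delta_mx 0 i)); apply: near_eq_derive; near=> y.
  by rewrite XS//; near: y; exact: near_open.
rewrite (@derive_val _ _ _ _ _ _ _ H) [dot ('D__ _ _) _]dotC => E.
by move: E; rewrite -[partial i X u]/('D_(delta_mx 0 i) X u); move: (dot _ _) => x; lra.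
Unshelve. all: by end_near. Qed.

(** Differentiate the orthogonality of [X] and its partial derivatives. *)
Lemma sphere_second_form u : U u -> second_form X u (X u) = - gram X u.
Proof.
move=> Uu; apply/matrixP => i j; rewrite [LHS]mxE [RHS]mxE gramE.
have dX := smooth_differentiable sX Uu.
have H := is_derive_dot (delta_mx 0 i) (smooth_differentiable2 sX (delta_mx 0 j) Uu) dX.
have : 'D_(delta_mx 0 i) (fun y => dot (partial j X y) (X y)) u = 0.
  rewrite -(derive_cst (0 : R) u (delta_mx 0 i)); apply: near_eq_derive; near=> y.
  rewrite dotC; apply: (sphere_unit_normal _).2.
  by near: y; exact: near_open.
rewrite (@derive_val _ _ _ _ _ _ _ H) => /eqP; rewrite addr_eq0 => /eqP E.
exact: (etrans E (congr1 -%R (dotC _ _))).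
Unshelve. all: by end_near. Qed.

Lemma sphere_laplace (g : 'rV[R]_(1 + k) -> R) u : U u ->
  (forall u, U u -> gram X u \in unitmx) ->
  (forall p, differentiable g p) -> (forall v p, differentiable ('D_v g) p) ->
  laplace_beltrami X g u = - k%:R * 'D_(X u) g (X u) +
    (\sum_a partial a (partial a g) (X u) - 'D_(X u) ('D_(X u) g) (X u)).
Proof.
move=> Uu ug d1 d2.
rewrite (hypersurface_laplace (conj oU sX) ug _ Uu (sphere_unit_normal Uu) d1 d2); last first.
  by move=> v Uv; exists (X v); exact: sphere_unit_normal.
congr (_ * _ + _); rewrite /shape_operator sphere_second_form// mulmxN mulVmx ?ug//.
by rewrite linearN/= mxtrace1.
Qed.

End ImageInSphere.

(** Stereographic projection from the pole (s, 0). *)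
Definition stereo (s : R) (u : 'rV[R]_k) : 'rV[R]_(1 + k) :=
  row_mx ((s * (1 - 2 / (1 + dot u u)))%:M : 'rV[R]_1) ((2 / (1 + dot u u)) *: u).

Let beta (u : 'rV[R]_k) := 2 / (1 + dot u u).

Let q_gt0 (u : 'rV[R]_k) : 0 < 1 + dot u u.
Proof. by have := dot_ge0 u; lra. Qed.

Lemma stereo_sphere s u : s ^+ 2 = 1 -> dot (stereo s u) (stereo s u) = 1.
Proof.
move=> s1; rewrite dot_row_mx dotZl dotZr -expr2 exprMn s1 mul1r.
have := q_gt0 u; move: (dot u u) => q q0; field; lra.
Qed.

Lemma stereo_ndiff s n : ndiff n (stereo s).
Proof.
have Hb : ndiff n beta.
  apply: (@ndiff_comp1 _ _ [set x | 0 < x] n (fun x => 2 * x^-1) (fun u => 1 + dot u u)).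
  - exact: q_gt0.
  - apply: ndiff1M; first exact: ndiff1_cst.
    by apply: ndiff1V; [move=> x /= /gt_eqF ->|exact: ndiff1_id].
  - apply: ndiffD; first exact: ndiff_cst.
    by apply: ndiff_sum => i; apply: ndiffM; exact: ndiff_coord.
apply: ndiff_mx => i j; rewrite ord1; case: (split_ordP j) => a -> .
  have -> : (fun u => stereo s u 0 (lshift k a)) = (fun u => s * (1 + (-1) * beta u)).
    by apply/funext => u; rewrite row_mxEl mxE ord1 mulN1r.
  apply: ndiffM; first exact: ndiff_cst.
  apply: ndiffD; first exact: ndiff_cst.
  by apply: ndiffM => //; exact: ndiff_cst.
have -> : (fun u => stereo s u 0 (rshift 1 a)) = (fun u => beta u * u 0 a).
  by apply/funext => u; rewrite row_mxEr mxE.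
by apply: ndiffM => //; exact: ndiff_coord.
Qed.

Let derive_beta u v : is_derive u v beta (- beta u ^+ 2 * dot u v).
Proof.
have di : differentiable (id : 'rV[R]_k -> 'rV[R]_k) u by [].
have Hq : is_derive u v (fun u : 'rV[R]_k => 1 + dot u u) (2 * dot u v).
  have H1 := is_derive_dot v di di.
  apply: (is_derive_eq (is_deriveD (is_derive_cst (1 : R) u v) H1)).
  by rewrite derive_id add0r dotC mulr2n mulrDl mul1r.
have H2 : is_derive (1 + dot u u) 1 (fun x : R => 2 * x^-1) (2 * (- (1 + dot u u) ^- 2 * 1)).
  apply: is_derive_cmul; apply: (@is_derive_inv1 R id) => /=.
  by rewrite gt_eqF// q_gt0.
have dq : differentiable (fun u : 'rV[R]_k => 1 + dot u u) u.
  by apply: differentiableD => //; exact: (differentiable_dot di di).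
apply: (is_derive_eq (derive_comp_real v H2 dq)).
rewrite (@derive_val _ _ _ _ _ _ _ Hq) /beta.
have := q_gt0 u; move: (1 + dot u u) (dot u v) => q r q0; field; lra.
Qed.

Lemma stereo_derive s u v : 'D_v (stereo s) u =
  row_mx ((s * (beta u ^+ 2 * dot u v))%:M : 'rV[R]_1)
    (beta u *: v - (beta u ^+ 2 * dot u v) *: u).
Proof.
apply/rowP => j; have dS := ndiff_diff u (stereo_ndiff s 0).
rewrite derive_coord; last exact: diff_derivable.
case: (split_ordP j) => a -> .
  have -> : (fun u => stereo s u 0 (lshift k a)) = (fun u => s * (1 - beta u)).
    by apply/funext => w; rewrite row_mxEl mxE ord1.
  have H : is_derive u v (fun u => s * (1 - beta u)) (s * (0 - (- beta u ^+ 2 * dot u v))).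
    apply: is_derive_cmul; apply: is_deriveB; exact: derive_beta.
  rewrite (@derive_val _ _ _ _ _ _ _ H) row_mxEl mxE [a]ord1 eqxx mulr1n; ring.
have -> : (fun u => stereo s u 0 (rshift 1 a)) = (fun u => beta u * u 0 a).
  by apply/funext => w; rewrite row_mxEr mxE.
have Hc : is_derive u v (fun u : 'rV[R]_k => u 0 a) (v 0 a).
  rewrite -(derive_coord_fun a v u); apply: derivableP; apply: diff_derivable.
  exact: differentiable_coord.
rewrite (@derive_val _ _ _ _ _ _ _ (is_derive_mul (derive_beta u v) Hc)) row_mxEr !mxE; ring.
Qed.

Lemma stereo_gram s u : s ^+ 2 = 1 -> gram (stereo s) u = (beta u ^+ 2)%:M.
Proof.
move=> s1; apply/matrixP => i j; rewrite gramE /partial !stereo_derive dot_row_mx mxE.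
rewrite -![- (_ *: u)]scaleNr !(dotDl, dotDr, dotZl, dotZr).
have -> : dot (delta_mx 0 i : 'rV[R]_k) (delta_mx 0 j) = (i == j)%:R.
  by rewrite dot_deltar mxE eqxx eq_sym.
rewrite (dotC (delta_mx 0 i)).
have qb : beta u * (1 + dot u u) = 2 by rewrite /beta divfK// gt_eqF// q_gt0.
move: (dot u (delta_mx _ _)) (dot u (delta_mx _ _)) => x y.
rewrite -[RHS]mulr_natr; move: (i == j)%:R => e.
have -> : dot u u = (1 + dot u u) - 1 by ring.
move: (beta u) (1 + dot u u) qb => b q qb.
transitivity (s ^+ 2 * (b ^+ 4 * x * y) + (b ^+ 2 * e + b ^+ 3 * x * y * (b * q - 2) - b ^+ 4 * x * y)).
  by ring.
by rewrite s1 qb; ring.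
Qed.

(** The pole is taken in the hemisphere that does not contain [w], so that a
    single chart, defined on the whole of R^k, is enough at each point. *)
Lemma sphere_stereo (w : 'rV[R]_(1 + k)) : dot w w = 1 ->
  exists s, s ^+ 2 = 1 /\ exists u, w = stereo s u.
Proof.
pose w0 := w 0 (lshift k 0); pose w' : 'rV[R]_k := rsubmx w.
have wE : w = row_mx (w0%:M : 'rV[R]_1) w'.
  rewrite -[LHS](hsubmxK w); congr row_mx; apply/rowP => i; rewrite ord1 !mxE mulr1n.
  by [].
rewrite [in X in X -> _]wE dot_row_mx => E.
pose s : R := if 0 <= w0 then -1 else 1.
have s1 : s ^+ 2 = 1 by rewrite /s; case: ifP; rewrite ?sqrrN expr1n.
have ss x : s * (s * x) = x by rewrite mulrA -expr2 s1 mul1r.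
have sw : s * w0 <= 0 by rewrite /s; case: (lerP 0 w0); lra.
exists s; split=> //; exists ((1 - s * w0)^-1 *: w').
have b0 : 1 - s * w0 != 0 by rewrite gt_eqF//; lra.
have bE : 2 / (1 + dot ((1 - s * w0)^-1 *: w') ((1 - s * w0)^-1 *: w')) = 1 - s * w0.
  rewrite dotZl dotZr; have -> : dot w' w' = 1 - (s * w0) ^+ 2.
    by rewrite exprMn s1 mul1r expr2 -E; ring.
  field; rewrite b0/=.
  have -> : (1 - s * w0) ^+ 2 + (1 - (s * w0) ^+ 2) = 2 * (1 - s * w0) by ring.
  by rewrite mulf_neq0.
rewrite /stereo bE scalerA mulfV// scale1r subKr ss; exact: wE.
Qed.

(** The eigenvalue equation in a stereographic chart, in terms of derivatives in
    the ambient space. *)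
Lemma harmonics_pde (m : nat) (g : 'rV[R]_(1 + k) -> R) (w : 'rV[R]_(1 + k)) :
  @harmonics R (1 + k) m g -> dot w w = 1 ->
  \sum_a partial a (partial a g) w - 'D_w ('D_w g) w - k%:R * 'D_w g w =
    - (m%:R * (k%:R + m%:R - 1)) * g w.
Proof.
move=> [sg H] /sphere_stereo[s [s1 [u ->]]].
have sS : smooth_on setT (stereo s) by apply/smooth_ndiff; exact: stereo_ndiff.
have ug v : setT v -> gram (stereo s) v \in unitmx.
  move=> _; rewrite stereo_gram// unitmxE det_scalar unitfE expf_neq0// expf_neq0//.
  by rewrite mulf_neq0// invr_eq0 gt_eqF// q_gt0.
have lp : local_param (@sphere R (1 + k)) setT (stereo s).
  by split=> //; [exact: openT|move=> v _; exact: stereo_sphere].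
have d1 : forall p, differentiable g p by move=> p; exact: (sg [::]).
have d2 : forall v p, differentiable ('D_v g) p by move=> v p; exact: (sg [:: v]).
have SS v : setT v -> dot (stereo s v) (stereo s v) = 1 by move=> _; exact: stereo_sphere.
have := H setT (stereo s) lp u I.
rewrite (@sphere_laplace setT (stereo s) openT sS SS g u I ug d1 d2) => E.
rewrite addrC -mulNr E; congr (- (_ * _) * _).
by rewrite natrD; ring.
Qed.

End Sphere.

(** * The profile curve *)

Section Monotone.
Variable R : realType.

Lemma derive_ge0_le (F F' : R -> R) (a b : R) : a <= b ->
  (forall x, a <= x <= b -> is_derive x 1 F (F' x)) ->
  (forall x, a <= x <= b -> 0 <= F' x) -> F a <= F b.
Proof.
rewrite le_eqVlt => /predU1P[->//|ab] dF F0.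
have [x xab E] : exists2 x, x \in `]a, b[ & F b - F a = F' x * (b - a).
  apply: MVT => // [x|].
    by rewrite in_itv/= => /andP[? ?]; apply: dF; rewrite !ltW.
  apply: derivable_within_continuous => x.
  by rewrite in_itv/= => ?; apply: is_derive_derivable; exact: dF.
rewrite -subr_ge0 E; apply: mulr_ge0; last by rewrite subr_ge0 ltW.
apply: F0.
by move: xab; rewrite in_itv/= => /andP[? ?]; rewrite !ltW.
Qed.

Lemma derive_eq0_cst (F F' : R -> R) (a b : R) : a <= b ->
  (forall x, a <= x <= b -> is_derive x 1 F (F' x)) ->
  (forall x, a <= x <= b -> F' x = 0) -> F a = F b.
Proof.
move=> ab dF F0; apply/eqP; rewrite eq_le; apply/andP; split.
  by apply: (derive_ge0_le ab dF) => x /F0 ->.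
rewrite -lerN2; apply: (@derive_ge0_le (fun x => - F x) (fun x => - F' x)) => // x xab.
  by apply: is_deriveN; exact: dF.
by rewrite F0// oppr0.
Qed.

Lemma is_derive_pow1 (a : R -> R) (x da : R) p :
  is_derive x 1 a da -> is_derive x 1 (fun y => a y ^+ p) (p%:R * a x ^+ p.-1 * da).
Proof.
move=> Ha; case: p => [|p].
  by rewrite !mul0r; exact: is_derive_cst.
elim: p => [|p IH].
  by apply: (is_derive_eq Ha); rewrite /= expr0 !mul1r.
have -> : (fun y => a y ^+ p.+2) = (fun y => a y * a y ^+ p.+1).
  by apply/funext => y; rewrite exprS.
apply: (is_derive_eq (is_derive_mul Ha IH)).
by rewrite /= -[p.+2%:R]natr1 exprS; ring.
Qed.

Lemma is_derive_opp1 (a : R -> R) (x da : R) :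
  is_derive (- x) 1 a da -> is_derive x 1 (fun y => a (- y)) (- da).
Proof.
move=> Ha.
have H : is_derive x 1 (-%R : R -> R) (-1) by exact: (is_deriveN (is_derive_id _ _)).
by apply: (is_derive_eq (is_derive_comp1 Ha H)); rewrite mulrN1.
Qed.

End Monotone.

Section Profile.
Variables (R : realType) (N : nat) (c : profile R N.+1).
Hypothesis N0 : (0 < N)%N.
Local Notation f := (cat_f c).
Local Notation f1 := (derive1 (cat_f c)).
Local Notation W := (cat_W c).

Definition in_domain (x : R) := (`|x|%:E < cat_L c)%E.

Lemma in_domain_le x y : `|x| <= `|y| -> in_domain y -> in_domain x.
Proof. by move=> xy; apply: le_lt_trans; rewrite lee_fin. Qed.

Lemma in_domain0 : in_domain 0.
Proof. by rewrite /in_domain normr0 cat_L_gt0. Qed.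

Lemma in_domainN x : in_domain x -> in_domain (- x).
Proof. by apply: in_domain_le; rewrite normrN. Qed.

Lemma in_domainW x : - W <= x <= W -> in_domain x.
Proof.
move=> xW; apply: (@in_domain_le _ W); last first.
  by rewrite /in_domain gtr0_norm ?cat_W_gt0// cat_W_lt.
by rewrite [`|W|]gtr0_norm ?cat_W_gt0// ler_norml.
Qed.

Lemma f_0 : f 0 = 1. Proof. by case: (cat_f_sol c). Qed.
Lemma f1_0 : f1 0 = 0. Proof. by case: (cat_f_sol c). Qed.

Lemma derive_f x : in_domain x -> is_derive x 1 f (f1 x).
Proof.
by move=> xL; have [_ _ /(_ x xL)[? _ _]] := cat_f_sol c; rewrite derive1E; exact: derivableP.
Qed.

Lemma derive_f1 x : in_domain x -> is_derive x 1 f1 (N%:R * f x ^+ (2 * N).-1).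
Proof.
move=> xL; have [_ _ /(_ x xL)[_ d2 E]] := cat_f_sol c.
apply: (is_derive_eq (derivableP d2)); rewrite -derive1E E; congr (_ * _ ^+ _).
  by rewrite -natr1 addrK.
lia.
Qed.

Lemma segment_domain x y z : in_domain x -> in_domain z -> x <= y <= z -> in_domain y.
Proof.
move=> dx dz /andP[xy yz]; have [y0|y0] := lerP 0 y.
  by apply: in_domain_le dz; rewrite !ger0_norm// (le_trans y0).
by apply: in_domain_le dx; rewrite !ltr0_norm ?lerN2// (le_lt_trans xy).
Qed.

Lemma first_integral x : in_domain x -> f1 x ^+ 2 = f x ^+ (2 * N) - 1.
Proof.
move=> dx.
pose F x := f1 x ^+ 2 - f x ^+ (2 * N).
suff FE : F x = F 0.
  by move: FE; rewrite /F f_0 f1_0 expr1n expr0n/= => FE; lra.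
pose F' y : R := 2%:R * f1 y ^+ 1 * (N%:R * f y ^+ (2 * N).-1) - (2 * N)%:R * f y ^+ (2 * N).-1 * f1 y.
have dF y : in_domain y -> is_derive y 1 F (F' y).
  move=> dy; apply: is_deriveB; apply: is_derive_pow1.
    exact: derive_f1.
  exact: derive_f.
have F'0 y : F' y = 0 by rewrite /F' natrM expr1; ring.
have [x0|x0] := lerP 0 x.
  apply/esym; apply: (@derive_eq0_cst _ F F') => // y yx; apply: dF.
  exact: segment_domain in_domain0 dx yx.
apply: (@derive_eq0_cst _ F F' x 0) => // [|y yx]; first exact: ltW.
by apply: dF; exact: segment_domain dx in_domain0 yx.
Qed.

Lemma f_continuous a b : in_domain a -> in_domain b -> {within `[a, b], continuous f}.
Proof.
move=> da db; apply: derivable_within_continuous => x; rewrite in_itv/= => xab.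
by apply: is_derive_derivable; apply: derive_f; exact: segment_domain xab.
Qed.

(** By the first integral f does not vanish; so it stays positive, and the first
    integral again gives f ^ (2 N) >= 1. *)
Lemma f_ge1 x : in_domain x -> 1 <= f x.
Proof.
have f0 y : in_domain y -> f y != 0.
  move=> dy; apply/eqP => fy; have := first_integral dy.
  rewrite fy expr0n muln_eq0/= -[N == 0%N]negbK -lt0n N0/= => E.
  by have := sqr_ge0 (f1 y); rewrite E; lra.
have fpos y : in_domain y -> 0 < f y.
  move=> dy; rewrite lt_neqAle eq_sym f0//= leNgt; apply/negP => fy.
  have [y0|y0] := lerP 0 y.
    have [|z] := @IVT R f 0 y 0 y0 (f_continuous in_domain0 dy).
      by rewrite f_0 ge_min le_max (ltW fy) ler01 !orbT.
    by rewrite in_itv/= => /(segment_domain in_domain0 dy)/f0/eqP.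
  have [|z] := @IVT R f y 0 0 (ltW y0) (f_continuous dy in_domain0).
    by rewrite f_0 ge_min le_max (ltW fy) ler01 !orbT.
  by rewrite in_itv/= => /(segment_domain dy in_domain0)/f0/eqP.
move=> dx; have := first_integral dx; have := sqr_ge0 (f1 x); have := fpos _ dx.
move=> fx0 H1 H2; have : 1 <= f x ^+ (2 * N) by lra.
by rewrite (@expr_ge1 _ (2 * N)) ?muln_gt0 ?(ltW fx0).
Qed.

Lemma f_gt0 x : in_domain x -> 0 < f x.
Proof. by move=> /f_ge1; lra. Qed.

Lemma f1_mono x y : in_domain x -> in_domain y -> x <= y -> f1 x <= f1 y.
Proof.
move=> dx dy xy; apply: (derive_ge0_le xy (F' := fun x => N%:R * f x ^+ (2 * N).-1)) => z zxy.
  by apply: derive_f1; exact: segment_domain zxy.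
by rewrite mulr_ge0// exprn_ge0// ltW// f_gt0//; exact: segment_domain zxy.
Qed.

Lemma f1_ge0 x : in_domain x -> 0 <= x -> 0 <= f1 x.
Proof. by move=> dx x0; rewrite -f1_0; apply: f1_mono => //; exact: in_domain0. Qed.

Lemma f1_le0 x : in_domain x -> x <= 0 -> f1 x <= 0.
Proof. by move=> dx x0; rewrite -f1_0; apply: f1_mono => //; exact: in_domain0. Qed.

Lemma f_mono x y : 0 <= x -> x <= y -> in_domain y -> f x <= f y.
Proof.
move=> x0 xy dy; have dx : in_domain x.
  by apply: segment_domain in_domain0 dy _; rewrite x0.
apply: (derive_ge0_le xy (F' := f1)) => z zxy.
  by apply: derive_f; exact: segment_domain zxy.
by apply: f1_ge0; [exact: segment_domain zxy|case/andP: zxy => ? _; exact: le_trans x0 _].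
Qed.

Lemma f_antimono x y : x <= y -> y <= 0 -> in_domain x -> f y <= f x.
Proof.
move=> xy y0 dx; have dy : in_domain y.
  by apply: segment_domain dx in_domain0 _; rewrite xy.
rewrite -lerN2; apply: (derive_ge0_le xy (F := fun x => - f x) (F' := fun x => - f1 x)) => z zxy.
  by apply: is_deriveN; apply: derive_f; exact: segment_domain zxy.
rewrite oppr_ge0; apply: f1_le0; [exact: segment_domain zxy|].
by case/andP: zxy => _ ?; exact: le_trans y0.
Qed.

End Profile.

Section ProfileEven.
Variables (R : realType) (N : nat) (c : profile R N.+1).
Hypothesis N0 : (0 < N)%N.
Local Notation f := (cat_f c).
Local Notation f1 := (derive1 (cat_f c)).
Local Notation W := (cat_W c).

Lemma is_derive_add (V : normedModType R) (g h : V -> R) x v (dg dh : R) :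
  is_derive x v g dg -> is_derive x v h dh -> is_derive x v (fun y => g y + h y) (dg + dh).
Proof. exact: is_deriveD. Qed.

Lemma pow_lipschitz (p : nat) (M a b : R) : 0 <= a <= M -> 0 <= b <= M ->
  `|a ^+ p - b ^+ p| <= p%:R * M ^+ p.-1 * `|a - b|.
Proof.
move=> /andP[a0 aM] /andP[b0 bM]; rewrite subrXX normrM mulrC ler_wpM2r//.
rewrite (le_trans (ler_norm_sum _ _ _))//.
apply: (@le_trans _ _ (\sum_(i < p) M ^+ p.-1)); last first.
  by rewrite sumr_const card_ord mulr_natl.
apply: ler_sum => i _; rewrite normrM !normrX !ger0_norm//.
have -> : p.-1 = (p.-1 - i + i)%N by rewrite subnK//; have := ltn_ord i; lia.
rewrite exprD addnK ler_pM ?exprn_ge0// lerXn2r// ?nnegrE//; exact: le_trans aM.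
Qed.

(** A solution of f'' = N f^(2N-1) is determined by its initial values, hence
    even: Gronwall's inequality for the energy of f(x) - f(-x). *)
Lemma f_even_pos x : in_domain c x -> 0 <= x -> f (- x) = f x /\ f1 (- x) = - f1 x.
Proof.
move=> dx x0; have dxN := in_domainN dx.
have dom y : 0 <= y <= x -> in_domain c y /\ in_domain c (- y).
  move=> yx; have dy := segment_domain (in_domain0 c) dx yx.
  by split=> //; exact: in_domainN.
pose M := f x + f (- x).
have fM y : 0 <= y <= x -> (0 <= f y <= M) /\ (0 <= f (- y) <= M).
  move=> /[dup] /dom[dy dyN] /andP[y0 yx]; have := f_gt0 N0 dx; have := f_gt0 N0 dxN.
  have := f_gt0 N0 dy; have := f_gt0 N0 dyN; have := f_mono N0 y0 yx dx.
  have : f (- y) <= f (- x) by apply: f_antimono => //; rewrite ?lerN2 ?oppr_le0.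
  by rewrite /M; lra.
pose p := (2 * N).-1; pose K := 1 + N%:R * (p%:R * M ^+ p.-1).
pose d y := f y - f (- y); pose e y := f1 y + f1 (- y).
pose d2 y : R := N%:R * f y ^+ p - N%:R * f (- y) ^+ p.
have dd y : 0 <= y <= x -> is_derive y 1 d (e y).
  move=> /dom[dy dyN].
  apply: (is_derive_eq (is_deriveB (derive_f dy) (is_derive_opp1 (derive_f dyN)))).
  by rewrite opprK.
have de y : 0 <= y <= x -> is_derive y 1 e (d2 y).
  move=> /dom[dy dyN].
  exact: (is_derive_add (derive_f1 N0 dy) (is_derive_opp1 (derive_f1 N0 dyN))).
have d2le y : 0 <= y <= x -> `|d2 y| <= (K - 1) * `|d y|.
  move=> /fM[H1 H2]; rewrite /d2 -mulrBr normrM ger0_norm// /K addrAC subrr add0r -mulrA.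
  by rewrite ler_wpM2l// pow_lipschitz.
pose E y := d y * d y + e y * e y.
pose G y := E y * expR (- K * y).
pose G' y := E y * (expR (- K * y) * (- K)) + expR (- K * y) * 
   ((d y * e y + d y * e y) + (e y * d2 y + e y * d2 y)).
have dG y : 0 <= y <= x -> is_derive y 1 G (G' y).
  move=> yx; apply: is_derive_mul.
    have := is_derive_mul (dd _ yx) (dd _ yx); have := is_derive_mul (de _ yx) (de _ yx).
    by move=> H1 H2; exact: (is_derive_add H2 H1).
  apply: is_derive_comp1; apply: (is_derive_eq (is_derive_cmul (- K) (is_derive_id _ _))).
  by rewrite mulr1.
have K1 : 1 <= K.
  rewrite /K lerDl !mulr_ge0// exprn_ge0//.
  have /fM[/andP[h1 h2] _] : 0 <= x <= x by rewrite x0 lexx.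
  exact: le_trans h1 h2.
have G0 y : 0 <= y <= x -> 0 <= - G' y.
  move=> yx; have := d2le _ yx => H.
  have -> : - G' y = expR (- K * y) * (K * E y - 2 * (d y * e y) - 2 * (e y * d2 y)).
    by rewrite /G'; ring.
  apply: mulr_ge0; first exact: expR_ge0.
  have H1 : e y * d2 y <= `|e y| * ((K - 1) * `|d y|).
    by rewrite (le_trans (ler_norm _))// normrM ler_wpM2l.
  have H2 : d y * e y <= `|d y| * `|e y| by rewrite (le_trans (ler_norm _))// normrM.
  have H3 : K * E y = K * (`|d y| ^+ 2 + `|e y| ^+ 2).
    by rewrite /E -!expr2 !real_normK ?num_real.
  have := sqr_ge0 (`|d y| - `|e y|).
  rewrite H3; move: `|d y| `|e y| H1 H2 => a b H1 H2 H4.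
  have : 0 <= (K - 1) * (a - b) ^+ 2 by rewrite mulr_ge0 ?sqr_ge0// subr_ge0.
  nra.
have : G x <= G 0.
  rewrite -lerN2; apply: (@derive_ge0_le _ (fun y => - G y) (fun y => - G' y) 0 x x0 _ G0).
  by move=> y yx; apply: is_deriveN; exact: dG.
rewrite {2}/G /E /d /e oppr0 f1_0 subrr addr0 !mul0r addr0 mul0r /G => H.
have : E x <= 0.
  by rewrite -(@pmulr_lle0 _ (expR (- K * x))) ?expR_gt0// mulrC.
have := sqr_ge0 (d x); have := sqr_ge0 (e x); rewrite /E -!expr2 => h1 h2 h3.
have d0 : d x = 0 by apply/eqP; rewrite -sqrf_eq0; apply/eqP; lra.
have e0 : e x = 0 by apply/eqP; rewrite -sqrf_eq0; apply/eqP; lra.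
by move: d0 e0; rewrite /d /e => ? ?; split; lra.
Qed.

Lemma W_domain : in_domain c W.
Proof. by rewrite /in_domain gtr0_norm ?cat_W_gt0// cat_W_lt. Qed.

Lemma f_WN : f (- W) = f W /\ f1 (- W) = - f1 W.
Proof. by apply: f_even_pos; [exact: W_domain|rewrite ltW// cat_W_gt0]. Qed.

(** W f'(W) = f(W) and the first integral give R^2 = W^2 f(W) ^ (2 N). *)
Lemma cat_R_pow : cat_R c = W * f W ^+ N.
Proof.
have fW := f_gt0 N0 W_domain; have W0 := cat_W_gt0 c.
apply/eqP; rewrite -(@eqrXn2 _ 2)// ?ltW ?cat_R_gt0 ?mulr_gt0 ?exprn_gt0//.
rewrite cat_RE exprMn -exprM mulnC.
have f2 : f W ^+ 2 = W ^+ 2 * f1 W ^+ 2 by rewrite -exprMn cat_WE.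
by rewrite f2 (first_integral N0 W_domain); apply/eqP; ring.
Qed.

End ProfileEven.

Lemma prof_z_alg (R : realType) (N : nat) (y t : R) : (0 < N)%N -> y != 0 ->
  t ^+ 2 = y ^+ (2 * N) - 1 ->
  t * (- (y ^+ N) ^- 2 * (N%:R * y ^+ N.-1 * t)) + (y ^+ N)^-1 * (N%:R * y ^+ (2 * N).-1) =
  N%:R / y ^+ N.+1.
Proof.
case: N => // n _ y0.
rewrite (_ : (2 * n.+1).-1 = (n.+1 + n)%N); last lia.
rewrite (_ : (2 * n.+1)%N = (n.+1 + n.+1)%N); last lia.
rewrite !exprD /= (exprS y n.+1) (exprS y n); move: (y ^+ n) (expf_neq0 n y0) => q q0 E.
transitivity (n.+1%:R * q ^+ 2 * y / (q * y) - n.+1%:R * t ^+ 2 * q / (y * q) ^+ 2).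
  by field; rewrite y0 q0.
by rewrite E; field; rewrite y0 q0.
Qed.

Section ProfileSmooth.
Variables (R : realType) (N : nat) (c : profile R N.+1).
Hypothesis N0 : (0 < N)%N.
Local Notation f := (cat_f c).
Local Notation f1 := (derive1 (cat_f c)).
Local Notation W := (cat_W c).

Lemma ndiff1_f n : ndiff1 [set x | in_domain c x] n f /\ ndiff1 [set x | in_domain c x] n f1.
Proof.
elim: n => [|n [IH1 IH2]].
  by split=> x dx; apply: is_derive_derivable; [exact: derive_f|exact: (derive_f1 N0)].
split; first by exists f1; split=> // x; exact: derive_f.
exists (fun x => N%:R * f x ^+ (2 * N).-1); split; first by move=> x; exact: (derive_f1 N0).
by apply: ndiff1M; [exact: ndiff1_cst|exact: ndiff1X].
Qed.

(** The hyperbolic tangent of the conformal parameter s with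
    f^N = cosh s. *)
Definition prof_z x := f1 x / f x ^+ N.

Lemma prof_z2 x : in_domain c x -> 1 - prof_z x ^+ 2 = (f x ^+ (2 * N))^-1.
Proof.
move=> dx; rewrite /prof_z expr_div_n (first_integral N0 dx) -exprM mulnC.
have f0 : f x ^+ (2 * N) != 0 by rewrite expf_neq0// gt_eqF// f_gt0.
by rewrite mulnC; field.
Qed.

Lemma derive_prof_z x : in_domain c x -> is_derive x 1 prof_z (N%:R / f x ^+ N.+1).
Proof.
move=> dx; have f0 : f x != 0 by rewrite gt_eqF// f_gt0.
have dV := @is_derive_inv1 R (fun y => f y ^+ N) x _ (expf_neq0 N f0) (is_derive_pow1 N (derive_f dx)).
apply: (is_derive_eq (is_derive_mul (derive_f1 N0 dx) dV)).
exact: prof_z_alg (first_integral N0 dx).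
Qed.

Lemma ndiff1_prof_z n : ndiff1 [set x | in_domain c x] n prof_z.
Proof.
have [Hf Hf1] := ndiff1_f n; apply: ndiff1M => //.
apply: ndiff1V; last exact: ndiff1X.
by move=> x dx; rewrite expf_neq0// gt_eqF// f_gt0.
Qed.

Lemma prof_z_lt1 x : in_domain c x -> `|prof_z x| < 1.
Proof.
move=> dx; rewrite -(@expr_lt1 _ 2)// real_normK ?num_real//.
have := prof_z2 dx; have : 0 < (f x ^+ (2 * N))^-1 by rewrite invr_gt0 exprn_gt0// f_gt0.
lra.
Qed.

End ProfileSmooth.

(** * The Jacobi operator of the catenoid *)

Section RowMx.
Variables (R : realType) (d : nat).

Lemma row_mx00 (a : R) (v : 'rV[R]_d) : row_mx (a%:M : 'rV[R]_1) v 0 (0 : 'I_(1 + d)) = a.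
Proof.
rewrite (_ : (0 : 'I_(1 + d)) = lshift d 0); last exact/val_inj.
by rewrite row_mxEl mxE mulr1n.
Qed.

Lemma row_mx_split (p : 'rV[R]_(1 + d)) : p = row_mx ((p 0 0)%:M : 'rV[R]_1) (rsubmx p).
Proof.
rewrite -[LHS](hsubmxK p) [lsubmx p]mx11_scalar; congr (row_mx _%:M _).
by rewrite mxE; congr (p _ _); exact/val_inj.
Qed.

Lemma derive_rsubmx (V : normedModType R) (X : V -> 'rV[R]_(1 + d)) (u v : V) :
  differentiable X u -> 'D_v (fun w => rsubmx (X w)) u = rsubmx ('D_v X u).
Proof.
move=> dX; have dr : differentiable (fun w => rsubmx (X w)) u.
  by apply: (@differentiable_comp _ _ _ _ X rsubmx) => //; exact: differentiable_rsubmx.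
apply/rowP => i; rewrite derive_coord; last exact: diff_derivable.
rewrite mxE derive_coord; last exact: diff_derivable.
by congr ('D_v _ u); apply/funext => w; rewrite mxE.
Qed.

End RowMx.

Section CatenoidGeometry.
Variables (R : realType) (N : nat) (c : profile R N.+1).
Hypothesis N0 : (0 < N)%N.
Local Notation f := (cat_f c).
Local Notation f1 := (derive1 (cat_f c)).
Local Notation W := (cat_W c).
Local Notation rho := (cat_R c).
Local Notation n := N.+1.

Lemma rho_neq0 : rho != 0. Proof. by rewrite gt_eqF// cat_R_gt0. Qed.

(** Half the gradient of the function |p'|^2 - F(p_0)^2, with
    F(y) = f(R y) / R, that vanishes on the catenoid. *)
Definition cat_grad (p : 'rV[R]_(1 + n)) : 'rV[R]_(1 + n) :=
  row_mx ((- (f (rho * p 0 0) * f1 (rho * p 0 0) / rho))%:M : 'rV[R]_1) (rsubmx p).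

Section Param.
Variables (U : set 'rV[R]_n) (X : 'rV[R]_n -> 'rV[R]_(1 + n)).
Hypotheses (oU : open U) (sX : smooth_on U X) (XC : forall u, U u -> catenoid c (X u)).
Hypothesis ug : forall u, U u -> gram X u \in unitmx.

Let x u := rho * X u 0 0.

Lemma cat_point u : U u -> exists w, [/\ - W <= x u <= W, dot w w = 1 & X u = catF c (x u) w].
Proof.
move=> /XC[y [w [yW ww XE]]]; exists w.
have -> : x u = y.
  by rewrite /x XE /catF row_mx00 mulrC divfK// rho_neq0.
by [].
Qed.

Lemma x_domain u : U u -> in_domain c (x u).
Proof. by move=> /cat_point[w [xW _ _]]; exact: in_domainW xW. Qed.

Lemma derive_x u v : U u -> is_derive u v x (rho * 'D_v X u 0 0).
Proof.
move=> Uu; apply: is_derive_cmul.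
exact: (is_derive_entry v 0 0 (smooth_differentiable sX Uu)).
Qed.

Lemma differentiable_x u : U u -> differentiable x u.
Proof.
move=> Uu; apply: differentiable_mul; first exact: differentiable_cst.
exact: (differentiable_entry 0 0 (smooth_differentiable sX Uu)).
Qed.

Lemma cat_grad_tangent u v : U u -> dot (cat_grad (X u)) ('D_v X u) = 0.
Proof.
move=> Uu.
pose q w := dot (rsubmx (X w)) (rsubmx (X w)) - rho ^- 2 * f (x w) ^+ 2.
have q0 : \forall w \near u, q w = 0.
  near=> w; have Uw : U w by near: w; exact: near_open.
  have [w' [_ ww E]] := cat_point Uw.
  rewrite /q {1 2}E row_mxKr dotZl dotZr ww mulr1 -expr2 expr_div_n; ring.
have dX := smooth_differentiable sX Uu.
have dr : differentiable (fun w => rsubmx (X w)) u.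
  by apply: (@differentiable_comp _ _ _ _ X rsubmx) => //; exact: differentiable_rsubmx.
have DrE := derive_rsubmx v dX.
have Dq := is_derive_dot v dr dr.
have Df := derive_comp_real v (is_derive_pow1 2 (derive_f (x_domain Uu))) (differentiable_x Uu).
have Hq := is_derive_add Dq (is_derive_cmul (- rho ^- 2) Df).
have := @derive_val _ _ _ _ _ _ _ Hq.
rewrite (@near_eq_derive _ _ _ _ (cst 0)); last first.
  by near=> w; rewrite mulNr; near: w; exact: q0.
rewrite derive_cst DrE (@derive_val _ _ _ _ _ _ _ (derive_x v Uu)).
rewrite [dot (rsubmx ('D_v X u)) _]dotC => E.
rewrite [X in dot _ X]row_mx_split /cat_grad -/(x u) dot_row_mx.
move: E; rewrite expr1; move: (dot _ _) ('D_v X u 0 0) (f _) (f1 _) => a b y t E.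
have E2 : a + a = 2 * (y * t * b / rho).
  move/eqP: E; rewrite eq_sym addr_eq0 => /eqP ->.
  by field; exact: rho_neq0.
have -> : a = y * t * b / rho by lra.
by field; exact: rho_neq0.
Unshelve. all: by end_near. Qed.

(** Differentiating the tangency of the partial derivatives gives minus the
    Hessian of the function that vanishes on the catenoid; this Hessian is the
    identity up to a multiple of e_0 e_0^T. *)
Lemma cat_grad_second i j u : U u ->
  dot (cat_grad (X u)) (partial i (partial j X) u) =
    - (gram X u i j - n%:R * f (x u) ^+ (2 * N) * (partial i X u 0 0 * partial j X u 0 0)).
Proof.
move=> Uu; pose v := delta_mx 0 i : 'rV[R]_n.
have dX := smooth_differentiable sX Uu.
have dG : is_derive u v (fun w => - (f (x w) * f1 (x w) / rho))
   (- ((n%:R * f (x u) ^+ (2 * N) - 1) * 'D_v X u 0 0)).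
  have dx := x_domain Uu.
  have H := is_derive_mul (derive_f dx) (derive_f1 N0 dx).
  have H2 := is_derive_cmul (- rho^-1) (derive_comp_real v H (differentiable_x Uu)).
  have -> : (fun w => - (f (x w) * f1 (x w) / rho)) = (fun w => - rho^-1 * (f (x w) * f1 (x w))).
    by apply/funext => w; rewrite mulNr mulrC.
  apply: (is_derive_eq H2).
  rewrite (@derive_val _ _ _ _ _ _ _ (derive_x v Uu)) -expr2 (first_integral N0 dx).
  have E : f (x u) * f (x u) ^+ (2 * N).-1 = f (x u) ^+ (2 * N).
    by rewrite -exprS; congr (_ ^+ _); lia.
  by rewrite -E -natr1; field; exact: rho_neq0.
have da (a : R -> R) da : is_derive (x u) 1 a da -> differentiable (fun w => a (x w)) u.
  move=> Ha; apply: (differentiable_comp (differentiable_x Uu)).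
  by apply/derivable1_diffP; exact: is_derive_derivable Ha.
have dgr : differentiable (fun w => cat_grad (X w)) u.
  apply: differentiable_mx => a b; rewrite ord1; case: (split_ordP b) => e ->.
    apply: (@differentiable_near_eq _ _ _ (fun w => - (f (x w) * f1 (x w) / rho))).
      by near=> w; rewrite row_mxEl mxE [e]ord1 eqxx mulr1n.
    apply: (@da (fun y => - (f y * f1 y / rho))).
    have H := is_derive_mul (derive_f (x_domain Uu)) (derive_f1 N0 (x_domain Uu)).
    have -> : (fun y => - (f y * f1 y / rho)) = (fun y => - rho^-1 * (f y * f1 y)).
      by apply/funext => w; rewrite mulNr mulrC.
    exact: is_derive_cmul H.
  apply: (@differentiable_near_eq _ _ _ (fun w => X w 0 (rshift 1 e))).
    by near=> w; rewrite row_mxEr mxE.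
  exact: differentiable_entry.
have DG : 'D_v (fun w => cat_grad (X w)) u = partial i X u - (n%:R * f (x u) ^+ (2 * N) * partial i X u 0 0) *: delta_mx 0 0.
  apply/rowP => b; rewrite derive_coord; last exact: diff_derivable.
  case: (split_ordP b) => e ->; rewrite [in RHS]mxE [X in _ = _ + X]mxE [X in _ = _ - X]mxE [X in _ = _ - _ * X]mxE.
    have -> : (fun w => cat_grad (X w) 0 (lshift n e)) = (fun w => - (f (x w) * f1 (x w) / rho)).
      by apply/funext => w; rewrite row_mxEl mxE [e]ord1 eqxx mulr1n.
    rewrite (@derive_val _ _ _ _ _ _ _ dG) [e]ord1.
    have -> : lshift n 0 = 0 :> 'I_(1 + n) by exact/val_inj.
    by rewrite eqxx mulr1 /partial -/v; ring.
  have -> : (fun w => cat_grad (X w) 0 (rshift 1 e)) = (fun w => X w 0 (rshift 1 e)).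
    by apply/funext => w; rewrite row_mxEr mxE.
  rewrite andbF mulr0 subr0 derive_coord//.
  exact: diff_derivable.
have H := is_derive_dot v dgr (smooth_differentiable2 sX (delta_mx 0 j) Uu).
have := @derive_val _ _ _ _ _ _ _ H.
rewrite (@near_eq_derive _ _ _ _ (cst 0)); last first.
  near=> w; apply: cat_grad_tangent; near: w; exact: near_open.
rewrite derive_cst DG => /esym/eqP; rewrite addrC addr_eq0 => /eqP E.
apply: (etrans E); congr (- _); rewrite gramE.
apply: (etrans (dotDl _ _ _)); congr (_ + _).
rewrite -scaleNr; apply: (etrans (dotZl _ _ _)); rewrite mulNr mulrA.
by congr (- (_ * _)); exact: (etrans (dotC _ _) (dot_deltar _ _)).
Unshelve. all: by end_near. Qed.


Lemma cat_grad_norm u : U u ->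
  dot (cat_grad (X u)) (cat_grad (X u)) = rho ^- 2 * f (x u) ^+ 2 * f (x u) ^+ (2 * N).
Proof.
move=> Uu; have [w [_ ww E]] := cat_point Uu.
have rE : rsubmx (X u) = (f (x u) / rho) *: w by rewrite {1}E row_mxKr.
rewrite /cat_grad -/(x u) dot_row_mx !rE dotZl dotZr ww mulr1.
have := first_integral N0 (x_domain Uu).
move: (f _) (f1 _) (f _ ^+ (2 * N)) => y t q E2.
transitivity (y ^+ 2 / rho ^+ 2 * (t ^+ 2 + 1)); last by rewrite E2 subrK mulrAC mulrC mulrA.
by field; exact: rho_neq0.
Qed.

Lemma cat_grad_norm_gt0 u : U u -> 0 < dot (cat_grad (X u)) (cat_grad (X u)).
Proof.
move=> Uu; rewrite cat_grad_norm//; have f0 := f_gt0 N0 (x_domain Uu).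
by rewrite !mulr_gt0 ?exprn_gt0// invr_gt0 exprn_gt0// cat_R_gt0.
Qed.

Lemma cat_normal u : U u -> exists M, unit_normal X u M.
Proof.
move=> Uu; have g0 := cat_grad_norm_gt0 Uu.
exists ((Num.sqrt (dot (cat_grad (X u)) (cat_grad (X u))))^-1 *: cat_grad (X u)); split.
  rewrite dotZl dotZr mulrA -invfM -expr2 sqr_sqrtr ?ltW// mulVf// gt_eqF//.
by move=> i; rewrite dotZl cat_grad_tangent// mulr0.
Qed.

(** The gradient is orthogonal to all tangent vectors, hence proportional to any
    unit normal. *)
Lemma cat_grad_normal u M : U u -> unit_normal X u M ->
  cat_grad (X u) = dot (cat_grad (X u)) M *: M.
Proof.
move=> Uu nM; have [NN DN] := unit_normal_mx nM.
have := tangent_projection NN DN; rewrite -gram_frame => /(_ (ug Uu)) P.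
have GD : cat_grad (X u) *m (tangent_frame X u)^T = 0.
  apply/matrixP => i j; rewrite ord1 [RHS]mxE -[RHS](cat_grad_tangent (delta_mx 0 j) Uu) mxE.
  by apply: eq_bigr => a _; rewrite !mxE.
have : cat_grad (X u) *m (1%:M - M^T *m M) = 0 by rewrite -P !mulmxA GD !mul0mx.
rewrite mulmxBr mulmx1 mulmxA [cat_grad _ *m M^T]mx11_scalar -dotE mul_scalar_mx => /eqP.
by rewrite subr_eq0 => /eqP.
Qed.

(** By [cat_grad_second] the shape operator is, up to a scalar, the identity
    minus an operator of rank one whose trace is n; its trace is zero and
    that of its square is proportional to n (n - 1). *)
Lemma cat_shape u M : U u -> unit_normal X u M ->
  \tr (shape_operator X u M) = 0 /\
  \tr (shape_operator X u M *m shape_operator X u M) =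
    n%:R * N%:R / dot (cat_grad (X u)) (cat_grad (X u)).
Proof.
move=> Uu nM; have Gb := cat_grad_normal Uu nM.
set b := dot (cat_grad (X u)) M in Gb.
have bb : b ^+ 2 = dot (cat_grad (X u)) (cat_grad (X u)).
  by rewrite {2}Gb dotZr -/b expr2.
have b0 : b != 0 by rewrite -sqrf_eq0 bb gt_eqF// cat_grad_norm_gt0.
pose g := gram X u; pose cc := f (x u) ^+ (2 * N).
pose a : 'cV[R]_n := \col_i partial i X u 0 0.
have ugu : g \in unitmx by exact: ug.
have SE : second_form X u M = - b^-1 *: (g - (n%:R * cc) *: (a *m a^T)).
  apply/matrixP => i j; have := cat_grad_second i j Uu.
  rewrite Gb dotZl -/b [dot M _]dotC => E.
  rewrite [LHS]mxE; apply: (mulfI b0); rewrite E.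
  have Eb y : b * (- b^-1 * y) = - y by rewrite mulNr mulrN mulVKf.
  rewrite [X in _ = _ * X]mxE Eb; congr (- _).
  rewrite [RHS]mxE [X in _ = _ + X]mxE; congr (_ - _).
  by rewrite [RHS]mxE; congr (_ * _); rewrite mxE big_ord1 !mxE.
have ShE : shape_operator X u M = - b^-1 *: (1%:M - (n%:R * cc) *: (invmx g *m a *m a^T)).
  rewrite /shape_operator SE -scalemxAr mulmxBr mulVmx// -scalemxAr mulmxA.
  by [].
pose s := (a^T *m invmx g *m a) 0 0.
have sE : a^T *m (invmx g *m a) = s%:M by rewrite mulmxA [LHS]mx11_scalar.
have ccs : cc * s = 1.
  have [NN DN] := unit_normal_mx nM.
  have := tangent_projection NN DN; rewrite -gram_frame => /(_ ugu) /matrixP/(_ 0 0).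
  have -> : ((tangent_frame X u)^T *m invmx (gram X u) *m tangent_frame X u) 0 0 = s.
    have aE j : a j 0 = tangent_frame X u j 0 by rewrite !mxE.
    rewrite /s mxE [RHS]mxE; apply: eq_bigr => j _; rewrite aE; congr (_ * _).
    rewrite mxE [RHS]mxE; apply: eq_bigr => i _; congr (_ * _).
    by rewrite mxE [RHS]mxE aE.
  have -> : (1%:M - M^T *m M) 0 0 = 1 - M 0 0 * M 0 0.
    by rewrite !mxE big_ord1 !mxE eqxx.
  move=> sE0.
  have G0 : (cat_grad (X u)) 0 0 = b * M 0 0 by rewrite Gb mxE.
  have G0' : (cat_grad (X u)) 0 0 = - (f (x u) * f1 (x u) / rho) by exact: row_mx00.
  have := cat_grad_norm Uu; rewrite -bb -/cc => b2.
  have : b ^+ 2 * (M 0 0 * M 0 0) = f (x u) ^+ 2 * (cc - 1) / rho ^+ 2.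
    transitivity ((b * M 0 0) ^+ 2); first by ring.
    by rewrite -G0 G0' sqrrN expr_div_n exprMn (first_integral N0 (x_domain Uu)).
  have fn0 : f (x u) != 0 by rewrite gt_eqF// f_gt0// x_domain.
  have cc0 : cc != 0 by rewrite expf_neq0.
  rewrite sE0 b2 => E.
  have {}E : cc * (M 0 0 * M 0 0) = cc - 1.
    have f2 : rho ^- 2 * f (x u) ^+ 2 != 0 by rewrite mulf_neq0 ?invr_eq0 ?expf_neq0// rho_neq0.
    apply: (mulfI f2); rewrite [LHS]mulrA E; ring.
  by rewrite mulrBr mulr1 E; ring.
have tra : \tr (invmx g *m a *m a^T) = s by rewrite mxtrace_mulC sE mxtrace_scalar.
rewrite ShE -bb; split.
  rewrite mxtraceZ raddfB/= mxtrace1 mxtraceZ tra -mulrA ccs mulr1 subrr mulr0.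
  by [].
rewrite -scalemxAl -scalemxAr !mxtraceZ.
rewrite mulmxBl mul1mx mulmxBr mulmx1 -!scalemxAl -!scalemxAr.
have -> : invmx g *m a *m a^T *m (invmx g *m a *m a^T) = s *: (invmx g *m a *m a^T).
  by rewrite -[LHS]mulmxA (mulmxA a^T) sE mul_scalar_mx -scalemxAr.
rewrite !raddfB/= !mxtraceZ tra mxtrace1.
transitivity (b^-1 ^+ 2 * (n%:R - 2 * n%:R * (cc * s) + n%:R ^+ 2 * (cc * s) ^+ 2)); first by ring.
by rewrite ccs -natr1; field.
Qed.

(** The catenoid being minimal, its Jacobi operator has no first order term; the
    vector [nu], written with the profile curve, is proportional to the normal. *)
Lemma cat_jacobi (phi : 'rV[R]_(1 + n) -> R) u M w : U u -> unit_normal X u M ->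
  dot w w = 1 -> X u = catF c (x u) w ->
  (forall p, differentiable phi p) -> (forall v p, differentiable ('D_v phi) p) ->
  let nu := row_mx ((- f1 (x u))%:M : 'rV[R]_1) w in
  jacobi X phi u M = - (\sum_a partial a (partial a phi) (X u) 
    - (f (x u) ^+ (2 * N))^-1 * 'D_nu ('D_nu phi) (X u))
    - n%:R * N%:R * rho ^+ 2 / (f (x u) ^+ 2 * f (x u) ^+ (2 * N)) * phi (X u).
Proof.
move=> Uu nM ww XE d1 d2 nu.
have [tr0 tr2] := cat_shape Uu nM.
rewrite /jacobi (hypersurface_laplace (conj oU sX) ug cat_normal Uu nM d1 d2) tr0 tr2 mul0r add0r.
have fn0 : f (x u) != 0 by rewrite gt_eqF// f_gt0// x_domain.
have cc0 : f (x u) ^+ (2 * N) != 0 by rewrite expf_neq0.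
congr (- (_ - _) - _ * _); last first.
  by rewrite cat_grad_norm//; field; rewrite cc0 fn0 rho_neq0.
have G : cat_grad (X u) = (f (x u) / rho) *: nu.
  have rE : rsubmx (X u) = (f (x u) / rho) *: w by rewrite {1}XE row_mxKr.
  rewrite /cat_grad -/(x u) rE /nu scale_row_mx; congr row_mx.
  by rewrite scale_scalar_mx mulrN mulrAC.
have := cat_grad_normal Uu nM; set b := dot _ M => Gb.
have b2 : b ^+ 2 = rho ^- 2 * f (x u) ^+ 2 * f (x u) ^+ (2 * N).
  by rewrite -cat_grad_norm// {2}Gb dotZr expr2.
have b0 : b != 0 by rewrite -sqrf_eq0 b2 !mulf_neq0 ?invr_eq0 ?expf_neq0// rho_neq0.
have ME : M = (b^-1 * (f (x u) / rho)) *: nu.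
  by rewrite -scalerA -G Gb scalerA mulVf// scale1r.
set t := _ * _ in ME.
have -> : 'D_M ('D_M phi) (X u) = t ^+ 2 * 'D_nu ('D_nu phi) (X u).
  rewrite !(derive2_partial _ _ _ d1 d2) mulr_sumr; apply: eq_bigr => i _.
  rewrite mulr_sumr; apply: eq_bigr => j _; rewrite ME !mxE; ring.
congr (_ * _); rewrite /t exprMn exprVn b2; field.
by rewrite rho_neq0 cc0 fn0.
Qed.

End Param.
End CatenoidGeometry.

(** * Smooth cut-off *)

Section Cutoff.
Variable R : realType.

(** x ^ (- k) exp (- 1 / x) extended by 0. *)
Definition flat (k : nat) (x : R) : R :=
  if 0 < x then x^-1 ^+ k * expR (- x^-1) else 0.

Lemma flat_le k x : `|flat k x| <= (k.+2)`!%:R * `|x| ^+ 2.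
Proof.
rewrite /flat; case: ifP => x0; last by rewrite normr0 mulr_ge0// exprn_ge0.
have y0 : 0 < x^-1 by rewrite invr_gt0.
rewrite ger0_norm; last by rewrite mulr_ge0 ?expR_ge0// exprn_ge0// ltW.
rewrite (gtr0_norm x0) expRN ler_pdivrMr; last exact: expR_gt0.
have := @expR_ge1Dxn R x^-1 k.+1 (ltW y0) => E.
have {}E : x^-1 ^+ k.+2 / (k.+2)`!%:R <= expR x^-1 by lra.
rewrite -mulrA -ler_pdivrMl ?ltr0n ?fact_gt0//.
have xE : x^-1 ^+ k = x ^+ 2 * x^-1 ^+ k.+2.
  have xx : x * x^-1 = 1 by rewrite mulfV// gt_eqF.
  by rewrite -[LHS]mulr1 -[X in _ * X](expr1n _ 2) -xx !exprS; ring.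
rewrite xE mulrCA ler_pM2l ?exprn_gt0// mulrC; exact: E.
Qed.

(** The powers of 1 / x make this family closed under differentiation; at 0 the
    bound [flat_le] applies. *)
Lemma is_derive_flat k (x : R) : is_derive x 1 (flat k) (flat k.+2 x - k%:R * flat k.+1 x).
Proof.
have [x0|x0|->] := ltgtP x 0.
- have -> : flat k.+2 x - k%:R * flat k.+1 x = 0.
    by rewrite /flat ltNge ltW//= mulr0 subrr.
  apply: (@near_eq_is_derive _ _ _ (cst 0)).
    near=> y; rewrite /flat ltNge ltW//=; near: y; exact: lt_nbhsl.
- apply: (@near_eq_is_derive R R R (fun y : R => y^-1 ^+ k * expR (- y^-1))).
    near=> y; rewrite /flat; suff -> : 0 < y by []; near: y; exact: lt_nbhsr.
  have dV : is_derive x 1 (fun y : R => y^-1) (- x ^- 2 * 1).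
    by apply: (@is_derive_inv1 R id); rewrite ?gt_eqF//; exact: is_derive_id.
  have H1 := is_derive_pow1 k dV.
  have dN : is_derive x 1 (fun y : R => - y^-1) (- (- x ^- 2 * 1)) by exact: (is_deriveN dV).
  have H2 := @is_derive_comp1 R (@expR R) (fun y : R => - y^-1) x _ _ (is_derive_expR (- x^-1)) dN.
  apply: (is_derive_eq (is_derive_mul H1 H2)).
  rewrite /flat x0; case: k H1 => [|k] H1 /=.
    by rewrite !mul0r mulr0 !expr0 -exprVn; ring.
  by rewrite -exprVn !exprS; ring.
- have -> : flat k.+2 0 - k%:R * flat k.+1 0 = 0 by rewrite /flat ltxx mulr0 subrr.
  have H : h^-1 *: ((flat k \o shift 0) (h *: 1) - flat k 0) @[h --> 0^'] --> (0 : R).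
    apply/cvgrPdist_le => e e0; near=> h.
    have h0 : h != 0 by near: h; exact: nbhs_dnbhs_neq.
    rewrite /= addr0 sub0r normrN [flat k 0]/flat ltxx subr0 /GRing.scale/= mulr1 normrM normfV.
    rewrite ler_pdivrMl ?normr_gt0// (le_trans (flat_le _ _))//.
    rewrite expr2 mulrCA ler_wpM2l//.
    rewrite -ler_pdivlMl ?ltr0n ?fact_gt0// mulrC.
    near: h; apply: dnbhs0_le; exact: divr_gt0.
  by apply: DeriveDef; [apply/cvg_ex; exists 0; exact: H|exact: cvg_lim H].
Unshelve. all: by end_near. Qed.

Lemma ndiff1_flat A n k : ndiff1 A n (flat k).
Proof.
elim: n k => [|n IH] k; first by move=> x _; exact: is_derive_derivable (is_derive_flat k x).
exists (fun x => flat k.+2 x + - k%:R * flat k.+1 x); split.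
  by move=> x _; rewrite mulNr; exact: is_derive_flat.
apply: ndiff1D => //; apply: ndiff1M => //; exact: ndiff1_cst.
Qed.

Lemma flat_gt0 k x : 0 < x -> 0 < flat k x.
Proof. by move=> x0; rewrite /flat x0 mulr_gt0 ?expR_gt0// exprn_gt0// invr_gt0. Qed.

Lemma flat_eq0 k x : x <= 0 -> flat k x = 0.
Proof. by move=> x0; rewrite /flat ltNge x0. Qed.

Lemma flat_ge0 k x : 0 <= flat k x.
Proof. by have [/(flat_gt0 k)/ltW|/flat_eq0 ->] := ltrP 0 x. Qed.

(** A smooth map of the line into ]-b, b[ which is the identity on [-a, a]. *)
Definition clamp (a b x : R) : R :=
  x * (flat 0 (b ^+ 2 - x ^+ 2) / (flat 0 (b ^+ 2 - x ^+ 2) + flat 0 (x ^+ 2 - a ^+ 2))).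

Section Clamp.
Variables a b : R.
Hypotheses (a0 : 0 < a) (ab : a < b).

Let den_gt0 x : 0 < flat 0 (b ^+ 2 - x ^+ 2) + flat 0 (x ^+ 2 - a ^+ 2).
Proof.
have ab2 : a ^+ 2 < b ^+ 2 by rewrite ltrXn2r// ?nnegrE ?ltW// (lt_trans a0).
have [xb|bx] := ltrP (x ^+ 2) (b ^+ 2).
  by rewrite ltr_pwDl ?flat_ge0// flat_gt0// subr_gt0.
by rewrite ltr_wpDl ?flat_ge0// flat_gt0// subr_gt0 (lt_le_trans ab2).
Qed.

Lemma ndiff1_clamp A n : ndiff1 A n (clamp a b).
Proof.
have H1 : ndiff1 A n (fun x => flat 0 (b ^+ 2 + (-1) * x ^+ 2)).
  apply: (@ndiff1_comp _ setT) => //; first exact: ndiff1_flat.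
  apply: ndiff1D; first exact: ndiff1_cst.
  by apply: ndiff1M; [exact: ndiff1_cst|apply: ndiff1X; exact: ndiff1_id].
have H2 : ndiff1 A n (fun x => flat 0 (x ^+ 2 + - a ^+ 2)).
  apply: (@ndiff1_comp _ setT) => //; first exact: ndiff1_flat.
  by apply: ndiff1D; [apply: ndiff1X; exact: ndiff1_id|exact: ndiff1_cst].
have -> : clamp a b = fun x => x * (flat 0 (b ^+ 2 + (-1) * x ^+ 2) *
   (flat 0 (b ^+ 2 + (-1) * x ^+ 2) + flat 0 (x ^+ 2 + - a ^+ 2))^-1).
  by apply/funext => x; rewrite mulN1r.
apply: ndiff1M; first exact: ndiff1_id.
apply: ndiff1M => //; apply: ndiff1V; last exact: ndiff1D.
by move=> x _; rewrite mulN1r gt_eqF.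
Qed.

Lemma clamp_id x : `|x| <= a -> clamp a b x = x.
Proof.
move=> xa; have x2 : x ^+ 2 <= a ^+ 2.
  by rewrite -real_normK ?num_real// lerXn2r// nnegrE ltW.
have := den_gt0 x; rewrite /clamp [flat 0 (x ^+ 2 - _)]flat_eq0 ?subr_le0// addr0 => d0.
by rewrite mulfV ?mulr1// gt_eqF.
Qed.

Lemma clamp_lt x : `|clamp a b x| < b.
Proof.
have b0 : 0 < b by exact: lt_trans ab.
have [xb|bx] := ltrP `|x| b; last first.
  rewrite /clamp flat_eq0 ?mul0r ?mulr0 ?normr0// subr_le0.
  by rewrite -[x ^+ 2]real_normK ?num_real// lerXn2r// nnegrE ltW.
apply: le_lt_trans xb; rewrite /clamp normrM ler_piMr//.
rewrite ger0_norm; last by rewrite divr_ge0 ?flat_ge0// ltW.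
by rewrite ler_pdivrMr// mul1r lerDl flat_ge0.
Qed.

End Clamp.
End Cutoff.

(** * Separated functions a(p_0) g(b(p_0) p') *)

Section Separated.
Variables (R : realType) (N : nat).
Local Notation n := N.+1.
Variables (g : 'rV[R]_n -> R) (a a1 a2 b b1 b2 : R -> R).
Hypothesis sg : smooth_on setT g.
Hypothesis da : forall y : R, is_derive y 1 a (a1 y).
Hypothesis da1 : forall y : R, is_derive y 1 a1 (a2 y).
Hypothesis db : forall y : R, is_derive y 1 b (b1 y).
Hypothesis db1 : forall y : R, is_derive y 1 b1 (b2 y).

Definition sep_arg (p : 'rV[R]_(1 + n)) : 'rV[R]_n := b (p 0 0) *: rsubmx p.
(** In the coordinates p = F(x, w) of the catenoid, and with b the inverse of the
    radius, this is a radial function times g(w); as a function on the ambient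
    space it is smooth. *)
Definition separated (p : 'rV[R]_(1 + n)) : R := a (p 0 0) * g (sep_arg p).

Let c1 (v p : 'rV[R]_(1 + n)) : 'rV[R]_n := b (p 0 0) *: rsubmx v + (b1 (p 0 0) * v 0 0) *: rsubmx p.
Let c2 (v p : 'rV[R]_(1 + n)) : 'rV[R]_n :=
  (2 * b1 (p 0 0) * v 0 0) *: rsubmx v + (b2 (p 0 0) * v 0 0 ^+ 2) *: rsubmx p.

Lemma separated_ndiff k : ndiff1 setT k a -> ndiff1 setT k b -> ndiff k separated.
Proof.
move=> ka kb; apply: ndiffM.
  by apply: (@ndiff_comp1 _ _ setT) => //; exact: ndiff_coord.
apply: ndiff_compmap => [|i]; first by move/smooth_ndiff: sg; exact.
have -> : (fun u => sep_arg u 0 i) = (fun u => b (u 0 0) * u 0 (rshift 1 i)).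
  by apply/funext => u; rewrite !mxE.
apply: ndiffM; last exact: ndiff_coord.
by apply: (@ndiff_comp1 _ _ setT) => //; exact: ndiff_coord.
Qed.

Let g1 p : differentiable g p. Proof. exact: (sg [::]). Qed.
Let g2 v p : differentiable ('D_v g) p. Proof. exact: (sg [:: v]). Qed.

Let dcoord (p v : 'rV[R]_(1 + n)) i : is_derive p v (fun q : 'rV[R]_(1 + n) => q 0 i) (v 0 i).
Proof.
rewrite -(derive_coord_fun i v p); apply: derivableP; apply: diff_derivable.
exact: differentiable_coord.
Qed.

Let dreal (h dh : R -> R) (p v : 'rV[R]_(1 + n)) : is_derive (p 0 0) 1 h (dh (p 0 0)) ->
  is_derive p v (fun q : 'rV[R]_(1 + n) => h (q 0 0)) (dh (p 0 0) * v 0 0).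
Proof.
move=> Hh; apply: (is_derive_eq (derive_comp_real v Hh (differentiable_coord _ _ _))).
by rewrite derive_coord_fun.
Qed.

Let diffreal (h : R -> R) (dh : R) (p : 'rV[R]_(1 + n)) : is_derive (p 0 0) 1 h dh ->
  differentiable (fun q : 'rV[R]_(1 + n) => h (q 0 0)) p.
Proof.
move=> Hh; apply: (@differentiable_comp _ _ _ _ (fun q : 'rV[R]_(1 + n) => q 0 0) h).
  exact: differentiable_coord.
by apply/derivable1_diffP; exact: is_derive_derivable Hh.
Qed.

Let diff_arg p : differentiable sep_arg p.
Proof.
apply: differentiable_mx => i j; rewrite ord1.
have -> : (fun u => sep_arg u 0 j) = (fun u => b (u 0 0) * u 0 (rshift 1 j)).
  by apply/funext => u; rewrite !mxE.
apply: differentiable_mul; last exact: differentiable_coord.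
exact: (diffreal (db _)).
Qed.

Let derive_arg p v : 'D_v sep_arg p = c1 v p.
Proof.
apply/rowP => i; rewrite derive_coord; last exact: diff_derivable.
have -> : (fun u => sep_arg u 0 i) = (fun u => b (u 0 0) * u 0 (rshift 1 i)).
  by apply/funext => u; rewrite !mxE.
rewrite (@derive_val _ _ _ _ _ _ _ (is_derive_mul (dreal v (db _)) (dcoord p v (rshift 1 i)))).
by rewrite !mxE; ring.
Qed.

Lemma separated_derive (p v : 'rV[R]_(1 + n)) :
  'D_v separated p = a1 (p 0 0) * v 0 0 * g (sep_arg p) + a (p 0 0) * 'D_(c1 v p) g (sep_arg p).
Proof.
have Hg : is_derive p v (fun q => g (sep_arg q)) ('D_(c1 v p) g (sep_arg p)).
  have dgs : differentiable (g \o sep_arg) p by apply: differentiable_comp; [exact: diff_arg|exact: g1].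
  apply: DeriveDef; first exact: diff_derivable.
  by rewrite -derive_arg; exact: (@derive_comp _ _ _ _ sep_arg g p v (diff_arg p) (g1 _)).
rewrite (@derive_val _ _ _ _ _ _ _ (is_derive_mul (dreal v (da _)) Hg)).
by rewrite addrC mulrC.
Qed.

Lemma separated_derive2 (p v : 'rV[R]_(1 + n)) :
  'D_v ('D_v separated) p =
    a2 (p 0 0) * v 0 0 ^+ 2 * g (sep_arg p) +
    2 * a1 (p 0 0) * v 0 0 * 'D_(c1 v p) g (sep_arg p) +
    a (p 0 0) * ('D_(c1 v p) ('D_(c1 v p) g) (sep_arg p) + 'D_(c2 v p) g (sep_arg p)).
Proof.
have -> : 'D_v separated = fun q => v 0 0 * (a1 (q 0 0) * g (sep_arg q)) +
    a (q 0 0) * \sum_i (b (q 0 0) * v 0 (rshift 1 i) + v 0 0 * (b1 (q 0 0) * q 0 (rshift 1 i)))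
       * partial i g (sep_arg q).
  apply/funext => q; rewrite separated_derive; congr (_ + _ * _); first by ring.
  rewrite derive_partial//; apply: eq_bigr => i _; rewrite /GRing.scale/= !mxE.
  by congr (_ * _); ring.
have Hg : is_derive p v (fun q => g (sep_arg q)) ('D_(c1 v p) g (sep_arg p)).
  have dgs : differentiable (g \o sep_arg) p by apply: differentiable_comp; [exact: diff_arg|exact: g1].
  apply: DeriveDef; first exact: diff_derivable.
  by rewrite -derive_arg; exact: (@derive_comp _ _ _ _ sep_arg g p v (diff_arg p) (g1 _)).
have Hp i : is_derive p v (fun q => partial i g (sep_arg q)) ('D_(c1 v p) (partial i g) (sep_arg p)).
  have dgs : differentiable (partial i g \o sep_arg) p.
    by apply: differentiable_comp; [exact: diff_arg|exact: g2].
  apply: DeriveDef; first exact: diff_derivable.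
  rewrite -derive_arg.
  exact: (@derive_comp _ _ _ _ sep_arg (partial i g) p v (diff_arg p) (g2 _ _)).
have Hc i : is_derive p v
    (fun q : 'rV[R]_(1 + n) => b (q 0 0) * v 0 (rshift 1 i) + v 0 0 * (b1 (q 0 0) * q 0 (rshift 1 i)))
    (c2 v p 0 i).
  have H1 := is_derive_mul (dreal v (db (p 0 0))) (is_derive_cst (v 0 (rshift 1 i)) p v).
  have H2 := is_derive_cmul (v 0 0) (is_derive_mul (dreal v (db1 (p 0 0))) (dcoord p v (rshift 1 i))).
  apply: (is_derive_eq (is_derive_add H1 H2)).
  by rewrite /cst !mxE; ring.
have Hs := is_derive_bigsum _ _ (fun i => is_derive_mul (Hc i) (Hp i)).
have H1 := is_derive_cmul (v 0 0) (is_derive_mul (dreal v (da1 (p 0 0))) Hg).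
have H := is_derive_add H1 (is_derive_mul (dreal v (da (p 0 0))) (Hs (index_enum _) xpredT)).
apply: (etrans (@derive_val _ _ _ _ _ _ _ H)).
have S1 : \sum_i (b (p 0 0) * v 0 (rshift 1 i) + v 0 0 * (b1 (p 0 0) * p 0 (rshift 1 i)))
       * partial i g (sep_arg p) = 'D_(c1 v p) g (sep_arg p).
  rewrite derive_partial//; apply: eq_bigr => i _; rewrite /GRing.scale/= !mxE.
  by congr (_ * _); ring.
have S2 : \sum_i ((b (p 0 0) * v 0 (rshift 1 i) + v 0 0 * (b1 (p 0 0) * p 0 (rshift 1 i)))
       * 'D_(c1 v p) (partial i g) (sep_arg p) + partial i g (sep_arg p) * c2 v p 0 i) =
   'D_(c1 v p) ('D_(c1 v p) g) (sep_arg p) + 'D_(c2 v p) g (sep_arg p).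
  rewrite big_split; congr (_ + _); last first.
    by rewrite derive_partial//; apply: eq_bigr => i _; rewrite mulrC.
  rewrite (@derive2_partial R N)//; apply: eq_bigr => i _.
  rewrite derive_partial; last exact: g2.
  rewrite mulr_sumr; apply: eq_bigr => j _; rewrite [LHS]mulrA; congr (_ * _).
  by rewrite !mxE; ring.
rewrite S1 S2; ring.
Qed.

End Separated.

Section CatenoidSeparated.
Variables (R : realType) (N m : nat) (c : profile R N.+1).
Hypothesis N0 : (0 < N)%N.
Local Notation n := N.+1.
Local Notation f := (cat_f c).
Local Notation f1 := (derive1 (cat_f c)).
Local Notation W := (cat_W c).
Local Notation rho := (cat_R c).

(** The profile curve goes on beyond W, which leaves room for a cut-off outside
    the catenoid. *)
Lemma margin : exists A B, [/\ W < A, A < B & in_domain c B].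
Proof.
have W0 := cat_W_gt0 c.
have [t Wt tL] : exists2 t, W < t & in_domain c t.
  have := cat_W_lt c; rewrite /in_domain; case: (cat_L c) => [r|_|//].
    rewrite lte_fin => Wr; exists ((W + r) / 2); first by rewrite midf_lt.
    by rewrite gtr0_norm ?lte_fin ?midf_lt// divr_gt0// addr_gt0// (lt_trans W0).
  by exists (W + 1); [rewrite ltrDl|rewrite ltry].
by exists ((W + t) / 2), t; rewrite !midf_lt.
Qed.

Lemma meridianE x (w : 'rV[R]_n) : in_domain c x -> dot w w = 1 ->
  meridian c x w = row_mx ((f x ^+ N)^-1%:M : 'rV[R]_1) ((f1 x / f x ^+ N) *: w).
Proof.
move=> dx ww; have fx0 := f_gt0 N0 dx.
have TE : derive1 (fun y => catF c y w) x = row_mx (rho^-1%:M : 'rV[R]_1) ((f1 x / rho) *: w).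
  have H i j : is_derive x 1 (fun y => catF c y w i j) (row_mx (rho^-1%:M : 'rV[R]_1) ((f1 x / rho) *: w) i j).
    rewrite ord1; case: (split_ordP j) => k ->.
      have -> : (fun y => catF c y w 0 (lshift n k)) = fun y => rho^-1 * y.
        by apply/funext => y; rewrite row_mxEl mxE [k]ord1 eqxx mulrC.
      rewrite row_mxEl mxE [k]ord1 eqxx -[X in is_derive _ _ _ X]/(rho^-1).
      by apply: (is_derive_eq (is_derive_cmul rho^-1 (is_derive_id x 1))); rewrite mulr1.
    have -> : (fun y => catF c y w 0 (rshift 1 k)) = fun y => (w 0 k / rho) * f y.
      by apply/funext => y; rewrite row_mxEr mxE; ring.
    rewrite row_mxEr mxE.
    by apply: (is_derive_eq (is_derive_cmul (w 0 k / rho) (derive_f dx))); ring.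
  rewrite derive1E; have dF : derivable (fun y => catF c y w) x 1.
    by apply/derivable_mxP => i j; exact: is_derive_derivable (H i j).
  apply/matrixP => i j; rewrite derive_coord//.
  exact: (@derive_val _ _ _ _ _ _ _ (H i j)).
rewrite /meridian TE dot_row_mx dotZl dotZr ww mulr1.
have -> : rho^-1 * rho^-1 + f1 x / rho * (f1 x / rho) = (f x ^+ N / rho) ^+ 2.
  rewrite expr_div_n -exprM mulnC; have := first_integral N0 dx.
  move=> E; rewrite -[f x ^+ (2 * N)](subrK 1) -E.
  by field; exact: rho_neq0.
rewrite sqrtr_sqr ger0_norm ?divr_ge0 ?exprn_ge0 ?ltW// ?cat_R_gt0//.
have fN0 : f x ^+ N != 0 by rewrite expf_neq0// gt_eqF.
rewrite scale_row_mx scale_scalar_mx scalerA; congr (row_mx _%:M (_ *: _)).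
  by field; rewrite fN0 rho_neq0.
by field; rewrite fN0 rho_neq0.
Qed.

Variables (A B : R).
Hypotheses (WA : W < A) (AB : A < B) (dB : in_domain c B).

Let A0 : 0 < A. Proof. exact: lt_trans (cat_W_gt0 c) WA. Qed.
Let B0 : 0 < B. Proof. exact: lt_trans AB. Qed.

(** A function of the abscissa on the profile curve, extended to the whole
    axis and rescaled to the unit ball. *)
Definition extend (h : R -> R) (y : R) : R := h (clamp A B (rho * y)).

Lemma clamp_domain x : in_domain c (clamp A B x).
Proof.
apply: in_domain_le dB; rewrite [`|B|](gtr0_norm B0) ltW// clamp_lt//.
Qed.

Lemma ndiff1_extend h k : ndiff1 [set x | in_domain c x] k h -> ndiff1 setT k (extend h).
Proof.
move=> Hh; apply: (@ndiff1_comp R [set x | in_domain c x] setT k h (fun y => clamp A B (rho * y))) => //.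
  by move=> x _; exact: clamp_domain.
apply: (@ndiff1_comp R setT setT k (clamp A B) (fun y => rho * y)) => //.
  exact: ndiff1_clamp.
by apply: ndiff1M; [exact: ndiff1_cst|exact: ndiff1_id].
Qed.

Lemma extendE h y : `|rho * y| <= A -> extend h y = h (rho * y).
Proof. by move=> yA; rewrite /extend clamp_id. Qed.

Lemma near_margin y : `|rho * y| < A -> \forall z \near y, `|rho * z| < A.
Proof.
move=> yA.
have cnt : {for y, continuous (fun z => `|rho * z|)}.
  apply: (@continuous_comp _ _ _ (fun z => rho * z) (fun t : R => `|t|)); last exact: norm_continuous.
  exact: mulrl_continuous.
exact: (cvgr_lt _ cnt _ yA).
Qed.

Lemma derive_extend h h1 y : (forall x, in_domain c x -> is_derive x 1 h (h1 x)) ->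
  `|rho * y| < A -> is_derive y 1 (extend h) (rho * extend h1 y).
Proof.
move=> dh yA.
apply: (@near_eq_is_derive R R R (fun y => h (rho * y))).
  near=> z; rewrite extendE// ltW//; near: z; exact: near_margin.
have dy : in_domain c (rho * y).
  by apply: in_domain_le dB; rewrite ltW// (lt_trans yA)// gtr0_norm.
have dl : is_derive y 1 (fun y : R => rho * y) rho.
  by apply: (is_derive_eq (is_derive_cmul rho (is_derive_id y 1))); rewrite mulr1.
apply: (is_derive_eq (is_derive_comp1 (dh _ dy) dl)).
by rewrite extendE ?ltW// mulrC.
Unshelve. all: by end_near. Qed.

(** The first two derivatives of an extension, as global functions whose
    values are known near the profile. *)
Lemma extend_derivatives h h1 h2 :
  (forall k, ndiff1 [set x | in_domain c x] k h) ->
  (forall x, in_domain c x -> is_derive x 1 h (h1 x)) ->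
  (forall x, in_domain c x -> is_derive x 1 h1 (h2 x)) ->
  exists e1 e2, [/\ forall y : R, is_derive y 1 (extend h) (e1 y),
    forall y : R, is_derive y 1 e1 (e2 y) &
    forall y, `|rho * y| < A -> e1 y = rho * h1 (rho * y) /\ e2 y = rho ^+ 2 * h2 (rho * y)].
Proof.
move=> sh dh dh1; have [e1 [He1 [e2 [He2 _]]]] := ndiff1_extend (sh 2).
exists e1, e2; split=> [y|y|y yA]; [exact: He1|exact: He2|].
have E1 z : `|rho * z| < A -> e1 z = rho * extend h1 z.
  move=> zA; have [_ <-] := derive_extend dh zA.
  by have [_ <-] := He1 z I.
split; first by rewrite E1// extendE// ltW.
have [_ <-] := He2 y I.
rewrite (@near_eq_derive _ _ _ _ (fun z => rho * extend h1 z)).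
  have H := is_derive_cmul rho (derive_extend dh1 yA).
  by rewrite (@derive_val _ _ _ _ _ _ _ H) extendE ?ltW// mulrA.
near=> z; apply: E1; near: z; exact: near_margin.
Unshelve. all: by end_near. Qed.

Variables (g : 'rV[R]_n -> R) (psi psi1 psi2 : R -> R).
Hypothesis hg : @harmonics R n m g.
Hypothesis spsi : forall k, ndiff1 [set x | in_domain c x] k psi.
Hypothesis dpsi : forall x, in_domain c x -> is_derive x 1 psi (psi1 x).
Hypothesis dpsi1 : forall x, in_domain c x -> is_derive x 1 psi1 (psi2 x).
Hypothesis psi_ode : forall x, in_domain c x ->
  psi2 x = (m%:R * (N%:R + m%:R - 1) * f x ^+ (2 * N) - n%:R * N%:R) / f x ^+ 2 * psi x.

Definition cat_separated : 'rV[R]_(1 + n) -> R :=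
  separated g (extend psi) (extend (fun x => rho / f x)).

Let f0 x : in_domain c x -> f x != 0.
Proof. by move=> dx; rewrite gt_eqF// f_gt0. Qed.

Let beta1 x := - (rho * f1 x / f x ^+ 2).
Let beta2 x := - (rho * N%:R * f x ^+ (2 * N) / f x ^+ 3) + 2 * rho * f1 x ^+ 2 / f x ^+ 3.

Let dbeta x : in_domain c x -> is_derive x 1 (fun x => rho / f x) (beta1 x).
Proof.
move=> dx; have H := is_derive_cmul rho (is_derive_inv1 (f0 dx) (derive_f dx)).
by apply: (is_derive_eq H); rewrite /beta1; ring.
Qed.

Let dbeta1 x : in_domain c x -> is_derive x 1 beta1 (beta2 x).
Proof.
move=> dx.
have H1 := @is_derive_inv1 R (fun y => f y ^+ 2) x _ (expf_neq0 2 (f0 dx)) (is_derive_pow1 2 (derive_f dx)).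
have H := is_derive_cmul (- rho) (is_derive_mul (derive_f1 N0 dx) H1).
have -> : beta1 = fun x => - rho * (f1 x * (f x ^+ 2)^-1).
  by apply/funext => y; rewrite /beta1; ring.
apply: (is_derive_eq H); rewrite /beta2.
have E : f x ^+ (2 * N) = f x * f x ^+ (2 * N).-1.
  by rewrite -exprS; congr (_ ^+ _); lia.
rewrite E; have := f0 dx; move: (f x ^+ (2 * N).-1) (f x) (f1 x) => q y t y0 /=.
by field.
Qed.

Let sbeta k : ndiff1 [set x | in_domain c x] k (fun x => rho / f x).
Proof.
apply: ndiff1M; first exact: ndiff1_cst.
by apply: ndiff1V; [move=> x; exact: f0|exact: (ndiff1_f c N0 k).1].
Qed.

Lemma cat_separated_smooth : smooth_on setT cat_separated.
Proof.
apply/smooth_ndiff => k; apply: separated_ndiff; first exact: hg.1.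
  exact: ndiff1_extend.
exact: (ndiff1_extend (@sbeta k)).
Qed.

Lemma catF_x x w : rho * catF c x w 0 0 = x.
Proof. by rewrite /catF row_mx00 mulrC divfK// rho_neq0. Qed.

Let norm_leA x : - W <= x <= W -> `|x| <= A.
Proof. by move=> xW; apply: le_trans _ (ltW WA); rewrite ler_norml. Qed.

Let sep_argE x w : - W <= x <= W -> sep_arg (extend (fun x => rho / f x)) (catF c x w) = w.
Proof.
move=> xW; rewrite /sep_arg extendE catF_x; last exact: norm_leA.
rewrite row_mxKr scalerA -[RHS]scale1r; congr (_ *: _).
have := f0 (in_domainW xW); move: (f x) => y y0.
by field; rewrite y0 rho_neq0.
Qed.

Lemma cat_separatedE x w : - W <= x <= W -> cat_separated (catF c x w) = psi x * g w.
Proof.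
move=> xW; rewrite /cat_separated /separated sep_argE//; congr (_ * _).
by rewrite extendE catF_x//; exact: norm_leA.
Qed.

Let D2scale s (w y : 'rV[R]_n) :
  'D_(s *: w) ('D_(s *: w) g) y = s ^+ 2 * 'D_w ('D_w g) y.
Proof.
have d1 p : differentiable g p by exact: (hg.1 [::]).
have d2 v p : differentiable ('D_v g) p by exact: (hg.1 [:: v]).
rewrite !(@derive2_partial R N)// mulr_sumr; apply: eq_bigr => i _.
by rewrite mulr_sumr; apply: eq_bigr => j _; rewrite !mxE; ring.
Qed.

(** By [cat_jacobi] the Jacobi equation involves the first and second derivatives
    of [g] at w; [harmonics_pde] and the first integral cancel them, and the
    radial equation is left. *)
Lemma cat_separated_jacobi : jacobi_function c cat_separated.
Proof.
split; first exact: cat_separated_smooth.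
move=> U X [oU sX XC ug] u M Uu nM.
have [w [xW ww XE]] := cat_point XC Uu; set x := rho * X u 0 0 in xW XE.
have ss := cat_separated_smooth.
have d1 p : differentiable cat_separated p by exact: (ss [::]).
have d2 v p : differentiable ('D_v cat_separated) p by exact: (ss [:: v]).
have g1 p : differentiable g p by exact: (hg.1 [::]).
rewrite (cat_jacobi N0 oU sX XC ug Uu nM ww XE d1 d2) -/x.
have [a1 [a2 [da da1 aE]]] := extend_derivatives spsi dpsi dpsi1.
have [b1 [b2 [db db1 bE]]] := extend_derivatives sbeta dbeta dbeta1.
have dx := in_domainW xW.
have xA : `|rho * (X u 0 0)| < A by rewrite (le_lt_trans _ WA)// ler_norml.
have [a1E a2E] := aE _ xA; have [b1E b2E] := bE _ xA.
have aE0 := extendE psi (ltW xA); have bE0 := extendE (fun x => rho / f x) (ltW xA).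
have D2 v : 'D_v ('D_v cat_separated) (X u) = _ := separated_derive2 hg.1 da da1 db db1 (X u) v.
have argE : sep_arg (extend (fun x => rho / f x)) (X u) = w by rewrite XE sep_argE.
have rE : rsubmx (X u) = (f x / rho) *: w by rewrite XE row_mxKr.
have fx0 := f0 dx.
pose G1 := 'D_w g w; pose G2 := 'D_w ('D_w g) w.
have Dw s r : 'D_(row_mx (s%:M : 'rV[R]_1) (r *: w)) ('D_(row_mx (s%:M : 'rV[R]_1) (r *: w)) cat_separated) (X u) =
    rho ^+ 2 * psi2 x * s ^+ 2 * g w
    + 2 * (rho * psi1 x) * s * ((rho / f x * r + rho * beta1 x * s * (f x / rho)) * G1)
    + psi x * ((rho / f x * r + rho * beta1 x * s * (f x / rho)) ^+ 2 * G2
      + (2 * (rho * beta1 x) * s * r + rho ^+ 2 * beta2 x * s ^+ 2 * (f x / rho)) * G1).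
  rewrite D2 argE rE row_mx00 row_mxKr a1E a2E b1E b2E aE0 bE0 -/x.
  by rewrite !scalerA -!scalerDl D2scale !derive_scale.
have De i : 'D_(row_mx (0%:M : 'rV[R]_1) (delta_mx 0 i)) ('D_(row_mx (0%:M : 'rV[R]_1) (delta_mx 0 i)) cat_separated) (X u) =
    psi x * ((rho / f x) ^+ 2 * partial i (partial i g) w).
  rewrite D2 argE rE row_mx00 row_mxKr aE0 bE0 -/x expr0n !mulr0 !mul0r !add0r !scale0r !addr0.
  rewrite D2scale; congr (_ * _).
  by rewrite derive0 addr0.
have e0E : delta_mx 0 (lshift n 0) = row_mx ((1 : R)%:M : 'rV[R]_1) ((0 : R) *: w).
  rewrite scale0r; apply/rowP => j; case: (split_ordP j) => k ->.
    by rewrite row_mxEl !mxE eq_shift [k]ord1 !eqxx.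
  by rewrite row_mxEr !mxE eq_shift andbF.
have eiE i : delta_mx 0 (rshift 1 i) = row_mx ((0 : R)%:M : 'rV[R]_1) (delta_mx 0 i : 'rV[R]_n).
  apply/rowP => j; case: (split_ordP j) => k ->.
    by rewrite row_mxEl !mxE eq_shift andbF mul0rn.
  by rewrite row_mxEr !mxE eq_shift.
have pde := @harmonics_pde R N m g w hg ww.
have -> : \sum_a partial a (partial a cat_separated) (X u) =
    'D_(delta_mx 0 (lshift n 0)) ('D_(delta_mx 0 (lshift n 0)) cat_separated) (X u) +
    \sum_i 'D_(delta_mx 0 (rshift 1 i)) ('D_(delta_mx 0 (rshift 1 i)) cat_separated) (X u).
  by rewrite big_split_ord big_ord1.
rewrite e0E Dw.
under eq_bigr do rewrite eiE De.
rewrite -mulr_sumr -mulr_sumr -[X in row_mx _ X]scale1r Dw.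
have -> : \sum_i partial i (partial i g) w =
    G2 + N%:R * G1 - m%:R * (N%:R + m%:R - 1) * g w.
  by move: pde; rewrite -/G1 -/G2; move: (\sum_i _) => S; lra.
have -> : cat_separated (X u) = psi x * g w by rewrite {1}XE cat_separatedE.
rewrite (psi_ode dx) /beta1 /beta2.
have FI := first_integral N0 dx.
have CE : f x ^+ (2 * N) = f1 x ^+ 2 + 1 by rewrite FI subrK.
have C0 : f1 x ^+ 2 + 1 != 0 by rewrite -CE expf_neq0.
rewrite CE -natr1; clear Dw; move: G1 G2 => h1 h2.
move: fx0 C0 (@rho_neq0 R N c).
move: (f x) (f1 x) rho (psi x) (psi1 x) (g w) (N%:R : R) (m%:R : R).
move=> y t r p p1 gw k l y0 C0 r0.
by field; rewrite y0 C0 r0.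
Qed.

Lemma cat_separated_meridian x w : - W <= x <= W -> dot w w = 1 ->
  'D_(meridian c x w) cat_separated (catF c x w) = rho * psi1 x / f x ^+ N * g w.
Proof.
move=> xW ww; have dx := in_domainW xW; have fx0 := f0 dx.
rewrite (meridianE dx ww).
have g1 p : differentiable g p by exact: (hg.1 [::]).
have [a1 [a2 [da da1 aE]]] := extend_derivatives spsi dpsi dpsi1.
have [b1 [b2 [db db1 bE]]] := extend_derivatives sbeta dbeta dbeta1.
have xA : `|rho * (catF c x w 0 0)| < A by rewrite catF_x (le_lt_trans _ WA)// ler_norml.
have [a1E _] := aE _ xA; have [b1E _] := bE _ xA.
have aE0 := extendE psi (ltW xA); have bE0 := extendE (fun x => rho / f x) (ltW xA).
rewrite catF_x in a1E b1E aE0 bE0.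
apply: (etrans (separated_derive hg.1 da db _ _)).
rewrite sep_argE// a1E b1E aE0 bE0 [rsubmx (catF c x w)]row_mxKr row_mx00 row_mxKr.
rewrite !scalerA -scalerDl derive_scale//.
rewrite [X in _ + _ * (X *: _)](_ : _ = 0).
  by rewrite scale0r mulr0 addr0.
rewrite /beta1; have := expf_neq0 N fx0; move: (f x ^+ N) (f x) (f1 x) fx0 => q y t y0 q0.
by field; rewrite q0 y0 rho_neq0.
Qed.

(** The meridian has speed f(x) ^ N / R at x; at the boundary R = W f(W) ^ N. *)
Lemma cat_separated_conormal w : dot w w = 1 ->
  (conormal_derivative c cat_separated).1 w = - (W * psi1 (- W) * g w) /\
  (conormal_derivative c cat_separated).2 w = W * psi1 W * g w.
Proof.
move=> ww; have W0 := ltW (cat_W_gt0 c).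
have WW : - W <= W <= W by rewrite lexx andbT; lra.
have WNW : - W <= - W <= W by rewrite lexx; lra.
have fN0 : f W ^+ N != 0 by rewrite expf_neq0// f0// W_domain.
have d1 p : differentiable cat_separated p by exact: (cat_separated_smooth [::]).
split.
  rewrite /= -[- meridian _ _ _]scaleN1r derive_scale// cat_separated_meridian// (f_WN c N0).1 scaleN1r; congr (- (_ * _)).
  by rewrite mulrAC; congr (_ * _); rewrite (cat_R_pow c N0) mulfK.
rewrite /= cat_separated_meridian//; congr (_ * _).
by rewrite mulrAC; congr (_ * _); rewrite (cat_R_pow c N0) mulfK.
Qed.

End CatenoidSeparated.

(** * Power series solutions of a Gegenbauer equation *)

Section PowerSeries.
Variable R : realType.

(** The coefficients of a power series that converges on ]-1, 1[. *)
Definition disc_cvg (c : nat -> R) := forall x : R, `|x| < 1 -> cvgn (pseries c x).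

(** (k + 1) t^k is at most 1 + t + ... + t^k. *)
Lemma ratio_bound (t : R) k : 0 <= t < 1 -> k.+1%:R * t ^+ k <= (1 - t)^-1.
Proof.
move=> /andP[t0 t1]; have d0 : 0 < 1 - t by lra.
rewrite -[leRHS]mul1r ler_pdivlMr//.
have : k.+1%:R * t ^+ k * (1 - t) <= 1 - t ^+ k.+1.
  elim: k => [|k IH]; first by rewrite expr0 expr1; lra.
  have E : k.+2%:R * t ^+ k.+1 * (1 - t) = t * (k.+1%:R * t ^+ k * (1 - t)) + t ^+ k.+1 * (1 - t).
    by rewrite -[k.+2%:R]natr1 !exprS; ring.
  rewrite E; have H := ler_wpM2l t0 IH.
  have : t * (1 - t ^+ k.+1) + t ^+ k.+1 * (1 - t) <= 1 - t ^+ k.+2.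
    rewrite (exprS t k.+1); have : t ^+ k.+1 <= 1 by rewrite exprn_ile1// ltW.
    have : 0 <= t ^+ k.+1 by rewrite exprn_ge0.
    move: (t ^+ k.+1) => q q0 q1; nra.
  lra.
have : 0 <= t ^+ k.+1 by rewrite exprn_ge0.
lra.
Qed.

Lemma disc_cvg_le c d : (forall k, `|c k| <= d k) -> disc_cvg d -> disc_cvg c.
Proof.
move=> cd Hd x x1; apply: normed_cvg.
apply: (@series_le_cvg _ _ (fun k => d k * `|x| ^+ k)) => [k|k|k|].
- by rewrite normr_ge0.
- by rewrite mulr_ge0 ?exprn_ge0// (le_trans _ (cd k)).
- by rewrite /= normrM normrX ler_wpM2r// exprn_ge0.
- by apply: Hd; rewrite normr_id.
Qed.

Lemma disc_cvg_natr (C : R) : 0 <= C -> disc_cvg (fun k => C * k.+1%:R).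
Proof.
move=> C0 x x1.
pose s := (1 + `|x|) / 2; pose t := `|x| / s.
have s0 : 0 < s by rewrite /s; have := normr_ge0 x; lra.
have s1 : s < 1 by rewrite /s; lra.
have t1 : 0 <= t < 1.
  rewrite /t; apply/andP; split; first by rewrite divr_ge0// ltW.
  by rewrite ltr_pdivrMr// mul1r /s; lra.
apply: normed_cvg.
apply: (@series_le_cvg _ _ (geometric (C * (1 - t)^-1) s)) => [k|k|k|].
- by rewrite normr_ge0.
- have [t0 t2] := andP t1; rewrite /=; apply: mulr_ge0; last by rewrite exprn_ge0// ltW.
  by rewrite mulr_ge0// invr_ge0 subr_ge0 ltW.
- rewrite /= !normrM normrX (ger0_norm C0) -!mulrA ler_wpM2l//.
  have -> : `|x| ^+ k = t ^+ k * s ^+ k by rewrite -exprMn /t divfK// gt_eqF.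
  rewrite normr_nat mulrA; apply: ler_wpM2r; first by rewrite exprn_ge0// ltW.
  exact: ratio_bound.
- by apply: is_cvg_geometric_series; rewrite gtr0_norm.
Qed.

(** Comparison with k t^k for a ratio t < 1: the coefficients grow no faster than
    r^(-k) for some r larger than the point considered. *)
Lemma disc_cvg_diffs c : disc_cvg c -> disc_cvg (pseries_diffs c).
Proof.
move=> Hc x x1; pose r := (1 + `|x|) / 2.
have r0 : 0 < r by rewrite /r; have := normr_ge0 x; lra.
have r1 : r < 1 by rewrite /r; lra.
have xr : `|x| < r by rewrite /r; lra.
have /Hc/cvg_series_bounded[M [_ HM]] : `|r| < 1 by rewrite gtr0_norm.
have bnd k : `|c k| * r ^+ k <= `|M| + 1.
  have := HM (`|M| + 1); rewrite (le_lt_trans (ler_norm M)) ?ltrDl// => /(_ isT k I).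
  by rewrite /= normrM normrX (gtr0_norm r0).
have C0 : 0 <= (`|M| + 1) / r by rewrite divr_ge0 ?addr_ge0// ltW.
have q1 : `| `|x| / r | < 1.
  rewrite ger0_norm; last by rewrite divr_ge0// ltW.
  by rewrite ltr_pdivrMr// mul1r.
have H := disc_cvg_natr C0 q1.
apply: normed_cvg; apply: (@series_le_cvg _ _ _ _ _ _ H) => [k|k|k].
- by rewrite normr_ge0.
- apply: mulr_ge0; first by rewrite mulr_ge0.
  by rewrite exprn_ge0// divr_ge0// ltW.
- rewrite /pseries_diffs /= !normrM normrX normr_nat expr_div_n.
  have -> : (`|M| + 1) / r * k.+1%:R * (`|x| ^+ k / r ^+ k) =
     k.+1%:R * ((`|M| + 1) / r ^+ k.+1) * `|x| ^+ k.
    by rewrite exprS; field; rewrite expf_neq0 gt_eqF.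
  rewrite ler_wpM2r ?exprn_ge0// ler_wpM2l//.
  by rewrite ler_pdivlMr ?exprn_gt0.
Qed.

Definition psum (c : nat -> R) (x : R) : R := limn (pseries c x).

Lemma derive_psum c (x : R) : disc_cvg c -> `|x| < 1 -> is_derive x 1 (psum c) (psum (pseries_diffs c) x).
Proof.
move=> Hc x1; pose r := (1 + `|x|) / 2.
have r0 : 0 < r by rewrite /r; have := normr_ge0 x; lra.
have r1 : `|r| < 1 by rewrite gtr0_norm// /r; lra.
apply: (@pseries_snd_diffs _ c r) => //.
- exact: Hc.
- exact: disc_cvg_diffs Hc r r1.
- exact: disc_cvg_diffs (disc_cvg_diffs Hc) r r1.
- by rewrite (gtr0_norm r0) /r; lra.
Qed.

Lemma ndiff1_psum c k : disc_cvg c -> ndiff1 [set x | `|x| < 1] k (psum c).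
Proof.
elim: k c => [|k IH] c Hc; first by move=> x x1; exact: is_derive_derivable (derive_psum Hc x1).
exists (psum (pseries_diffs c)); split; first by move=> x; exact: derive_psum.
by apply: IH; exact: disc_cvg_diffs.
Qed.

Lemma psum0 c : psum c 0 = c 0%N.
Proof.
apply: cvg_lim => //; apply: (@cvg_near_cst _ _ _ _ _ _ _).
near=> k; rewrite /pseries /series/=; have k0 : (0 < k)%N by near: k; exact: nbhs_infty_gt.
rewrite -(prednK k0) big_nat_recl// expr0 mulr1 big1 ?addr0// => i _.
by rewrite expr0n mulr0.
Unshelve. all: by end_near. Qed.

Lemma psum_parity c s : (forall k, (-1) ^+ k * c k = s * c k) ->
  forall x, `|x| < 1 -> disc_cvg c -> psum c (- x) = s * psum c x.
Proof.
move=> Hc x x1 ec; apply: cvg_lim => //.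
have -> : pseries c (- x) = (fun k => s * pseries c x k).
  apply/funext => k; rewrite /pseries /series/= mulr_sumr; apply: eq_bigr => i _.
  by rewrite -[- x]mulN1r exprMn mulrCA mulrA Hc mulrA.
apply: cvgMr; exact: ec.
Qed.

Section Gegenbauer.
Variables (al be h0 h1 : R).

(** Two consecutive coefficients of the solution of
    (1 - z^2) H'' = (al + be + 1) z H' + al be H with H(0) = h0, H'(0) = h1. *)
Fixpoint gegen_pair (k : nat) : R * R :=
  if k is k'.+1 then
    let p := gegen_pair k' in
    (p.2, (k'%:R + al) * (k'%:R + be) / (k'.+1%:R * k'.+2%:R) * p.1)
  else (h0, h1).

Definition gegen k := (gegen_pair k).1.

Lemma gegen_rec k : gegen k.+2 = (k%:R + al) * (k%:R + be) / (k.+1%:R * k.+2%:R) * gegen k.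
Proof. by []. Qed.

Hypotheses (al01 : 0 <= al <= 1) (be03 : 0 <= be <= 3).
Hypotheses (h00 : 0 <= h0 <= 1) (h10 : 0 <= h1 <= 1).

(** As al <= 1 and be <= 3, the recurrence factor is at most (k + 3) / (k + 2), so
    that the linear bound passes from k to k + 2. *)
Lemma gegen_bound k : 0 <= gegen k <= k.+1%:R.
Proof.
suff [] : (0 <= gegen k <= k.+1%:R) /\ (0 <= gegen k.+1 <= k.+2%:R) by [].
elim: k => [|k [IH1 IH2]]; first by split=> //; case/andP: h10 => ? ?; apply/andP; split; rewrite /gegen/=; lra.
split=> //; rewrite gegen_rec.
have k0 : (0 : R) <= k%:R by [].
have E1 : k.+1%:R = k%:R + 1 :> R by rewrite natr1.
have E2 : k.+2%:R = k%:R + 2 :> R by rewrite -natr1 E1; lra.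
have E3 : k.+3%:R = k%:R + 3 :> R by rewrite -natr1 E2; lra.
rewrite E1 E2 E3 in IH1 IH2 *; move: (k%:R) k0 (gegen k) IH1 {IH2 E1 E2 E3} => y y0 g /andP[g0 g1].
have d0 : 0 < (y + 1) * (y + 2) by rewrite mulr_gt0//; lra.
have [a0 a1] := andP al01; have [b0 b1] := andP be03.
have n0 : 0 <= (y + al) * (y + be) by apply: mulr_ge0; lra.
apply/andP; split; first by apply: mulr_ge0 => //; apply: divr_ge0 => //; exact: ltW.
rewrite mulrAC ler_pdivrMr//.
have H1 : (y + al) * (y + be) <= (y + 1) * (y + 3) by apply: ler_pM; lra.
apply: (@le_trans _ _ ((y + 1) * (y + 3) * (y + 1))).
  exact: ler_pM.
nra.
Qed.

Lemma gegen_parity (s : R) : s * h0 = h0 -> s * h1 = - h1 ->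
  forall k, (-1) ^+ k * gegen k = s * gegen k.
Proof.
move=> s0 s1 k.
suff [] : (-1) ^+ k * gegen k = s * gegen k /\ (-1) ^+ k.+1 * gegen k.+1 = s * gegen k.+1 by [].
elim: k => [|k [IH1 IH2]]; first by rewrite expr0 expr1 /gegen/= s0 s1 mul1r mulN1r.
split=> //; rewrite gegen_rec mulrCA [RHS]mulrCA; congr (_ * _).
by rewrite -IH1 !exprS !mulN1r opprK.
Qed.

Lemma disc_cvg_gegen : disc_cvg gegen.
Proof.
apply: (@disc_cvg_le _ (fun k => 1 * k.+1%:R)); last by apply: disc_cvg_natr.
by move=> k; have /andP[g0 g1] := gegen_bound k; rewrite ger0_norm// mul1r.
Qed.

Lemma gegen_ode z : `|z| < 1 ->
  (1 - z ^+ 2) * psum (pseries_diffs (pseries_diffs gegen)) z =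
  (al + be + 1) * z * psum (pseries_diffs gegen) z + al * be * psum gegen z.
Proof.
move=> z1.
have H0 : pseries gegen z @ \oo --> psum gegen z by exact: disc_cvg_gegen.
have H1 : pseries (pseries_diffs gegen) z @ \oo --> psum (pseries_diffs gegen) z.
  by apply: disc_cvg_diffs => //; exact: disc_cvg_gegen.
have H2 : pseries (pseries_diffs (pseries_diffs gegen)) z @ \oo -->
    psum (pseries_diffs (pseries_diffs gegen)) z.
  by do 2!apply: disc_cvg_diffs => //; exact: disc_cvg_gegen.
have E2 i : pseries_diffs (pseries_diffs gegen) i = (i%:R + al) * (i%:R + be) * gegen i.
  rewrite /pseries_diffs gegen_rec mulrA.
  have : i.+1%:R != 0 :> R by []; have : i.+2%:R != 0 :> R by [].
  by move: (i.+1%:R) (i.+2%:R) => x y x0 y0; field; rewrite x0 y0.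
pose S0 k := \sum_(0 <= i < k) gegen i * z ^+ i.
pose S1 k := \sum_(0 <= i < k) pseries_diffs gegen i * z ^+ i.
pose S2 k := \sum_(0 <= i < k) pseries_diffs (pseries_diffs gegen) i * z ^+ i.
have E k : S2 k.+2 = z ^+ 2 * S2 k + ((al + be + 1) * z * S1 k.+1 + al * be * S0 k.+2).
  elim: k => [|k IH].
    rewrite /S0 /S1 /S2 !big_nat_recr//= !big_geq// !E2 /pseries_diffs.
    by rewrite !expr0 expr1; ring.
  have R2 j : S2 j.+1 = S2 j + (j%:R + al) * (j%:R + be) * gegen j * z ^+ j.
    by rewrite /S2 big_nat_recr//= E2.
  have R2' j : S2 j.+1 = S2 j + j.+1%:R * (j.+2%:R * gegen j.+2) * z ^+ j.
    by rewrite /S2 big_nat_recr.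
  have R1 j : S1 j.+1 = S1 j + j.+1%:R * gegen j.+1 * z ^+ j by rewrite /S1 big_nat_recr.
  have R0 j : S0 j.+1 = S0 j + gegen j * z ^+ j by rewrite /S0 big_nat_recr.
  rewrite (R2 k.+2) IH (R2' k) (R1 k.+1) (R0 k.+2).
  have -> : k.+2%:R = k%:R + 2 :> R by rewrite -!natr1; ring.
  have -> : k.+1%:R = k%:R + 1 :> R by rewrite -!natr1.
  rewrite !exprS; ring.
have L2 : S2 k.+2 @[k --> \oo] --> psum (pseries_diffs (pseries_diffs gegen)) z.
  by rewrite (cvg_shiftS (fun k => S2 k.+1)) cvg_shiftS.
have L1 : S1 k.+1 @[k --> \oo] --> psum (pseries_diffs gegen) z by rewrite cvg_shiftS.
have L0 : S0 k.+2 @[k --> \oo] --> psum gegen z.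
  by rewrite (cvg_shiftS (fun k => S0 k.+1)) cvg_shiftS.
have LR : (z ^+ 2 * S2 k + ((al + be + 1) * z * S1 k.+1 + al * be * S0 k.+2)) @[k --> \oo] -->
   z ^+ 2 * psum (pseries_diffs (pseries_diffs gegen)) z +
   ((al + be + 1) * z * psum (pseries_diffs gegen) z + al * be * psum gegen z).
  by apply: cvgD; [exact: cvgMr H2|apply: cvgD; [exact: cvgMr L1|exact: cvgMr L0]].
rewrite (funext E) in L2.
have := cvg_unique _ L2 LR => /(_ (@Rhausdorff R)) EQ.
by rewrite mulrBl mul1r {1}EQ addrC addKr.
Qed.

End Gegenbauer.
End PowerSeries.

(** * The radial equation *)

Section Radial.
Variables (R : realType) (N M : nat) (c : profile R N.+1).
Hypotheses (N0 : (0 < N)%N) (MN : (M < N)%N).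
Local Notation f := (cat_f c).
Local Notation f1 := (derive1 (cat_f c)).
Local Notation W := (cat_W c).
Local Notation z := (prof_z c).

Variables (h0 h1 : R).
Hypotheses (h00 : 0 <= h0 <= 1) (h10 : 0 <= h1 <= 1).

Let al : R := M%:R / N%:R.
Let be : R := 2 + M.+1%:R / N%:R.

Let N0R : 0 < N%:R :> R. Proof. by rewrite ltr0n. Qed.

Let al01 : 0 <= al <= 1.
Proof. by rewrite /al divr_ge0//= ler_pdivrMr// mul1r ler_nat ltnW. Qed.

Let be03 : 0 <= be <= 3.
Proof.
have : 0 <= M.+1%:R / N%:R :> R by rewrite divr_ge0.
have : M.+1%:R / N%:R <= 1 :> R by rewrite ler_pdivrMr// mul1r ler_nat.
by rewrite /be; lra.
Qed.

Let co := gegen al be h0 h1.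
Let eco : disc_cvg co. Proof. exact: disc_cvg_gegen. Qed.

(** With al = M / N and be = 2 + (M + 1) / N, and h the power series in
    z = f' / f ^ N, the function f ^ (- N - M) h solves the radial equation of
    order M + 1; (h0, h1) = (1, 0) gives the even solution and (0, 1) the
    odd one. *)
Definition rad_h x := psum co (z x).
Definition rad_h1 x := psum (pseries_diffs co) (z x).
Let rad_h2 x := psum (pseries_diffs (pseries_diffs co)) (z x).

Lemma derive_rad_h x : in_domain c x -> is_derive x 1 rad_h (N%:R / f x ^+ N.+1 * rad_h1 x).
Proof.
move=> dx.
have H := is_derive_comp1 (derive_psum eco (prof_z_lt1 N0 dx)) (derive_prof_z N0 dx).
by apply: (is_derive_eq H); rewrite mulrC.
Qed.

Lemma derive_rad_h1 x : in_domain c x -> is_derive x 1 rad_h1 (N%:R / f x ^+ N.+1 * rad_h2 x).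
Proof.
move=> dx.
have H := is_derive_comp1 (derive_psum (disc_cvg_diffs eco) (prof_z_lt1 N0 dx)) (derive_prof_z N0 dx).
by apply: (is_derive_eq H); rewrite mulrC.
Qed.

Let f0 x : in_domain c x -> f x != 0.
Proof. by move=> dx; rewrite gt_eqF// f_gt0. Qed.

Lemma rad_h2E x : in_domain c x ->
  rad_h2 x = f x ^+ (2 * N) * ((al + be + 1) * z x * rad_h1 x + al * be * rad_h x).
Proof.
move=> dx; have := gegen_ode al01 be03 h00 h10 (prof_z_lt1 N0 dx).
rewrite (prof_z2 N0 dx) -/co -/(rad_h1 x) -/(rad_h x) -/(rad_h2 x) => <-.
by rewrite mulVKf// expf_neq0// f0.
Qed.

Lemma derive_fV K x : in_domain c x ->
  is_derive x 1 (fun x => (f x ^+ K)^-1) (- (K%:R * f1 x / (f x * f x ^+ K))).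
Proof.
move=> dx; have fx0 := f0 dx.
apply: (is_derive_eq (@is_derive_inv1 R (fun y => f y ^+ K) x _ (expf_neq0 K fx0) (is_derive_pow1 K (derive_f dx)))).
case: K => [|K] /=; first by rewrite !mul0r mulr0 oppr0.
have := expf_neq0 K fx0; rewrite (exprS (f x) K); move: (f x ^+ K) (f x) (f1 x) fx0 => q y t y0 q0.
by field; rewrite q0 y0.
Qed.

Definition rad_psi x := (f x ^+ (N + M))^-1 * rad_h x.
Definition rad_psi1 x := (f x ^+ (N + M))^-1 *
  (N%:R / f x ^+ N.+1 * rad_h1 x - (N + M)%:R * f1 x / f x * rad_h x).

Lemma derive_rad_psi x : in_domain c x -> is_derive x 1 rad_psi (rad_psi1 x).
Proof.
move=> dx; apply: (is_derive_eq (is_derive_mul (derive_fV (N + M) dx) (derive_rad_h dx))).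
rewrite /rad_psi1; have fx0 := f0 dx; have := expf_neq0 (N + M) fx0.
by move: (f x ^+ (N + M)) => p p0; field; rewrite p0 fx0 expf_neq0.
Qed.

Let pow_double (y : R) : y != 0 ->
  y ^+ (2 * N).-1 = y ^+ N * y ^+ N / y /\ y ^+ (2 * N) = y ^+ N * y ^+ N.
Proof.
move=> y0; split; last by rewrite -exprD; congr (_ ^+ _); lia.
by apply: (mulIf y0); rewrite divfK// -exprSr -exprD; congr (_ ^+ _); lia.
Qed.

Lemma derive_rad_psi1 x : in_domain c x -> is_derive x 1 rad_psi1
  ((M.+1%:R * (N%:R + M.+1%:R - 1) * f x ^+ (2 * N) - N.+1%:R * N%:R) / f x ^+ 2 * rad_psi x).
Proof.
move=> dx; have fx0 := f0 dx.
have dN1 := is_derive_cmul N%:R (derive_fV N.+1 dx).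
have H1 := is_derive_mul dN1 (derive_rad_h1 dx).
have dV1 := is_derive_inv1 fx0 (derive_f dx).
have H2 := is_derive_mul (is_derive_mul (is_derive_cmul (N + M)%:R (derive_f1 N0 dx)) dV1) (derive_rad_h dx).
have H3 := is_derive_add H1 (is_derive_cmul (-1) H2).
have H := is_derive_mul (derive_fV (N + M) dx) H3.
have -> : rad_psi1 = fun x => (f x ^+ (N + M))^-1 * (N%:R * (f x ^+ N.+1)^-1 * rad_h1 x +
     -1 * ((N + M)%:R * f1 x * (f x)^-1 * rad_h x)).
  by apply/funext => y; rewrite /rad_psi1 mulN1r.
apply: (is_derive_eq H); rewrite rad_h2E// /rad_psi.
have [E E2] := pow_double fx0.
have T2 : f x ^+ N * f x ^+ N = f1 x ^+ 2 + 1 by rewrite (first_integral N0 dx) subrK E2.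
rewrite E E2 /prof_z [f x ^+ N.+1]exprS /al /be.
have := expf_neq0 N fx0; have := expf_neq0 (N + M) fx0; have := gt_eqF N0R.
rewrite natrD -[N.+1%:R]natr1 -[M.+1%:R]natr1.
move: T2 fx0; move: (f x) (f1 x) (rad_h x) (rad_h1 x) (N%:R : R) (M%:R : R) (f x ^+ (N + M)) (f x ^+ N).
move=> y t h hh k l p q T2 y0 k0 p0 q0.
have {}k0 : k != 0 by rewrite k0.
transitivity (p^-1 * ((k + l) * (k + l + 1) * t ^+ 2 / y ^+ 2 * h - (k + l) * k * (q * q) / y ^+ 2 * h
   + l * (2 * k + l + 1) / y ^+ 2 * h)).
  by field; rewrite k0 p0 q0 y0.
rewrite T2; field; by rewrite p0 y0.
Qed.

Lemma ndiff1_rad_psi k : ndiff1 [set x | in_domain c x] k rad_psi.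
Proof.
apply: ndiff1M.
  apply: ndiff1V; first by move=> x dx; rewrite expf_neq0// f0.
  by apply: ndiff1X; exact: (ndiff1_f c N0 k).1.
apply: (@ndiff1_comp R [set x | `|x| < 1] _ k (psum co) z).
- by move=> x; exact: prof_z_lt1.
- exact: ndiff1_psum.
- exact: ndiff1_prof_z.
Qed.

Lemma rad_psi_parity s : s * h0 = h0 -> s * h1 = - h1 ->
  rad_psi (- W) = s * rad_psi W /\ rad_psi1 (- W) = - (s * rad_psi1 W).
Proof.
move=> s0 s1; have dW := W_domain c; have dNW := in_domainN dW.
have [fW f1W] := f_WN c N0.
have zW : z (- W) = - z W by rewrite /prof_z fW f1W mulNr.
have par := gegen_parity al be s0 s1.
have hW : rad_h (- W) = s * rad_h W.
  by rewrite /rad_h zW; apply: psum_parity => //; exact: prof_z_lt1.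
have par1 k : (-1) ^+ k * pseries_diffs co k = - s * pseries_diffs co k.
  have := par k.+1; rewrite exprS mulN1r mulNr => E.
  by rewrite /pseries_diffs mulrCA [RHS]mulrCA; congr (_ * _); rewrite mulNr -E opprK.
have h1W : rad_h1 (- W) = - s * rad_h1 W.
  rewrite /rad_h1 zW; apply: psum_parity => //; first exact: prof_z_lt1.
  exact: disc_cvg_diffs.
rewrite /rad_psi /rad_psi1 fW f1W hW h1W; split; ring.
Qed.

End Radial.

(** * Iterated integrals of continuous functions *)

Section BoxIntegral.
Variable R : realType.
Local Notation mu := (@lebesgue_measure R).

Lemma segment_integrable (a b : R) (F : R -> R) : continuous F ->
  mu.-integrable `[a, b] (EFin \o F).
Proof.
move=> cF; apply: continuous_compact_integrable; first exact: segment_compact.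
exact: continuous_subspaceT.
Qed.

(** Uniform continuity on the segment, by compactness. *)
Lemma Rintegral_continuous (V : normedModType R) (F : V * R -> R) (a b : R) : a <= b ->
  continuous F -> continuous (fun x => \int[mu]_(t in `[a, b]) F (x, t)).
Proof.
move=> ab cF x0.
have cF1 x : continuous (fun t => F (x, t)).
  move=> t; apply: (@continuous_comp _ _ _ (fun t : R => (x, t)) F); last exact: cF.
  exact: (@cvg_pair R V R (nbhs t) (nbhs x) (nbhs t) _ _ _ (cst x) id (cvg_cst x) cvg_id).
apply/cvgrPdist_le => e e0.
pose d := e / (b - a + 1).
have d0 : 0 < d by rewrite divr_gt0//; lra.
have /compact_near_coveringP cov := @segment_compact R a b.
have nr : \forall x \near x0, `[a, b] `<=` (fun t => `|F (x0, t) - F (x, t)| <= d).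
  apply: (cov V (nbhs x0) (fun x t => `|F (x0, t) - F (x, t)| <= d)) => t _.
  have d20 : 0 < d / 2 by rewrite divr_gt0.
  have c1 : \forall z \near (x0, t), `|F (x0, t) - F z| <= d / 2.
    exact: (cvgrPdist_le _ _).1 (cF (x0, t)) _ d20.
  have c2 : \forall s \near t, `|F (x0, t) - F (x0, s)| <= d / 2.
    exact: (cvgrPdist_le _ _).1 (cF1 x0 t) _ d20.
  case: c1 => -[A B] /= [nA nB] AB.
  near=> s x => /=.
  have h1 : `|F (x0, t) - F (x, s)| <= d / 2.
    by apply: (AB (x, s)); split=> /=; [near: x|near: s].
  have h2 : `|F (x0, t) - F (x0, s)| <= d / 2 by near: s.
  rewrite distrC in h2; rewrite [d]splitr.
  have -> : F (x0, s) - F (x, s) = (F (x0, s) - F (x0, t)) + (F (x0, t) - F (x, s)) by ring.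
  by rewrite (le_trans (ler_normD _ _))// lerD.
near=> x.
have ix y : mu.-integrable `[a, b] (EFin \o (fun t => F (y, t))) by exact: segment_integrable.
rewrite -RintegralB//.
have iB : mu.-integrable `[a, b] (EFin \o (fun t => F (x0, t) - F (x, t))).
  by apply: segment_integrable => t; apply: cvgB; exact: cF1.
rewrite (le_trans (le_normr_Rintegral _ iB))//.
apply: (@le_trans _ _ (\int[mu]_(t in `[a, b]) d)).
  apply: le_Rintegral => //.
  - by apply: segment_integrable => t; apply: cvg_norm; apply: cvgB; exact: cF1.
  - by apply: segment_integrable => t; exact: cvg_cst.
  - by near: x.
rewrite Rintegral_cst//= lebesgue_measure_itv/= lte_fin.
have [ab'|_] := ltrP a b; last by rewrite mulr0 ltW.
rewrite -EFinD/= /d mulrAC ler_pdivrMr ?ler_wpM2l ?ltW//; lra.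
Unshelve. all: by end_near. Qed.


(** The function is at least half its value at [t] on a segment near [t]. *)
Lemma Rintegral_gt0 (F : R -> R) (a b t : R) : a < b -> continuous F ->
  (forall s, 0 <= F s) -> a <= t <= b -> 0 < F t -> 0 < \int[mu]_(s in `[a, b]) F s.
Proof.
move=> ab cF F0 /andP[at_ tb] Ft.
have [d d0 dF] : exists2 d, 0 < d & forall s, `|s - t| < d -> F t / 2 <= F s.
  have : \forall s \near t, `|F t - F s| <= F t / 2.
    by apply: (cvgrPdist_le _ _).1 (cF t) _ _; rewrite divr_gt0.
  move=> /nbhs_ballP[d /= d0 dP]; exists d => // s st.
  have := dP s; rewrite -ball_normE /= distrC => /(_ st).
  by rewrite ler_norml => /andP[_]; lra.
pose p := Num.max a (t - d / 2); pose q := Num.min b (t + d / 2).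
have pq : p < q.
  by rewrite /p /q gt_max !lt_min; apply/andP; split; apply/andP; split; lra.
have [ap pt] : a <= p /\ t - d / 2 <= p by rewrite /p !le_max !lexx orbT.
have [qb qt] : q <= b /\ q <= t + d / 2 by rewrite /q !ge_min !lexx orbT.
have sub : `[p, q]%classic `<=` `[a, b]%classic.
  by apply: subset_itv; rewrite bnd_simp.
have /integrableP[mF _] := segment_integrable a b cF.
have I0 : (0 : R) < F t / 2 * (q - p) by rewrite mulr_gt0 ?subr_gt0// divr_gt0.
rewrite (lt_le_trans I0)//.
apply: (@le_trans _ _ (\int[mu]_(s in `[p, q]) F s)).
  apply: (@le_trans _ _ (\int[mu]_(s in `[p, q]) (F t / 2))).
    by rewrite Rintegral_cst//= lebesgue_measure_itv/= lte_fin pq -EFinD.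
  apply: le_Rintegral => //.
  - by apply: segment_integrable => s; exact: cvg_cst.
  - exact: segment_integrable.
  - move=> s /=; rewrite in_itv/= => /andP[ps sq]; apply: dF.
    by rewrite ltr_norml; apply/andP; split; lra.
rewrite /Rintegral fine_le//.
- exact: integrable_fin_num (segment_integrable _ _ cF).
- exact: integrable_fin_num (segment_integrable _ _ cF).
- by apply: ge0_subset_integral => // s _; rewrite lee_fin.
Qed.

Definition segments (I : nat -> set R) := forall j, exists a b, a < b /\ I j = `[a, b]%classic.

Lemma continuous_row_mx k : continuous (fun z : R * 'rV[R]_k => row_mx ((z.1)%:M : 'rV[R]_1) z.2).
Proof.
have -> : (fun z : R * 'rV[R]_k => row_mx ((z.1)%:M : 'rV[R]_1) z.2) =
    (fun z => z.1 *: row_mx (1%:M : 'rV[R]_1) (0 : 'rV[R]_k) + row_mx (0 : 'rV[R]_1) z.2).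
  apply/funext => z; rewrite scale_row_mx add_row_mx scaler0 add0r addr0.
  by rewrite scale_scalar_mx mulr1.
have cR : continuous (fun v : 'rV[R]_k => row_mx (0 : 'rV[R]_1) v).
  move=> v; apply: differentiable_continuous; apply: differentiable_mx => i j.
  case: (split_ordP j) => l ->.
    under eq_fun do rewrite row_mxEl mxE; exact: differentiable_cst.
  by under eq_fun do rewrite row_mxEr; exact: differentiable_coord.
move=> z; apply: cvgD.
  apply: (@continuous_comp _ _ _ fst (fun t : R => t *: row_mx (1%:M : 'rV[R]_1) (0 : 'rV[R]_k))).
    exact: cvg_fst.
  exact: scalel_continuous.
by apply: (@continuous_comp _ _ _ snd (fun v : 'rV[R]_k => row_mx (0 : 'rV[R]_1) v)); [exact: cvg_snd|exact: cR].
Qed.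

(** The parameter ranges over any normed module so that the induction can absorb
    the outer variables of integration into it. *)
Lemma box_continuous k (V : normedModType R) (I : nat -> set R) (H : V * 'rV[R]_k -> R) :
  segments I -> continuous H -> continuous (fun x => box_integral I (fun v => H (x, v))).
Proof.
elim: k V I H => [|k IH] V I H sI cH /=.
  move=> x; apply: (@continuous_comp _ _ _ (fun x : V => (x, 0 : 'rV[R]_0)) H); last exact: cH.
  exact: (@cvg_pair V V 'rV[R]_0 (nbhs x) (nbhs x) (nbhs (0 : 'rV[R]_0)) _ _ _ id (cst 0) cvg_id (cvg_cst _)).
have [a [b [ab ->]]] := sI 0%N.
apply: (@Rintegral_continuous V (fun z => box_integral (fun j => I j.+1)
   (fun v : 'rV[R]_k => H (z.1, row_mx ((z.2)%:M : 'rV[R]_1) v)))); first exact: ltW.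
apply: (IH (V * R)%type (fun j => I j.+1) (fun z => H (z.1.1, row_mx ((z.1.2)%:M : 'rV[R]_1) z.2))).
  by move=> j; exact: sI.
move=> z; apply: (@continuous_comp _ _ _
  (fun z : V * R * 'rV[R]_k => (z.1.1, row_mx ((z.1.2)%:M : 'rV[R]_1) z.2)) H); last exact: cH.
apply: (@cvg_pair _ _ _ (nbhs z) (nbhs z.1.1) (nbhs (row_mx ((z.1.2)%:M : 'rV[R]_1) z.2))).
  by apply: (@continuous_comp _ _ _ (@fst (V * R) 'rV[R]_k) fst); exact: cvg_fst.
apply: (@continuous_comp _ _ _ (fun z : V * R * 'rV[R]_k => (z.1.2, z.2))
  (fun z : R * 'rV[R]_k => row_mx ((z.1)%:M : 'rV[R]_1) z.2)); last exact: continuous_row_mx.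
apply: (@cvg_pair _ _ _ (nbhs z) (nbhs z.1.2) (nbhs z.2)); last exact: cvg_snd.
apply: (@continuous_comp _ _ _ (@fst (V * R) 'rV[R]_k) snd); [exact: cvg_fst|exact: cvg_snd].
Qed.

Lemma box_continuous1 k (I : nat -> set R) (h : 'rV[R]_k.+1 -> R) : segments I -> continuous h ->
  continuous (fun t : R => box_integral I (fun v : 'rV[R]_k => h (row_mx (t%:M : 'rV[R]_1) v))).
Proof.
move=> sI ch.
apply: (@box_continuous k R I (fun z => h (row_mx ((z.1)%:M : 'rV[R]_1) z.2))) => //.
move=> z; apply: (@continuous_comp _ _ _ (fun z : R * 'rV[R]_k => row_mx ((z.1)%:M : 'rV[R]_1) z.2) h).
  exact: continuous_row_mx.
exact: ch.
Qed.

Lemma continuous_slice k (h : 'rV[R]_k.+1 -> R) (t : R) : continuous h ->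
  continuous (fun v : 'rV[R]_k => h (row_mx (t%:M : 'rV[R]_1) v)).
Proof.
move=> ch v; apply: (@continuous_comp _ _ _ (fun v : 'rV[R]_k => row_mx (t%:M : 'rV[R]_1) v) h); last exact: ch.
apply: (@continuous_comp _ _ _ (fun v : 'rV[R]_k => (t, v)) (fun z : R * 'rV[R]_k => row_mx ((z.1)%:M : 'rV[R]_1) z.2)).
  exact: (@cvg_pair _ _ _ (nbhs v) (nbhs t) (nbhs v) _ _ _ (cst t) id (cvg_cst t) cvg_id).
exact: continuous_row_mx.
Qed.

Lemma box_integral_scale k (I : nat -> set R) (K : R) (h : 'rV[R]_k -> R) : segments I ->
  continuous h -> box_integral I (fun v => K * h v) = K * box_integral I h.
Proof.
elim: k I h => [//|k IH] I h sI ch /=.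
have [a [b [ab E]]] := sI 0%N; rewrite E.
rewrite -RintegralZl//; last first.
  by apply: segment_integrable; apply: box_continuous1 => // j; exact: sI.
apply: eq_Rintegral => t _; apply: IH => [j|]; first exact: sI.
exact: continuous_slice.
Qed.

Lemma box_integral_ge0 k (I : nat -> set R) (h : 'rV[R]_k -> R) :
  (forall v, 0 <= h v) -> 0 <= box_integral I h.
Proof.
elim: k I h => [|k IH] I h h0; first exact: h0.
apply: fine_ge0; apply: integral_ge0 => t _; rewrite lee_fin; apply: IH => v; exact: h0.
Qed.

Lemma box_integral_gt0 k (I : nat -> set R) (h : 'rV[R]_k -> R) (u : 'rV[R]_k) : segments I ->
  continuous h -> (forall v, 0 <= h v) -> (forall j : 'I_k, I j (u 0 j)) -> 0 < h u ->
  0 < box_integral I h.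
Proof.
elim: k I h u => [|k IH] I h u sI ch h0 uI hu /=.
  by rewrite (_ : 0 = u)//; apply/rowP => -[].
have [a [b [ab E]]] := sI 0%N; rewrite E.
apply: (@Rintegral_gt0 _ a b (u 0 0)) => //.
- by apply: box_continuous1 => // j; exact: sI.
- by move=> s; apply: box_integral_ge0.
- by have := uI 0; rewrite E /= in_itv.
have sI' : segments (fun j => I j.+1) by move=> j; exact: sI.
apply: (IH _ _ (rsubmx (u : 'rV[R]_(1 + k))) sI').
- exact: continuous_slice.
- by move=> v; exact: h0.
- by move=> j; rewrite mxE; have := uI (rshift 1 j).
by rewrite -(@row_mx_split R k u).
Qed.

End BoxIntegral.

(** * Spherical coordinates *)

Section Spherical.
Variable R : realType.

Lemma ndiff1_sincos A n : ndiff1 A n (@sin R) /\ ndiff1 A n (@cos R).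
Proof.
elim: n => [|n [IH1 IH2]].
  by split=> x _; [exact: (is_derive_derivable (is_derive_sin x))|exact: (is_derive_derivable (is_derive_cos x))].
split; first by exists cos; split=> // x _; exact: is_derive_sin.
exists (fun x => (-1) * sin x); split; first by move=> x _; rewrite mulN1r; exact: is_derive_cos.
by apply: ndiff1M => //; exact: ndiff1_cst.
Qed.

Lemma ndiff_entry k n m p (Y : 'rV[R]_k -> 'M[R]_(m, p)) i j :
  ndiff n Y -> ndiff n (fun u => Y u i j).
Proof.
elim: n Y => [|n IH] Y HY; first by split=> // u; exact: (differentiable_entry i j (ndiff_diff u HY)).
split=> [u|v]; first exact: (differentiable_entry i j (ndiff_diff u HY)).
have -> : 'D_v (fun u => Y u i j) = (fun u => 'D_v Y u i j).
  apply/funext => u; rewrite [RHS]derive_coord//.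
  exact: (diff_derivable (ndiff_diff u HY)).
by apply: IH; exact: HY.2.
Qed.

Lemma sphS k (u : 'rV[R]_k.+1) : (@sph R k.+2 u : 'rV[R]_(1 + k.+1)) =
  row_mx ((cos (u 0 0))%:M : 'rV[R]_1)
    (sin (u 0 0) *: @sph R k.+1 (rsubmx (u : 'rV[R]_(1 + k)))).
Proof.
apply/rowP => i; case: (split_ordP i) => l ->.
  rewrite row_mxEl mxE [RHS]mxE [l]ord1 eqxx mulr1n big_pred0 // mul1r.
  case: insubP => [j _ jE|]; last by rewrite ltn0Sn.
  by congr (cos (u 0 _)); exact/val_inj.
rewrite row_mxEr !mxE mulrA; congr (_ * _).
  rewrite big_mkcond big_ord_recl /=; congr (_ * _).
  rewrite [RHS]big_mkcond; apply: eq_bigr => j _.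
  rewrite /bump leq0n add1n ltnS; case: ifP => // _.
  by rewrite !mxE; congr (sin (u 0 _)); exact/val_inj.
case: insubP => [j _ jE|H1]; case: insubP => [j' _ jE'|H2].
- by rewrite mxE; congr (cos (u 0 _)); apply/val_inj; rewrite jE /= jE'.
- by move: H2; rewrite -leqNgt => H2; have := ltn_ord j; rewrite jE /= add1n ltnS ltnNge H2.
- by move: H1; rewrite /= add1n ltnS -jE' ltn_ord.
- by [].
Qed.

Lemma sphSl k (u : 'rV[R]_k.+1) (l : 'I_1) : @sph R k.+2 u 0 (lshift k.+1 l) = cos (u 0 0).
Proof.
transitivity ((@sph R k.+2 u : 'rV[R]_(1 + k.+1)) 0 (lshift k.+1 l)) => //.
by rewrite sphS row_mxEl mxE [l]ord1 eqxx.
Qed.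

Lemma sphSr k (u : 'rV[R]_k.+1) (l : 'I_k.+1) : @sph R k.+2 u 0 (rshift 1 l) =
  sin (u 0 0) * @sph R k.+1 (rsubmx (u : 'rV[R]_(1 + k))) 0 l.
Proof.
transitivity ((@sph R k.+2 u : 'rV[R]_(1 + k.+1)) 0 (rshift 1 l)) => //.
by rewrite sphS row_mxEr mxE.
Qed.

Lemma sph_sphere k (u : 'rV[R]_k) : dot (@sph R k.+1 u) (@sph R k.+1 u) = 1.
Proof.
elim: k u => [|k IH] u.
  rewrite /dot big_ord1 !mxE big_pred0; last by case.
  by case: insubP => [[]//|_]; rewrite !mul1r.
by rewrite sphS dot_row_mx dotZl dotZr IH mulr1 -!expr2 cos2Dsin2.
Qed.

Lemma sph_ndiff k n : ndiff n (@sph R k.+1 : 'rV[R]_k -> _).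
Proof.
elim: k n => [|k IH] n.
  have -> : (@sph R 1 : 'rV[R]_0 -> _) = cst (@sph R 1 0).
    by apply/funext => u; congr sph; apply/rowP => -[].
  exact: ndiff_cst.
have [Hs Hc] := ndiff1_sincos setT n.
apply: ndiff_mx => i j; rewrite ord1; case: (@split_ordP 1 k.+1 j) => l ->.
  have -> : (fun u : 'rV[R]_k.+1 => @sph R k.+2 u 0 (lshift k.+1 l)) = (fun u => cos (u 0 0)).
    by apply/funext => u; exact: sphSl.
  by apply: (ndiff_comp1 (A := setT)) => //; exact: ndiff_coord.
have -> : (fun u : 'rV[R]_k.+1 => @sph R k.+2 u 0 (rshift 1 l)) =
   (fun u => sin (u 0 0) * (fun v => @sph R k.+1 v 0 l) (rsubmx (u : 'rV[R]_(1 + k)))).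
  by apply/funext => u; exact: sphSr.
apply: ndiffM; first by apply: (ndiff_comp1 (A := setT)) => //; exact: ndiff_coord.
apply: (@ndiff_compmap R k.+1 k n (fun v => @sph R k.+1 v 0 l)
  (fun u : 'rV[R]_k.+1 => rsubmx (u : 'rV[R]_(1 + k)))) => [|i'].
  exact: ndiff_entry.
by under eq_fun do rewrite mxE; exact: ndiff_coord.
Qed.

Lemma derive_sphS k (u v : 'rV[R]_(1 + k)) : 'D_v (@sph R k.+2) u =
  row_mx ((- sin (u 0 0) * v 0 0)%:M : 'rV[R]_1)
    ((cos (u 0 0) * v 0 0) *: @sph R k.+1 (rsubmx u) +
     sin (u 0 0) *: 'D_(rsubmx v) (@sph R k.+1) (rsubmx u)).
Proof.
have dS := ndiff_diff u (@sph_ndiff k.+1 0).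
have dS' := ndiff_diff (rsubmx u) (@sph_ndiff k 0).
have dc : differentiable (fun u : 'rV[R]_(1 + k) => u 0 0) u by exact: differentiable_coord.
apply/rowP => j; rewrite derive_coord; last exact: diff_derivable.
case: (@split_ordP 1 k.+1 j) => l ->.
  have -> : (fun u : 'rV[R]_k.+1 => @sph R k.+2 u 0 (lshift k.+1 l)) = (fun u => cos (u 0 0)).
    by apply/funext => w; exact: sphSl.
  rewrite (@derive_val _ _ _ _ _ _ _ (derive_comp_real v (is_derive_cos (u 0 0)) dc)).
  by rewrite (@row_mxEl R 1 1 k.+1) mxE [l]ord1 eqxx mulr1n derive_coord_fun.
have -> : (fun u : 'rV[R]_k.+1 => @sph R k.+2 u 0 (rshift 1 l)) =
   (fun u => sin (u 0 0) * @sph R k.+1 (rsubmx (u : 'rV[R]_(1 + k))) 0 l).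
  by apply/funext => w; exact: sphSr.
have H1 := derive_comp_real v (is_derive_sin (u 0 0)) dc.
have dr : differentiable (rsubmx : 'rV[R]_(1 + k) -> 'rV[R]_k) u by exact: differentiable_rsubmx.
have dsr : differentiable (@sph R k.+1 \o (rsubmx : 'rV[R]_(1 + k) -> 'rV[R]_k)) u.
  exact: differentiable_comp.
have H2 : is_derive u v (fun u : 'rV[R]_(1 + k) => @sph R k.+1 (rsubmx u) 0 l)
    ('D_(rsubmx v) (@sph R k.+1) (rsubmx u) 0 l).
  have := is_derive_entry v 0 l dsr.
  rewrite (derive_comp v dr dS') (_ : 'D_v _ u = rsubmx v)//.
  have di : differentiable (id : 'rV[R]_(1 + k) -> 'rV[R]_(1 + k)) u by [].
  by rewrite (derive_rsubmx v di) derive_id.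
rewrite (@derive_val _ _ _ _ _ _ _ (is_derive_mul H1 H2)) derive_coord_fun (@row_mxEr R 1 1 k.+1) !mxE; ring.
Qed.

Lemma sph_smooth k : smooth_on setT (@sph R k.+1 : 'rV[R]_k -> _).
Proof. by apply/smooth_ndiff => n; exact: sph_ndiff. Qed.

(** The warped product form d t^2 + sin^2 t g of the round metric. *)
Lemma gram_sphS k (u : 'rV[R]_(1 + k)) : gram (@sph R k.+2) u =
  block_mx (1%:M : 'M[R]_1) 0 0 (sin (u 0 0) ^+ 2 *: gram (@sph R k.+1) (rsubmx u)).
Proof.
have N0 (v : 'rV[R]_k) : dot (@sph R k.+1 (rsubmx u)) ('D_v (@sph R k.+1) (rsubmx u)) = 0.
  rewrite derive_partial; last exact: (ndiff_diff _ (@sph_ndiff k 0)).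
  rewrite dotC dot_suml big1// => i _; rewrite dotZl dotC.
  rewrite (sphere_unit_normal openT (@sph_smooth k) (fun u _ => sph_sphere u) (u := rsubmx u) I).2.
  by rewrite mulr0.
have G (v w : 'rV[R]_(1 + k)) : dot ('D_v (@sph R k.+2) u) ('D_w (@sph R k.+2) u) = v 0 0 * w 0 0 +
    sin (u 0 0) ^+ 2 * dot ('D_(rsubmx v) (@sph R k.+1) (rsubmx u)) ('D_(rsubmx w) (@sph R k.+1) (rsubmx u)).
  rewrite !derive_sphS dot_row_mx !(dotDl, dotDr, dotZl, dotZr) sph_sphere.
  rewrite (dotC ('D_(rsubmx v) (@sph R k.+1) (rsubmx u)) (@sph R k.+1 (rsubmx u))) !N0.
  have := cos2Dsin2 (u 0 0); move: (dot _ _) (v 0 0) (w 0 0) (cos _) (sin _) => a s t cc ss E.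
  transitivity ((cc ^+ 2 + ss ^+ 2) * (s * t) + ss ^+ 2 * a); first by ring.
  by rewrite E mul1r.
have e0 : (delta_mx 0 (lshift k 0) : 'rV[R]_(1 + k)) 0 0 = 1.
  by rewrite mxE eqxx (_ : (0 : 'I_(1 + k)) == lshift k 0)//; apply/eqP/val_inj.
have er l : (delta_mx 0 (rshift 1 l) : 'rV[R]_(1 + k)) 0 0 = 0 by rewrite mxE.
apply/matrixP => i j; rewrite gramE /partial G.
case: (@split_ordP 1 k i) => a ->; case: (@split_ordP 1 k j) => b ->.
- rewrite (@block_mxEul R 1 k 1 k) [a]ord1 [b]ord1 [RHS]mxE eqxx mulr1n.
  rewrite (_ : rsubmx (delta_mx 0 (lshift k 0) : 'rV[R]_(1 + k)) = 0); last first.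
    by apply/rowP => l; rewrite !mxE eq_shift andbF.
  by rewrite derive0 dot0l mulr0 addr0 e0 mulr1.
- rewrite (@block_mxEur R 1 k 1 k) [a]ord1 [RHS]mxE.
  rewrite (_ : rsubmx (delta_mx 0 (lshift k 0) : 'rV[R]_(1 + k)) = 0); last first.
    by apply/rowP => l; rewrite !mxE eq_shift andbF.
  by rewrite derive0 dot0l mulr0 addr0 er mulr0.
- rewrite (@block_mxEdl R 1 k 1 k) [b]ord1 [RHS]mxE.
  rewrite (_ : rsubmx (delta_mx 0 (lshift k 0) : 'rV[R]_(1 + k)) = 0); last first.
    by apply/rowP => l; rewrite !mxE eq_shift andbF.
  by rewrite derive0 dot0r mulr0 addr0 er mul0r.
- rewrite (@block_mxEdr R 1 k 1 k) [RHS]mxE gramE.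
  have E l : rsubmx (delta_mx 0 (rshift 1 l) : 'rV[R]_(1 + k)) = delta_mx 0 l.
    by apply/rowP => l'; rewrite !mxE eq_shift.
  by rewrite !E er mul0r add0r.
Qed.

Lemma det_gram_sph k (u : 'rV[R]_k) : (forall j : 'I_k, (j.+1 < k)%N -> sin (u 0 j) != 0) ->
  0 < \det (gram (@sph R k.+1) u).
Proof.
elim: k u => [|k IH] u H; first by rewrite det_mx00.
rewrite (congr1 (fun A : 'M[R]_(1 + k) => \det A) (@gram_sphS k u) : \det (gram (@sph R k.+2) u) = _).
rewrite det_ublock det1 mul1r detZ.
apply: mulr_gt0.
  have P (a : R) (j : nat) : ((0 < j)%N -> a != 0) -> 0 < (a ^+ 2) ^+ j.
    by case: j => [|j] aj; rewrite ?expr0// exprn_gt0// lt0r sqr_ge0 sqrf_eq0 andbT aj.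
  by apply: P => k0; exact: H.
apply: IH => j jk; rewrite mxE; exact: (H (rshift 1 j)).
Qed.

(** The first angle is the arc cosine of the first coordinate; the second one of
    the circle needs [0, 2 pi] to reach both signs of the sine. *)
Lemma sph_surj k (w : 'rV[R]_k.+2) : dot w w = 1 -> exists u : 'rV[R]_k.+1,
  (forall j : 'I_k.+1, @sph_range R k.+2 j (u 0 j)) /\ @sph R k.+2 u = w.
Proof.
have row1 (w' : 'rV[R]_1) : dot w' w' = (w' 0 0) ^+ 2 by rewrite /dot big_ord1 expr2.
elim: k w => [|k IH] w ww.
  have wE : (w : 'rV[R]_(1 + 1)) = row_mx ((w 0 0)%:M : 'rV[R]_1) (rsubmx (w : 'rV[R]_(1 + 1))).
    exact: row_mx_split.
  pose w1 := rsubmx (w : 'rV[R]_(1 + 1)) 0 0.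
  have w01 : (w 0 0) ^+ 2 + w1 ^+ 2 = 1.
    by have := etrans (esym (congr1 (fun v : 'rV[R]_(1 + 1) => dot v v) wE)) ww; rewrite dot_row_mx row1 -expr2.
  have w0 : -1 <= w 0 0 <= 1.
    have := sqr_ge0 w1; rewrite -ler_norml -(@expr_le1 _ 2)// real_normK ?num_real//; lra.
  have [t [t0 [ct st]]] : exists t : R, 0 <= t <= 2 * pi /\ cos t = w 0 0 /\ sin t = w1.
    have s2 : Num.sqrt (1 - w 0 0 ^+ 2) = `|w1|.
      by rewrite -sqrtr_sqr; congr Num.sqrt; lra.
    have aw : 0 <= acos (w 0 0) <= pi by rewrite acos_ge0// acos_lepi.
    have [w1p|w1n] := lerP 0 w1.
      exists (acos (w 0 0)); rewrite acosK// sin_acos// s2 ger0_norm//; split=> //.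
      by have := pi_ge0 R; lra.
    exists (2 * pi - acos (w 0 0)); split; first by have := pi_ge0 R; lra.
    rewrite mulr_natl addrC cosD2pi cosN sinD2pi sinN acosK// sin_acos// s2 ltr0_norm// opprK.
    by [].
  exists (const_mx t); split=> [j|].
    by rewrite mxE [j]ord1 /sph_range /= in_itv.
  rewrite [RHS]wE; apply: (etrans (sphS _)); rewrite mxE ct st; congr row_mx.
  apply/rowP => j; rewrite mxE [j]ord1 [X in _ * X]mxE big_pred0; last by case.
  by case: insubP => [[]//|_]; rewrite !mulr1.
have wE : (w : 'rV[R]_(1 + k.+2)) = row_mx ((w 0 0)%:M : 'rV[R]_1) (rsubmx (w : 'rV[R]_(1 + k.+2))).
  exact: row_mx_split.
set w' := rsubmx _ in wE.
have w01 : (w 0 0) ^+ 2 + dot w' w' = 1.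
  by have := etrans (esym (congr1 (fun v : 'rV[R]_(1 + k.+2) => dot v v) wE)) ww; rewrite dot_row_mx -expr2.
have w0 : -1 <= w 0 0 <= 1.
  have := dot_ge0 w'; rewrite -ler_norml -(@expr_le1 _ 2)// real_normK ?num_real//; lra.
pose s := Num.sqrt (dot w' w').
have ss : sin (acos (w 0 0)) = s by rewrite sin_acos// /s; congr Num.sqrt; lra.
have [u [uI uE]] : exists u : 'rV[R]_k.+1,
    (forall j : 'I_k.+1, @sph_range R k.+2 j (u 0 j)) /\ s *: @sph R k.+2 u = w'.
  have [s0|s0] := eqVneq (dot w' w') 0.
    exists 0; split=> [j|].
      by rewrite mxE /sph_range; case: ifP => _; rewrite /= in_itv/= lexx ?mulr_ge0 ?pi_ge0.
    rewrite /s s0 sqrtr0 scale0r; apply/esym/eqP; rewrite -dot_eq0; exact/eqP.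
  have sp : s != 0 by rewrite sqrtr_eq0 -ltNge lt_neqAle eq_sym s0 dot_ge0.
  have [|u [uI uE]] := IH (s^-1 *: w').
    by rewrite dotZl dotZr mulrA -invfM -expr2 sqr_sqrtr ?dot_ge0// mulVf.
  by exists u; split=> //; rewrite uE scalerA mulfV// scale1r.
exists (row_mx ((acos (w 0 0))%:M : 'rV[R]_1) u); split=> [j|].
  case: (@split_ordP 1 k.+1 j) => l ->.
    rewrite (_ : row_mx _ _ 0 (lshift k.+1 l) = acos (w 0 0)); last first.
      by rewrite (@row_mxEl _ 1 1 k.+1) mxE [l]ord1 eqxx.
    by rewrite [l]ord1 /sph_range /= in_itv/= acos_ge0// acos_lepi.
  rewrite (_ : row_mx _ _ 0 (rshift 1 l) = u 0 l); last by rewrite (@row_mxEr _ 1 1 k.+1).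
  exact: uI.
rewrite [RHS]wE; apply: (etrans (sphS _)); rewrite (@row_mx00 R k.+1) (@row_mxKr _ 1 1 k.+1).
by rewrite acosK// ss uE.
Qed.

End Spherical.

(** * The Steklov eigenvalues of separated modes *)

Section Linear.
Variables (R : realType) (d : nat).
Local Notation V := 'rV[R]_d.

Lemma smooth_lin (phi psi : V -> R) a : smooth_on setT phi -> smooth_on setT psi ->
  smooth_on setT (fun p => phi p + a * psi p).
Proof.
move=> /smooth_ndiff Hp /smooth_ndiff Hq; apply/smooth_ndiff => k.
by apply: ndiffD => //; apply: ndiffM => //; exact: ndiff_cst.
Qed.

Lemma derive_lin (phi psi : V -> R) a v p : differentiable phi p -> differentiable psi p ->
  'D_v (fun p => phi p + a * psi p) p = 'D_v phi p + a * 'D_v psi p.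
Proof.
move=> dp dq.
have H1 : is_derive p v phi ('D_v phi p) by split=> //; exact: diff_derivable.
have H2 : is_derive p v psi ('D_v psi p) by split=> //; exact: diff_derivable.
by have [_ ->] := is_derive_add H1 (is_derive_cmul a H2).
Qed.

Lemma derive2_lin (phi psi : V -> R) a v w p : smooth_on setT phi -> smooth_on setT psi ->
  'D_v ('D_w (fun p => phi p + a * psi p)) p = 'D_v ('D_w phi) p + a * 'D_v ('D_w psi) p.
Proof.
move=> sp sq.
have -> : 'D_w (fun p => phi p + a * psi p) = (fun p => 'D_w phi p + a * 'D_w psi p).
  by apply/funext => q; apply: derive_lin; [exact: (sp [::])|exact: (sq [::])].
by apply: derive_lin; [exact: (sp [:: w])|exact: (sq [:: w])].
Qed.

End Linear.

Section Eigenvalue.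
Variables (R : realType) (k : nat).
Local Notation N := k.+1.
Local Notation n := N.+1.
Variable (c : profile R n).
Local Notation f := (cat_f c).
Local Notation W := (cat_W c).
Local Notation rho := (cat_R c).
Let N0 : (0 < N)%N := isT.

Lemma jacobi_function_lin phi psi a : jacobi_function c phi -> jacobi_function c psi ->
  jacobi_function c (fun p => phi p + a * psi p).
Proof.
move=> [sp Jp] [sq Jq]; have sl := smooth_lin a sp sq; split=> //.
move=> U X UX u M Uu nM; have [oU sX XC ug] := UX.
have [w [xW ww XE]] := cat_point XC Uu.
have d1 (h : 'rV[R]_(1 + n) -> R) (sh : smooth_on setT h) p : differentiable h p by exact: (sh [::]).
have d2 (h : 'rV[R]_(1 + n) -> R) (sh : smooth_on setT h) v p : differentiable ('D_v h) p by exact: (sh [:: v]).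
have E (h : 'rV[R]_(1 + n) -> R) (sh : smooth_on setT h) := cat_jacobi N0 oU sX XC ug Uu nM ww XE (d1 h sh) (d2 h sh).
have Hp := Jp U X UX u M Uu nM; have Hq := Jq U X UX u M Uu nM.
rewrite (E _ sp) in Hp; rewrite (E _ sq) in Hq; rewrite (E _ sl) => {E Jp Jq}.
have S : \sum_i partial i (partial i (fun p => phi p + a * psi p)) (X u) =
   \sum_i partial i (partial i phi) (X u) + a * \sum_i partial i (partial i psi) (X u).
  rewrite mulr_sumr -big_split; apply: eq_bigr => i _; exact: derive2_lin.
have lin (s1 s2 t r e1 e2 e p1 p2 q : R) : t = s1 + a * s2 -> e = e1 + a * e2 ->
    - (s1 - r * e1) - q * p1 = 0 -> - (s2 - r * e2) - q * p2 = 0 ->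
    - (t - r * e) - q * (p1 + a * p2) = 0.
  move=> -> -> H1 H2; transitivity ((- (s1 - r * e1) - q * p1) + a * (- (s2 - r * e2) - q * p2)); first by ring.
  by rewrite H1 H2; ring.
exact: (lin _ _ _ _ _ _ _ _ _ _ S (derive2_lin a _ _ _ sp sq) Hp Hq).
Qed.

Lemma conormal_derivative_lin (phi psi : 'rV[R]_(1 + n) -> R) (a : R) w : smooth_on setT phi -> smooth_on setT psi ->
  (conormal_derivative c (fun p => phi p + a * psi p)).1 w =
    (conormal_derivative c phi).1 w + a * (conormal_derivative c psi).1 w /\
  (conormal_derivative c (fun p => phi p + a * psi p)).2 w =
    (conormal_derivative c phi).2 w + a * (conormal_derivative c psi).2 w.
Proof.
by move=> sp sq; split; apply: derive_lin; [exact: (sp [::])|exact: (sq [::])|exact: (sp [::])|exact: (sq [::])].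
Qed.

Lemma gram_boundary x (t : 'rV[R]_N) : gram (fun t => catF c x (@sph R n t)) t =
  (f x / rho) ^+ 2 *: gram (@sph R n) t.
Proof.
have ds (t : 'rV[R]_N) : differentiable (@sph R n) t := ndiff_diff t (@sph_ndiff R N 0).
have P i : partial i (fun t => catF c x (@sph R n t)) t =
    row_mx (0%:M : 'rV[R]_1) ((f x / rho) *: partial i (@sph R n) t).
  have E j l : is_derive t (delta_mx 0 i) (fun t => catF c x (@sph R n t) j l)
      (row_mx (0%:M : 'rV[R]_1) ((f x / rho) *: partial i (@sph R n) t) j l).
    rewrite ord1; case: (split_ordP l) => l' ->.
      rewrite row_mxEl mxE mul0rn.
      under eq_fun do rewrite /catF row_mxEl.
      exact: is_derive_cst.
    rewrite row_mxEr mxE.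
    have -> : (fun t => catF c x (@sph R n t) 0 (rshift 1 l')) = (fun t => f x / rho * @sph R n t 0 l').
      by apply/funext => t'; rewrite /catF row_mxEr mxE.
    by apply: is_derive_cmul; exact: is_derive_entry.
  have dX : differentiable (fun t => catF c x (@sph R n t)) t.
    apply: differentiable_mx => j l; rewrite ord1; case: (split_ordP l) => l' ->.
      under eq_fun do rewrite /catF row_mxEl.
      exact: differentiable_cst.
    have -> : (fun t => catF c x (@sph R n t) 0 (rshift 1 l')) = (fun t => f x / rho * @sph R n t 0 l').
      by apply/funext => t'; rewrite /catF row_mxEr mxE.
    apply: differentiable_mul; first exact: differentiable_cst.
    exact: differentiable_entry.
  apply/matrixP => j l; rewrite /partial derive_coord; last exact: diff_derivable.
  by have [_ ->] := E j l.
apply/matrixP => i j; rewrite gramE !P dot_row_mx mulr0 add0r dotZl dotZr mxE gramE.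
by rewrite mulrA expr2.
Qed.

Definition boundary_weight x (t : 'rV[R]_N) : R :=
  Num.sqrt (((f x / rho) ^+ 2) ^+ N * \det (gram (@sph R n) t)).

Lemma boundary_integralE x h : boundary_integral c x h =
  box_integral (@sph_range R n) (fun t => h (@sph R n t) * boundary_weight x t).
Proof.
rewrite /boundary_integral /volume_integral; congr box_integral; apply/funext => t.
by rewrite gram_boundary detZ.
Qed.

Lemma sph_range_segments : segments (@sph_range R n).
Proof.
move=> j; rewrite /sph_range; case: ifP => _.
  by exists 0, pi; rewrite pi_gt0.
by exists 0, (2 * pi); rewrite mulr_gt0 ?pi_gt0.
Qed.

Lemma boundary_weight_continuous x : continuous (boundary_weight x).
Proof.
move=> t; apply: (@continuous_comp _ _ _ (fun t => ((f x / rho) ^+ 2) ^+ N * \det (gram (@sph R n) t)) Num.sqrt).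
  apply: differentiable_continuous; apply: differentiable_mul; first exact: differentiable_cst.
  apply: differentiable_det => i j.
  exact: (differentiable_gram (U := setT) (@sph_smooth R N) i j (u := t) I).
exact: sqrt_continuous.
Qed.

Lemma sph_continuous (g : 'rV[R]_n -> R) : smooth_on setT g -> continuous (fun t => g (@sph R n t)).
Proof.
move=> sg t; apply: (@continuous_comp _ _ _ (@sph R n) g).
  exact: (differentiable_continuous (ndiff_diff t (@sph_ndiff R N 0))).
by apply: differentiable_continuous; exact: (sg [::]).
Qed.

Lemma boundary_sqr_continuous (g : 'rV[R]_n -> R) x : smooth_on setT g ->
  continuous (fun t => g (@sph R n t) ^+ 2 * boundary_weight x t).
Proof.
move=> sg; have -> : (fun t => g (@sph R n t) ^+ 2 * boundary_weight x t) =
    (fun t => g (@sph R n t) * g (@sph R n t) * boundary_weight x t).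
  by apply/funext => t; rewrite expr2.
move=> t; have H := cvgM (cvgM (sph_continuous sg (x:=t)) (sph_continuous sg (x:=t))) (@boundary_weight_continuous x t). exact: H.
Qed.

Lemma boundary_integral_sqr (g h : 'rV[R]_n -> R) K x : smooth_on setT g ->
  (forall w, dot w w = 1 -> h w = K * g w ^+ 2) ->
  boundary_integral c x h = K * boundary_integral c x (fun w => g w ^+ 2).
Proof.
move=> sg hE; rewrite !boundary_integralE -box_integral_scale//.
- by congr box_integral; apply/funext => t; rewrite hE ?sph_sphere// mulrA.
- exact: sph_range_segments.
- exact: boundary_sqr_continuous.
Qed.

(** The spherical coordinates degenerate where a sine vanishes; a point where
    the function does not vanish is moved slightly towards the centre of the
    box, where they are regular. *)
Lemma boundary_integral_gt0 (g : 'rV[R]_n -> R) x w : smooth_on setT g -> f x != 0 ->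
  dot w w = 1 -> g w != 0 -> 0 < boundary_integral c x (fun w => g w ^+ 2).
Proof.
move=> sg fx0 ww gw.
have [u [uI uE]] := @sph_surj R k w ww.
pose q (e : R) : 'rV[R]_N := u + e *: (const_mx (pi / 2) - u).
have cq : continuous q.
  move=> e; apply: cvgD; first exact: cvg_cst.
  exact: scalel_continuous.
have cg : {for 0, continuous (fun e => g (@sph R n (q e)))}.
  apply: (@continuous_comp _ _ _ q (fun t => g (@sph R n t))); first exact: cq.
  exact: sph_continuous.
have q0 : q 0 = u by rewrite /q scale0r addr0.
have [e [e0 e1 ge]] : exists e : R, [/\ 0 < e, e < 1 & g (@sph R n (q e)) != 0].
  have : \forall e \near (0 : R), g (@sph R n (q e)) != 0.
    by apply: (cvgr_neq0 _ cg); rewrite /= q0 uE.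
  move=> /nbhs_ballP[d /= d0 dP].
  exists (Num.min (d / 2) (1 / 2)); split.
  - by rewrite lt_min !divr_gt0.
  - by rewrite gt_min; apply/orP; right; lra.
  - apply: dP; rewrite -ball_normE /= sub0r normrN gtr0_norm ?lt_min ?divr_gt0//.
    by rewrite gt_min; apply/orP; left; lra.
have pi0 := pi_gt0 R.
have qE j : q e 0 j = (1 - e) * u 0 j + e * (pi / 2) by rewrite !mxE; ring.
rewrite boundary_integralE; apply: (box_integral_gt0 (u := q e)).
- exact: sph_range_segments.
- exact: boundary_sqr_continuous.
- by move=> t; rewrite mulr_ge0 ?sqr_ge0 ?sqrtr_ge0.
- move=> j; move: (uI j); rewrite qE /sph_range; case: ifP => _; rewrite /= !in_itv /= => /andP[a b]; apply/andP; split.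
  + by apply: addr_ge0; apply: mulr_ge0 => //; lra.
  + have : (1 - e) * u 0 j <= (1 - e) * pi by rewrite ler_wpM2l//; lra.
    have : 0 < e * pi by exact: mulr_gt0.
    by lra.
  + by apply: addr_ge0; apply: mulr_ge0 => //; lra.
  + have : (1 - e) * u 0 j <= (1 - e) * (2 * pi) by rewrite ler_wpM2l//; lra.
    have : 0 < e * pi by exact: mulr_gt0.
    by lra.
- rewrite mulr_gt0//; first by rewrite lt0r sqr_ge0 sqrf_eq0 ge.
  rewrite sqrtr_gt0 mulr_gt0//.
    by rewrite exprn_gt0// lt0r sqr_ge0 sqrf_eq0 mulf_neq0// invr_eq0 rho_neq0.
  apply: det_gram_sph => j jk; rewrite gt_eqF// sin_gt0_pi// qE.
  have := uI j; rewrite /sph_range jk /= in_itv /= => /andP[a b].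
  have A1 : 0 <= (1 - e) * u 0 j by apply: mulr_ge0 => //; lra.
  have A2 : (1 - e) * u 0 j <= (1 - e) * pi by rewrite ler_wpM2l//; lra.
  have A3 : 0 < e * pi by exact: mulr_gt0.
  by apply/andP; split; lra.
Qed.

End Eigenvalue.

Section SteklovIdentity.
Variables (R : realType) (k : nat).
Local Notation N := k.+1.
Local Notation n := N.+1.
Variable (c : profile R n).
Local Notation f := (cat_f c).
Local Notation W := (cat_W c).
Let N0 : (0 < N)%N := isT.
Variables (m : nat) (g : 'rV[R]_n -> R) (psi psi1 psi2 : R -> R) (s : R).
Hypothesis hg : @harmonics R n m g.
Hypothesis spsi : forall j, ndiff1 [set x | in_domain c x] j psi.
Hypothesis dpsi : forall x, in_domain c x -> is_derive x 1 psi (psi1 x).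
Hypothesis dpsi1 : forall x, in_domain c x -> is_derive x 1 psi1 (psi2 x).
Hypothesis psi_ode : forall x, in_domain c x ->
  psi2 x = (m%:R * (N%:R + m%:R - 1) * f x ^+ (2 * N) - n%:R * N%:R) / f x ^+ 2 * psi x.
Hypotheses (s2 : s * s = 1) (psiN : psi (- W) = s * psi W) (psi1N : psi1 (- W) = - (s * psi1 W)).
Hypothesis psiW : psi W != 0.

(** The separated Jacobi function with boundary values [b] differs from the
    extension of [b] used by the operator by an element of the kernel; the
    conormal derivative of that element is a multiple of [b], and [b] is
    orthogonal to it.  Hence the multiple is zero. *)
Lemma steklov_eigenvalue (b : bfun R n) (l : R) :
  (forall w, b.1 w = g w) -> (forall w, b.2 w = s * g w) ->
  ~ beq b (fun=> 0, fun=> 0) -> DN c b (bscale l b) -> l = W * psi1 W / psi W.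
Proof.
move=> b1 b2 bn0 [Vb [phi [Jphi tphi _] [Vlb [psi0 [Jpsi0 tpsi0] cE]]]].
have [A [B [WA AB dB]]] := margin c.
pose K := s / psi W.
pose p0 x := K * psi x; pose p1 x := K * psi1 x; pose p2 x := K * psi2 x.
have sp j : ndiff1 [set x | in_domain c x] j p0 by apply: ndiff1M => //; exact: ndiff1_cst.
have dp x : in_domain c x -> is_derive x 1 p0 (p1 x) by move=> dx; apply: is_derive_cmul; exact: dpsi.
have dp1 x : in_domain c x -> is_derive x 1 p1 (p2 x) by move=> dx; apply: is_derive_cmul; exact: dpsi1.
have ode x : in_domain c x ->
    p2 x = (m%:R * (N%:R + m%:R - 1) * f x ^+ (2 * N) - n%:R * N%:R) / f x ^+ 2 * p0 x.
  by move=> dx; rewrite /p2 /p0 psi_ode//; ring.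
pose Psi := cat_separated c A B g p0.
have JPsi : jacobi_function c Psi := cat_separated_jacobi N0 WA AB dB hg sp dp dp1 ode.
have sg := hg.1; have W0 := cat_W_gt0 c.
have WW : - W <= W <= W by rewrite lexx andbT; lra.
have WNW : - W <= - W <= W by rewrite lexx; lra.
set lam := W * psi1 W / psi W.
have tPsi w : dot w w = 1 -> Psi (catF c (- W) w) = b.1 w /\ Psi (catF c W w) = b.2 w.
  move=> ww; rewrite /Psi !(cat_separatedE N0 WA AB)// b1 b2 /p0 psiN /K; split.
    by transitivity ((s * s) * g w); [move: (psi W) psiW => y y0; field|rewrite s2 mul1r].
  by move: (psi W) psiW => y y0; field.
have cPsi w : dot w w = 1 -> (conormal_derivative c Psi).1 w = lam * b.1 w /\
    (conormal_derivative c Psi).2 w = lam * b.2 w.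
  move=> ww; have [-> ->] := cat_separated_conormal N0 WA AB dB hg sp dp dp1 ww.
  rewrite b1 b2 /p1 psi1N /lam /K; split; last by move: (psi1 W) (psi W) psiW => a y y0; field.
  transitivity (W * (s * s) * psi1 W / psi W * g w); last by rewrite s2 mulr1.
  by move: (psi1 W) (psi W) psiW => a y y0; field.
pose eta0 p := phi p + (-1) * psi0 p.
have Jeta0 : jacobi_function c eta0 by exact: jacobi_function_lin.
pose eta p := eta0 p + (-1) * Psi p.
have Jeta : jacobi_function c eta by exact: jacobi_function_lin.
have keta : kerJ c eta.
  split=> // w ww; have [t1 t2] := tPsi w ww; have [u1 u2] := tphi w ww; have [v1 v2] := tpsi0 w ww.
  split.
    have -> : (trace c eta).1 w = (trace c phi).1 w - (trace c psi0).1 w - Psi (catF c (- W) w).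
      by rewrite /trace /eta /eta0 /= !mulN1r.
    by rewrite t1 u1 v1 subr0 subrr.
  have -> : (trace c eta).2 w = (trace c phi).2 w - (trace c psi0).2 w - Psi (catF c W w).
    by rewrite /trace /eta /eta0 /= !mulN1r.
  by rewrite t2 u2 v2 subr0 subrr.
have ceta w : dot w w = 1 -> (conormal_derivative c eta).1 w = (l - lam) * b.1 w /\
    (conormal_derivative c eta).2 w = (l - lam) * b.2 w.
  move=> ww; have [c1 c2] := cPsi w ww; have [d1 d2] := cE w ww.
  have [e1 e2] := conormal_derivative_lin c (-1) w Jphi.1 Jpsi0.1.
  have [h1 h2] := conormal_derivative_lin c (-1) w Jeta0.1 JPsi.1.
  rewrite h1 h2 e1 e2 c1 c2 {1}d1 {1}d2 /bscale /=.
  by move: (_.1 w) (_.2 w) => x y; split; ring.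
have fW0 : f W != 0 by rewrite gt_eqF// f_gt0// W_domain.
have fNW0 : f (- W) != 0 by rewrite (f_WN c N0).1.
have [w [ww gw]] : exists w, dot w w = 1 /\ g w != 0.
  apply: contrapT => H; apply: bn0 => w ww.
  have g0 : g w = 0 by apply: contrapT => /eqP gw; apply: H; exists w.
  by rewrite b1 b2 g0 mulr0.
have := Vb.2 _ keta; rewrite /bdot.
rewrite (@boundary_integral_sqr R k c g _ (l - lam) (- W) sg); last first.
  by move=> w' ww'; rewrite (ceta w' ww').1 b1; ring.
rewrite (@boundary_integral_sqr R k c g _ (l - lam) W sg); last first.
  move=> w' ww'; rewrite (ceta w' ww').2 b2.
  by transitivity ((s * s) * ((l - lam) * g w' ^+ 2)); [ring|rewrite s2 mul1r].
have I1 := boundary_integral_gt0 sg fNW0 ww gw; have I2 := boundary_integral_gt0 sg fW0 ww gw.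
rewrite -mulrDr; move: (boundary_integral _ _ _) (boundary_integral _ _ _) I1 I2 => i1 i2 I1 I2.
move=> /eqP; rewrite mulf_eq0 (gt_eqF (addr_gt0 I1 I2)) orbF subr_eq0 => /eqP; exact.
Qed.

End SteklovIdentity.

(** * Estimates *)

Lemma derive_le_increment (R : realType) (F G F' G' : R -> R) (a b : R) : a <= b ->
  (forall x, a <= x <= b -> is_derive x 1 F (F' x)) ->
  (forall x, a <= x <= b -> is_derive x 1 G (G' x)) ->
  (forall x, a <= x <= b -> F' x <= G' x) -> F b - F a <= G b - G a.
Proof.
move=> ab dF dG FG.
suff : G a + (-1) * F a <= G b + (-1) * F b by lra.
apply: (derive_ge0_le ab (F := fun x => G x + (-1) * F x) (F' := fun x => G' x + (-1) * F' x)) => x xab.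
  apply: is_derive_add; first exact: dG.
  by apply: is_derive_cmul; exact: dF.
by have := FG x xab; lra.
Qed.

Lemma is_derive_scale (R : realType) (k x : R) : is_derive x 1 (fun x : R => k * x) k.
Proof. by apply: (is_derive_eq (is_derive_cmul k (is_derive_id x 1))); rewrite mulr1. Qed.

Section ProfileBounds.
Variables (R : realType) (N : nat) (c : profile R N.+1).
Hypothesis (N0 : (0 < N)%N).
Local Notation f := (cat_f c).
Local Notation f1 := (derive1 (cat_f c)).
Local Notation W := (cat_W c).
Local Notation z := (prof_z c).
Local Notation F := (cat_f c (cat_W c)).

Lemma prof_segment x : 0 <= x <= W -> in_domain c x.
Proof. by move=> /andP[x0 xW]; apply: in_domainW; rewrite xW andbT; lra. Qed.

Lemma prof_z0 : z 0 = 0.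
Proof. by have [_ E _] := cat_f_sol c; rewrite /prof_z E mul0r. Qed.

Lemma prof_z_ge0 x : 0 <= x <= W -> 0 <= z x.
Proof.
move=> xW; have dx := prof_segment xW; case/andP: xW => x0 _.
by rewrite /prof_z divr_ge0 ?f1_ge0// exprn_ge0// ltW// f_gt0.
Qed.

Lemma prof_z_le x : 0 <= x <= W -> z x <= N%:R * x.
Proof.
move=> xW; have /andP[x0 xW'] := xW.
suff : z x - z 0 <= N%:R * x - N%:R * 0 by rewrite prof_z0; lra.
have dom y : 0 <= y <= x -> in_domain c y.
  by move=> /andP[y0 yx]; apply: prof_segment; rewrite y0 (le_trans yx).
apply: (derive_le_increment x0 (F' := fun y => N%:R / f y ^+ N.+1) (G' := fun=> N%:R)
  (G := fun y => N%:R * y)) => y yx; [exact: derive_prof_z (dom y yx)|exact: is_derive_scale|].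
by rewrite ler_pdivrMr ?exprn_gt0 ?f_gt0 ?dom// ler_peMr// exprn_ege1// f_ge1// dom.
Qed.

Lemma W_f1 : W * f1 W = F.
Proof. exact: cat_WE. Qed.

Lemma F_ge1 : 1 <= F.
Proof. by apply: f_ge1 => //; exact: W_domain. Qed.

Lemma f1W_gt0 : 0 < f1 W.
Proof.
have W0 := cat_W_gt0 c; have := F_ge1; rewrite -W_f1 => H.
by rewrite -(pmulr_rgt0 _ W0); lra.
Qed.

Lemma f1W_le : f1 W <= F ^+ N.
Proof.
have z0 : 0 <= z W by apply: prof_z_ge0; rewrite lexx andbT ltW// cat_W_gt0.
have := prof_z_lt1 N0 (W_domain c); rewrite ger0_norm// => /ltW.
by rewrite /prof_z ler_pdivrMr ?exprn_gt0 ?f_gt0 ?W_domain// mul1r.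
Qed.

(** With s the parameter of f ^ N = cosh s, the function
    f' / (1 + f ^ N) = tanh (s / 2) stays below 1 and grows at least at the rate
    N / (2 F). *)
Lemma NW_le : N%:R * W <= 2 * F.
Proof.
have W0 := cat_W_gt0 c; have F1 := F_ge1.
pose d x := 1 + f x ^+ N.
have d0 x : 0 <= x <= W -> 0 < d x.
  by move=> xW; rewrite /d addr_gt0// exprn_gt0// f_gt0//; exact: prof_segment.
pose y x := f1 x * (d x)^-1.
have y0 : y 0 = 0 by have [_ E _] := cat_f_sol c; rewrite /y E mul0r.
have y1 : y W <= 1.
  have dW : 0 < d W by apply: d0; rewrite lexx andbT ltW.
  by rewrite /y ler_pdivrMr// mul1r /d; have := f1W_le; lra.
suff : N%:R / (2 * F) * W - N%:R / (2 * F) * 0 <= y W - y 0.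
  rewrite y0 mulr0 !subr0 => H.
  have : N%:R / (2 * F) * W <= 1 by lra.
  by rewrite mulrAC ler_pdivrMr ?mul1r//; lra.
apply: (derive_le_increment (ltW W0) (F := fun x => N%:R / (2 * F) * x) (F' := fun=> N%:R / (2 * F))
   (G' := fun x => N%:R * f x ^+ N.-1 / d x)) => x xW; first exact: is_derive_scale.
  have dx := prof_segment xW; have FI := first_integral N0 dx.
  have dd : is_derive x 1 d (N%:R * f x ^+ N.-1 * f1 x).
    apply: (is_derive_eq (is_derive_add (is_derive_cst (1 : R) x 1) (is_derive_pow1 N (derive_f dx)))).
    by rewrite add0r.
  apply: (is_derive_eq (is_derive_mul (derive_f1 N0 dx) (is_derive_inv1 (lt0r_neq0 (d0 x xW)) dd))).
  have := lt0r_neq0 (d0 x xW); rewrite /d.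
  have E1 : f x ^+ (2 * N).-1 = f x ^+ N.-1 * f x ^+ N by rewrite -exprD; congr (_ ^+ _); lia.
  have E2 : f x ^+ (2 * N) = f x ^+ N * f x ^+ N by rewrite -exprD; congr (_ ^+ _); lia.
  move: FI; rewrite E1 E2; move: (f x ^+ N.-1) (f x ^+ N) (f1 x) => p q t FI q0.
  transitivity (N%:R * p * (q * (1 + q) - t ^+ 2) / (1 + q) ^+ 2).
    by field.
  by rewrite FI; field.
have dx := prof_segment xW; have f0 := f_ge1 N0 dx.
have fF : f x <= F by case/andP: xW => x0 xW; apply: f_mono => //; exact: W_domain.
have q1 : 1 <= f x ^+ N by rewrite exprn_ege1.
have E : f x ^+ N = f x * f x ^+ N.-1 by rewrite -exprS prednK.
have p0 : 0 < f x ^+ N.-1 by rewrite exprn_gt0// f_gt0.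
rewrite -[leRHS]mulrA ler_wpM2l// ler_pdivlMr ?d0// mulrC ler_pdivrMr; last lra.
rewrite /d; apply: (@le_trans _ _ (2 * f x ^+ N)); first lra.
have : f x * f x ^+ N.-1 <= F * f x ^+ N.-1 by rewrite ler_wpM2r// ltW.
by rewrite E; lra.
Qed.

Lemma f1W_ge : N%:R / 2 <= f1 W.
Proof.
have W0 := cat_W_gt0 c; rewrite -(ler_pM2l W0) W_f1.
by have := NW_le; lra.
Qed.

Lemma F_pow_ge : N%:R / 2 <= F ^+ N.
Proof. exact: le_trans f1W_ge f1W_le. Qed.

(** From z(W) <= N W one gets f'(W) <= N F ^ (N + 1) / f'(W), and the first
    integral turns this into F ^ (2 N) <= 1 + N F ^ (N + 1). *)
Lemma F_pow_le : F ^+ N.-1 <= N.+1%:R.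
Proof.
have W0 := cat_W_gt0 c; have F1 := F_ge1; have t0 := f1W_gt0.
have F0 : 0 < F by lra.
have q0 : 0 < F ^+ N by rewrite exprn_gt0.
have H := prof_z_le (x := W); rewrite lexx ltW// in H; have {H} := H isT.
rewrite /prof_z ler_pdivrMr// => H.
have H2 : f1 W ^+ 2 <= N%:R * F * F ^+ N.
  rewrite expr2 -{1}W_f1.
  have -> : N%:R * (W * f1 W) * F ^+ N = N%:R * W * F ^+ N * f1 W by ring.
  by rewrite ler_pM2r.
rewrite (first_integral N0 (W_domain c)) in H2.
have E2 : F ^+ (2 * N) = F ^+ N.-1 * (F * F ^+ N).
  by rewrite -exprS -exprD; congr (_ ^+ _); lia.
rewrite E2 in H2.
have p1 : 1 <= F * F ^+ N by rewrite -exprS exprn_ege1.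
have p0 : 0 < F * F ^+ N by lra.
rewrite -(ler_pM2r p0) -natr1 mulrDl mul1r.
by move: H2; rewrite -mulrA; lra.
Qed.

Lemma prof_zW : 1 - 4 / N%:R ^+ 2 <= z W /\ z W < 1.
Proof.
have W0 := cat_W_gt0 c; have zl := prof_z_lt1 N0 (W_domain c).
have z0 : 0 <= z W by rewrite prof_z_ge0// lexx ltW.
rewrite ger0_norm// in zl; split=> //.
have zz : z W ^+ 2 <= z W by rewrite expr2 ler_piMr// ltW.
apply: le_trans zz; have := prof_z2 N0 (W_domain c) => E.
have : (F ^+ (2 * N))^-1 <= 4 / N%:R ^+ 2.
  have n0 : 0 < N%:R / 2 :> R by rewrite divr_gt0// ltr0n.
  have -> : 4 / N%:R ^+ 2 = ((N%:R / 2) ^+ 2)^-1 :> R.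
    have nn : N%:R != 0 :> R by rewrite pnatr_eq0 -lt0n.
    by field.
  have q0 : 0 < F ^+ N by rewrite exprn_gt0//; have := F_ge1; lra.
  have -> : F ^+ (2 * N) = (F ^+ N) ^+ 2 by rewrite mulnC exprM.
  have a0 : 0 < (N%:R / 2 : R) ^+ 2 by rewrite exprn_gt0.
  have b0 : 0 < (F ^+ N) ^+ 2 by rewrite exprn_gt0.
  rewrite lef_pV2 ?posrE//; have := F_pow_ge; move: (F ^+ N) (N%:R / 2) n0 => q p p0 pq.
  by rewrite ler_sqr ?nnegrE//; lra.
by lra.
Qed.

End ProfileBounds.

Lemma psum_ge0 (R : realType) (co : nat -> R) (t : R) : (forall k, 0 <= co k) -> 0 <= t < 1 ->
  disc_cvg co -> 0 <= psum co t.
Proof.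
move=> co0 /andP[t0 t1] ec; apply: limr_ge; first by apply: ec; rewrite ger0_norm.
near=> k; rewrite /pseries /series /=; apply: sumr_ge0 => i _.
by rewrite mulr_ge0// exprn_ge0.
Unshelve. all: by end_near. Qed.

Section RadialBounds.
Variables (R : realType) (N M : nat) (c : profile R N.+1).
Hypotheses (N0 : (0 < N)%N) (MN : (M < N)%N).
Local Notation f := (cat_f c).
Local Notation f1 := (derive1 (cat_f c)).
Local Notation W := (cat_W c).
Local Notation z := (prof_z c).
Local Notation F := (cat_f c (cat_W c)).
Variables (h0 h1 : R).
Hypotheses (h00 : 0 <= h0 <= 1) (h10 : 0 <= h1 <= 1).

Definition rad_gam : R := (N%:R + 2 * M%:R + 1) / N%:R.
Definition rad_eta : R := M%:R / N%:R * (2 + M.+1%:R / N%:R).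
Local Notation gam := rad_gam.
Local Notation eta := rad_eta.
Local Notation h := (rad_h M c h0 h1).
Local Notation hz := (rad_h1 M c h0 h1).

Let N0R : 0 < N%:R :> R. Proof. by rewrite ltr0n. Qed.
Let NR0 : N%:R != 0 :> R. Proof. by rewrite gt_eqF. Qed.

(** The power series have nonnegative coefficients, and z >= 0 for x >= 0. *)
Lemma rad_ge0 x : 0 <= x <= W -> 0 <= h x /\ 0 <= hz x.
Proof.
move=> xW; have dx := prof_segment xW.
have zx : 0 <= z x < 1.
  by have := prof_z_lt1 N0 dx; rewrite ger0_norm prof_z_ge0.
have al01 : 0 <= (M%:R / N%:R : R) <= 1.
  by rewrite divr_ge0//= ler_pdivrMr// mul1r ler_nat ltnW.
have be03 : 0 <= (2 + M.+1%:R / N%:R : R) <= 3.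
  have : 0 <= M.+1%:R / N%:R :> R by rewrite divr_ge0.
  have : M.+1%:R / N%:R <= 1 :> R by rewrite ler_pdivrMr// mul1r ler_nat.
  by lra.
have eco := disc_cvg_gegen al01 be03 h00 h10.
have b k := gegen_bound al01 be03 h00 h10 k.
split; apply: psum_ge0 => //.
- by move=> k; case/andP: (b k).
- by move=> k; rewrite /pseries_diffs mulr_ge0//; case/andP: (b k.+1).
- exact: disc_cvg_diffs.
Qed.

Lemma rad_h_0 : h 0 = h0.
Proof. by rewrite /rad_h prof_z0 psum0. Qed.

Lemma rad_h1_0 : hz 0 = h1.
Proof. by rewrite /rad_h1 prof_z0 psum0 /pseries_diffs mul1r. Qed.

(** The derivative of the radial function in the variable z, with the integrating
    factor of its equation. *)
Definition rad_P x := (f x ^+ (3 * N + 2 * M + 1))^-1 * hz x.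

Lemma rad_PE x : in_domain c x -> hz x = f x ^+ (3 * N + 2 * M + 1) * rad_P x.
Proof. by move=> dx; rewrite /rad_P mulVKf// expf_neq0// gt_eqF// f_gt0. Qed.

Lemma rad_P_ge0 x : 0 <= x <= W -> 0 <= rad_P x.
Proof.
move=> xW; rewrite /rad_P mulr_ge0 ?(rad_ge0 xW).2// invr_ge0 exprn_ge0// ltW// f_gt0//; exact: prof_segment.
Qed.

Lemma derive_h x : in_domain c x -> is_derive x 1 h (N%:R * f x ^+ (2 * N + 2 * M) * rad_P x).
Proof.
move=> dx; apply: (is_derive_eq (derive_rad_h N0 MN h00 h10 dx)).
rewrite (rad_PE dx); have := f_gt0 N0 dx; move: (f x) (rad_P x) => y p y0.
have -> : y ^+ (3 * N + 2 * M + 1) = y ^+ (2 * N + 2 * M) * y ^+ N.+1.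
  by rewrite -exprD; congr (_ ^+ _); lia.
by move: (y ^+ (2 * N + 2 * M)) (y ^+ N.+1) (lt0r_neq0 (exprn_gt0 N.+1 y0)) => a b b0; field.
Qed.

Lemma derive_P x : in_domain c x ->
  is_derive x 1 rad_P (eta * N%:R * (f x ^+ (2 * N + 2 * M + 2))^-1 * h x).
Proof.
move=> dx; have fx0 := lt0r_neq0 (f_gt0 N0 dx).
apply: (is_derive_eq (is_derive_mul (derive_fV N0 (3 * N + 2 * M + 1) dx) (derive_rad_h1 N0 MN h00 h10 dx))).
rewrite (rad_h2E N0 MN h00 h10 dx) /rad_eta /prof_z.
move: (f x) (f1 x) (h x) (hz x) fx0 => y t a b y0.
have -> : y ^+ (3 * N + 2 * M + 1) = y ^+ N * y ^+ (2 * N + 2 * M + 2) / y.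
  by rewrite -exprD -[X in _ = X / _]mulr1; apply: (canRL (mulfK y0)); rewrite -exprSr mulr1; congr (_ ^+ _); lia.
have -> : y ^+ (2 * N) = y ^+ N * y ^+ N by rewrite -exprD; congr (_ ^+ _); lia.
have -> : (3 * N + 2 * M + 1)%:R = 3 * N%:R + 2 * M%:R + 1 :> R by rewrite 2!natrD 2!natrM.
rewrite (exprS y N) -[M.+1]addn1 natrD.
move: (y ^+ N) (y ^+ (2 * N + 2 * M + 2)) (expf_neq0 N y0) (expf_neq0 (2 * N + 2 * M + 2) y0) => q r q0 r0.
by move: (N%:R) (M%:R) NR0 => k l k0; field; rewrite k0 q0 r0 y0.
Qed.

(** The quantity that the boundary condition W f'(W) = f(W) turns into the
    eigenvalue. *)
Definition rad_Y x := gam * (z x * h x) + (-1) * ((f x ^+ (2 * N))^-1 * hz x).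

Lemma rad_Y_0 : rad_Y 0 = - h1.
Proof.
rewrite /rad_Y prof_z0 rad_h1_0 (_ : f 0 = 1); last by have [] := cat_f_sol c.
by rewrite expr1n invr1; ring.
Qed.

Lemma derive_Y x : in_domain c x ->
  is_derive x 1 rad_Y ((gam - eta) * (N%:R / f x ^+ N.+1 * h x)).
Proof.
move=> dx; have fx0 := lt0r_neq0 (f_gt0 N0 dx).
have H1 := is_derive_cmul gam (is_derive_mul (derive_prof_z N0 dx) (derive_rad_h N0 MN h00 h10 dx)).
have H2 := is_derive_cmul (-1) (is_derive_mul (derive_fV N0 (2 * N) dx) (derive_rad_h1 N0 MN h00 h10 dx)).
apply: (is_derive_eq (is_derive_add H1 H2)).
rewrite (rad_h2E N0 MN h00 h10 dx) /rad_eta /rad_gam /prof_z.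
move: (f x) (f1 x) (h x) (hz x) fx0 => y t a b y0.
have -> : y ^+ (2 * N) = y ^+ N * y ^+ N by rewrite -exprD; congr (_ ^+ _); lia.
rewrite natrM (exprS y N) -[M.+1]addn1 natrD.
move: (y ^+ N) (expf_neq0 N y0) => q q0.
by move: (N%:R) (M%:R) NR0 => k l k0; field; rewrite k0 q0 y0.
Qed.

(** W psi'(W) / psi(W) with W = f(W) / f'(W), after the derivative of the
    power series has been expressed by [rad_Y]. *)
Lemma rad_eigenvalue : h W != 0 ->
  W * rad_psi1 M c h0 h1 W / rad_psi M c h0 h1 W = M.+1%:R - N%:R * rad_Y W / (z W * h W).
Proof.
move=> hW; have fW := W_f1 c; have t0 := lt0r_neq0 (f1W_gt0 c N0).
have F0 := lt0r_neq0 (f_gt0 N0 (W_domain c)).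
rewrite /rad_psi1 /rad_psi /rad_Y /rad_gam /prof_z -[M.+1]addn1 !natrD.
have -> : F ^+ (2 * N) = F ^+ N * F ^+ N by rewrite -exprD; congr (_ ^+ _); lia.
rewrite (exprS F N) exprD.
move: fW t0 F0 hW (expf_neq0 N F0) (expf_neq0 M F0).
move: W (f1 W) F (F ^+ N) (F ^+ M) (h W) (hz W) => w t y q r a b wt t0 y0 a0 q0 r0.
have -> : w = y / t by rewrite -wt mulfK.
by move: (N%:R) (M%:R) NR0 => k l k0; field; rewrite k0 q0 y0 t0 a0 r0.
Qed.

Lemma rad_eta_ge0 : 0 <= eta.
Proof. by rewrite /rad_eta mulr_ge0 ?divr_ge0// addr_ge0// divr_ge0. Qed.

Let domE x y : 0 <= x -> x <= y -> y <= W -> forall t, x <= t <= y -> 0 <= t <= W.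
Proof. by move=> x0 xy yW t /andP[xt ty]; rewrite (le_trans x0 xt) (le_trans ty yW). Qed.

Let dom x (xW : 0 <= x <= W) := prof_segment xW.
Let f_ge x (xW : 0 <= x <= W) : 1 <= f x. Proof. exact: f_ge1 (dom xW). Qed.
Let f_pos x (xW : 0 <= x <= W) : 0 < f x. Proof. exact: f_gt0 (dom xW). Qed.
Let f1_pos x (xW : 0 <= x <= W) : 0 <= f1 x.
Proof. by apply: f1_ge0 (dom xW) _ => //; case/andP: xW. Qed.
Let f_leF x (xW : 0 <= x <= W) : f x <= F.
Proof. by case/andP: xW => x0 xW; apply: f_mono => //; exact: W_domain. Qed.
Let pow_pos x k (xW : 0 <= x <= W) : 0 < f x ^+ k. Proof. by rewrite exprn_gt0 ?f_pos. Qed.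
Let powV_pos x k (xW : 0 <= x <= W) : 0 <= (f x ^+ k)^-1. Proof. by rewrite invr_ge0 ltW// pow_pos. Qed.
Let pow_ge0 x k (xW : 0 <= x <= W) : 0 <= f x ^+ k. Proof. exact: ltW (pow_pos k xW). Qed.
Local Ltac nonneg xW := rewrite ?(rad_P_ge0 xW, pow_ge0 _ xW, powV_pos _ xW, (rad_ge0 xW).1, f1_pos xW,
  ltW (f_pos xW), rad_eta_ge0, ler0n, mulr_ge0)//.
Let powE (y : R) : y ^+ (2 * N + 2 * M + 2) = y * y ^+ (2 * N) * y ^+ (2 * M + 1).
Proof. by rewrite -(exprS y (2 * N)) -exprD; congr (_ ^+ _); lia. Qed.
Let pow2N (y : R) : y ^+ (2 * N) = y ^+ N * y ^+ N.
Proof. by rewrite -exprD; congr (_ ^+ _); lia. Qed.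
Let powE2 (y : R) : y ^+ (2 * N + 2 * M) = y ^+ (2 * N).-1 * y ^+ (2 * M + 1).
Proof. by rewrite -exprD; congr (_ ^+ _); lia. Qed.
Let powE3 (y : R) : y ^+ (N + 2 * M + 1) = y ^+ (2 * M) * y ^+ N.+1.
Proof. by rewrite -exprD; congr (_ ^+ _); lia. Qed.
Let powE4 (y : R) : y ^+ (2 * N + 2 * M) = y ^+ (N + 2 * M + 1).-1 * y ^+ N.
Proof. by rewrite -exprD; congr (_ ^+ _); lia. Qed.
Let powE5 (y : R) : y ^+ (2 * N + 2 * M + 2) = y ^+ N.+1 * y ^+ (N + 2 * M + 1).
Proof. by rewrite -exprD; congr (_ ^+ _); lia. Qed.
Let odd_alg (e p t a b y : R) : y != 0 -> a != 0 -> b != 0 ->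
  e * p * (t / (y * a)) = e * (y * a * b)^-1 * (p * (b * t)).
Proof. by move=> y0 a0 b0; field; rewrite y0 a0 b0. Qed.
Let WW : 0 <= W <= W. Proof. by rewrite lexx andbT ltW// cat_W_gt0. Qed.
Let f_0E : f 0 = 1. Proof. by have [] := cat_f_sol c. Qed.
Let f1_0E : f1 0 = 0. Proof. by have [] := cat_f_sol c. Qed.

Lemma rad_h_mono x y : 0 <= x -> x <= y -> y <= W -> h x <= h y.
Proof.
move=> x0 xy yW; have D := domE x0 xy yW.
apply: (derive_ge0_le xy (F' := fun x => N%:R * f x ^+ (2 * N + 2 * M) * rad_P x)) => t /D tW.
  exact: derive_h (dom tW).
by nonneg tW.
Qed.

Lemma rad_P_mono x y : 0 <= x -> x <= y -> y <= W -> rad_P x <= rad_P y.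
Proof.
move=> x0 xy yW; have D := domE x0 xy yW.
apply: (derive_ge0_le xy (F' := fun x => eta * N%:R * (f x ^+ (2 * N + 2 * M + 2))^-1 * h x)) => t /D tW.
  exact: derive_P (dom tW).
by nonneg tW.
Qed.

Lemma rad_P_0 : rad_P 0 = h1.
Proof. by rewrite /rad_P f_0E expr1n invr1 mul1r rad_h1_0. Qed.

Let dFV x (xW : 0 <= x <= W) :
  is_derive x 1 (fun x => (-1) * (f x ^+ N)^-1) (N%:R / f x ^+ N.+1 * f1 x).
Proof.
apply: (is_derive_eq (is_derive_cmul (-1) (derive_fV N0 N (dom xW)))).
by rewrite exprS; ring.
Qed.

(** ** Odd modes *)

Section Odd.
Hypotheses (h0E : h0 = 0) (h1E : h1 = 1).

Let P_ge1 x : 0 <= x <= W -> 1 <= rad_P x.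
Proof.
by move=> /andP[x0 xW]; rewrite -h1E -rad_P_0; exact: rad_P_mono.
Qed.

(** In the odd case the radial function starts like f', and [rad_P] starts at 1. *)
Lemma odd_h_ge x : 0 <= x <= W -> f1 x <= h x.
Proof.
move=> /[dup] xW /andP[x0 xW']; have D := domE (lexx 0) x0 xW'.
suff : f1 x - f1 0 <= h x - h 0 by rewrite f1_0E rad_h_0 h0E !subr0.
apply: (derive_le_increment x0 (F' := fun x => N%:R * f x ^+ (2 * N).-1)
  (G' := fun x => N%:R * f x ^+ (2 * N + 2 * M) * rad_P x)) => t /D tW.
- exact: derive_f1 (dom tW).
- exact: derive_h (dom tW).
rewrite powE2 -!mulrA ler_wpM2l// ler_peMr ?(ltW (pow_pos _ _))//.
have := exprn_ege1 (2 * M + 1) (f_ge tW); have := P_ge1 tW.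
by move: (_ ^+ _) (rad_P t) => a b b1 a1; rewrite -[1]mulr1 ler_pM.
Qed.

Lemma odd_h_le x : 0 <= x <= W -> h x <= rad_P x * (f x ^+ (2 * M + 1) * f1 x).
Proof.
move=> /[dup] xW /andP[x0 xW']; have D := domE (lexx 0) x0 xW'.
suff : h x - h 0 <= rad_P x * (f x ^+ (2 * M + 1) * f1 x) - rad_P 0 * (f 0 ^+ (2 * M + 1) * f1 0).
  by rewrite f1_0E rad_h_0 h0E !mulr0 !subr0.
have dG t : 0 <= t <= x -> _ := fun tx => is_derive_mul (derive_P (dom (D t tx)))
  (is_derive_mul (is_derive_pow1 (2 * M + 1) (derive_f (dom (D t tx)))) (derive_f1 N0 (dom (D t tx)))).
apply: (derive_le_increment x0 _ dG (F' := fun x => N%:R * f x ^+ (2 * N + 2 * M) * rad_P x)) => t /D tW.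
  exact: derive_h (dom tW).
have p0 := rad_P_ge0 tW; have t0 := f1_pos tW; have g0 := (rad_ge0 tW).1.
have q0 k : 0 <= f t ^+ k := ltW (pow_pos k tW).
have i0 := powV_pos (2 * N + 2 * M + 2) tW.
rewrite powE2 mulrDr -addrA -[leLHS]addr0 lerD//.
  by rewrite le_eqVlt; apply/orP; left; apply/eqP; ring.
by apply: addr_ge0; nonneg tW.
Qed.

(** By [odd_h_le] the logarithmic derivative of [rad_P] is at most
    eta N f' / f ^ (2 N + 1), whose integral is at most eta / 2; the factor
    1 - (eta / 2) (1 - f ^ (- 2 N)) makes the product nonincreasing. *)
Lemma odd_P_le : rad_P W * (1 - eta / 2) <= 1.
Proof.
have W0 := ltW (cat_W_gt0 c).
pose B x := (1 - eta / 2) + eta / 2 * (f x ^+ (2 * N))^-1.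
have dB x : 0 <= x <= W -> is_derive x 1 B (0 + eta / 2 * (- ((2 * N)%:R * f1 x / (f x * f x ^+ (2 * N))))).
  move=> xW; exact: (is_derive_add (is_derive_cst (1 - eta / 2 : R) (x : R) 1)
    (is_derive_cmul (eta / 2) (derive_fV N0 (2 * N) (dom xW)))).
have e0 := rad_eta_ge0.
have dG x : 0 <= x <= W -> _ := fun xW => is_derive_mul (derive_P (dom xW)) (dB x xW).
have : rad_P W * B W - rad_P 0 * B 0 <= 0 * W - 0 * 0.
  apply: (derive_le_increment W0 dG (fun x _ => is_derive_scale 0 x)) => x xW.
  have hl := odd_h_le xW; have p0 := rad_P_ge0 xW; have t0 := f1_pos xW; have g0 := (rad_ge0 xW).1.
  have y1 := f_ge xW; have y0 := f_pos xW; have i0 := powV_pos (2 * N + 2 * M + 2) xW.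
  have B1 : B x <= 1.
    rewrite /B; have : (f x ^+ (2 * N))^-1 <= 1 by rewrite invf_le1 ?pow_pos// exprn_ege1.
    move=> v1; have : eta / 2 * (f x ^+ (2 * N))^-1 <= eta / 2 * 1 by rewrite ler_wpM2l//; lra.
    by lra.
  pose X := eta * N%:R * rad_P x * (f1 x / (f x * f x ^+ (2 * N))).
  set P' := eta * N%:R * _^-1 * _.
  have P'0 : 0 <= P' by rewrite /P'; nonneg xW.
  have P'X : P' <= X.
    rewrite /P' /X.
    have -> : eta * N%:R * rad_P x * (f1 x / (f x * f x ^+ (2 * N))) =
        eta * N%:R * (f x ^+ (2 * N + 2 * M + 2))^-1 * (rad_P x * (f x ^+ (2 * M + 1) * f1 x)).
      by rewrite powE; apply: odd_alg; rewrite lt0r_neq0// pow_pos.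
    by rewrite ler_wpM2l//; nonneg xW.
  have -> : rad_P x * (0 + eta / 2 * (- ((2 * N)%:R * f1 x / (f x * f x ^+ (2 * N))))) = - X.
    by rewrite /X natrM; move: ((f x * f x ^+ (2 * N))^-1) => q; field.
  have : B x * P' <= 1 * P' by rewrite ler_wpM2r.
  by lra.
rewrite rad_P_0 h1E /B f_0E expr1n invr1 !mulr1 => H.
have : 0 <= rad_P W * (eta / 2 * (F ^+ (2 * N))^-1).
  by nonneg WW; rewrite divr_ge0.
by rewrite mulrDr in H; lra.
Qed.

(** Up to the factor gam - eta, Y + 1 is the integral of N f ^ (- N - 1) h; with h
    replaced by f' the integral is 1 - F ^ (- N). *)
Lemma odd_Y : 0 <= gam - eta ->
  -1 + (gam - eta) * (1 - (F ^+ N)^-1) <= rad_Y W /\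
  rad_Y W <= -1 + (gam - eta) * (rad_P W * F ^+ (2 * M + 1)).
Proof.
move=> ge; have W0 := ltW (cat_W_gt0 c); have [_ W0'] := andP WW.
have dH k x : 0 <= x <= W -> is_derive x 1 (fun x => k * ((-1) * (f x ^+ N)^-1)) (k * (N%:R / f x ^+ N.+1 * f1 x)).
  by move=> xW; apply: is_derive_cmul; exact: dFV.
have dY x : 0 <= x <= W -> _ := fun xW => derive_Y (dom xW).
have n0 x : 0 <= x <= W -> 0 <= N%:R / f x ^+ N.+1 by move=> xW; nonneg xW.
have Y0 : rad_Y 0 = -1 by rewrite rad_Y_0 h1E.
split.
  have := derive_le_increment W0 (dH (gam - eta)) dY; rewrite Y0 f_0E expr1n invr1 => H.
  suff : (gam - eta) * (-1 / F ^+ N) - (gam - eta) * (-1 * 1) <= rad_Y W - -1 by lra.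
  apply: H => x xW; apply: ler_wpM2l => //; apply: ler_wpM2l; [exact: n0|exact: odd_h_ge].
have := derive_le_increment W0 dY (dH ((gam - eta) * (rad_P W * F ^+ (2 * M + 1)))).
rewrite Y0 f_0E expr1n invr1 => H.
set K := (gam - eta) * (rad_P W * F ^+ (2 * M + 1)) in H *.
have K0 : 0 <= K by rewrite /K mulr_ge0//; nonneg WW.
have Kv : 0 <= K * (F ^+ N)^-1 by rewrite mulr_ge0// powV_pos.
suff : rad_Y W - -1 <= K * (-1 / F ^+ N) - K * (-1 * 1).
  by rewrite mulN1r mulrN; lra.
apply: H => x xW; rewrite /K -[leRHS]mulrA; apply: ler_wpM2l => //; rewrite [leRHS]mulrCA; apply: ler_wpM2l; first exact: n0.
apply: (le_trans (odd_h_le xW)); rewrite mulrA; apply: ler_wpM2r; first exact: f1_pos.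
have /andP[x0 x1] := xW; apply: ler_pM; [exact: rad_P_ge0|exact: pow_ge0|exact: rad_P_mono|].
by apply: lerXn2r; [exact: ltW (f_pos xW)|exact: ltW (f_pos WW)|exact: f_leF].
Qed.

End Odd.

(** ** Even modes *)

Section Even.
Hypotheses (h0E : h0 = 1) (h1E : h1 = 0).
Hypothesis ge0 : 0 <= gam - eta.

Let Y0 : rad_Y 0 = 0. Proof. by rewrite rad_Y_0 h1E oppr0. Qed.
Let P0 : rad_P 0 = 0. Proof. by rewrite rad_P_0. Qed.
Let H0 : h 0 = 1. Proof. by rewrite rad_h_0. Qed.
Let W0 : 0 <= W. Proof. exact: ltW (cat_W_gt0 c). Qed.
Let e0 : 0 <= eta. Proof. exact: rad_eta_ge0. Qed.
Let n0 x k : 0 <= x <= W -> 0 <= N%:R / f x ^+ k. Proof. by move=> xW; nonneg xW. Qed.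

Lemma even_h_ge1 x : 0 <= x <= W -> 1 <= h x.
Proof. by move=> /andP[x0 xW]; rewrite -H0; exact: rad_h_mono. Qed.

Lemma even_Y_ge x : 0 <= x <= W -> (gam - eta) * z x <= rad_Y x.
Proof.
move=> /andP[x0 xW']; have D := domE (lexx 0) x0 xW'.
suff : (gam - eta) * z x - (gam - eta) * z 0 <= rad_Y x - rad_Y 0 by rewrite Y0 prof_z0; lra.
apply: (derive_le_increment x0 (fun t tx => is_derive_cmul (gam - eta) (derive_prof_z N0 (dom (D t tx))))
  (fun t tx => derive_Y (dom (D t tx)))) => t /D tW.
apply: ler_wpM2l => //; rewrite -[leLHS]mulr1; apply: ler_wpM2l; [exact: n0|exact: even_h_ge1].
Qed.

Lemma even_hz_le x : 0 <= x <= W -> (f x ^+ (2 * N))^-1 * hz x <= gam * (z x * h x).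
Proof.
move=> xW; have := even_Y_ge xW; rewrite /rad_Y; have z0 := prof_z_ge0 N0 xW.
have : 0 <= (gam - eta) * z x by rewrite mulr_ge0.
by lra.
Qed.

(** The logarithmic derivative of the radial function is at most
    N gam f' / f. *)
Lemma even_h_le x : 0 <= x <= W -> h x <= f x ^+ (N + 2 * M + 1).
Proof.
move=> /[dup] xW /andP[x0 xW']; have D := domE (lexx 0) x0 xW'.
pose K := (N + 2 * M + 1)%N; have q0 := pow_pos K xW; rewrite -/K.
suff : (f x ^+ K)^-1 * h x - (f 0 ^+ K)^-1 * h 0 <= 0 * x - 0 * 0.
  rewrite f_0E expr1n invr1 H0 mulr1 !mul0r subr0 subr_le0 mulrC ler_pdivrMr// mul1r.
  exact.
apply: (derive_le_increment x0 (fun t tx => is_derive_mul (derive_fV N0 K (dom (D t tx)))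
  (derive_rad_h N0 MN h00 h10 (dom (D t tx)))) (fun t _ => is_derive_scale 0 t)) => t /D tW.
have hl := even_hz_le tW.
have y0 := lt0r_neq0 (f_pos tW).
have : 0 <= (f t ^+ K)^-1 * (N%:R / f t ^+ N.+1 * f t ^+ (2 * N)) *
    (gam * (z t * h t) - (f t ^+ (2 * N))^-1 * hz t).
  by apply: mulr_ge0; [nonneg tW|rewrite subr_ge0].
move=> G; rewrite -subr_ge0; apply: (le_trans G); rewrite le_eqVlt; apply/orP; left; apply/eqP => {G hl}.
rewrite /rad_gam /prof_z /K.
have -> : (N + 2 * M + 1)%:R = N%:R + 2 * M%:R + 1 :> R by rewrite 2!natrD natrM.
rewrite pow2N.
rewrite (exprS (f t) N).
move: (expf_neq0 N y0) (expf_neq0 (N + 2 * M + 1) y0).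
move: (h t) (hz t) (f1 t) (f t) (f t ^+ N) (f t ^+ (N + 2 * M + 1)) y0 => a b s y q r y0 qq0 r0.
by move: (N%:R) (M%:R) NR0 => k l k0; field; rewrite k0 qq0 y0 r0.
Qed.

Let P'_le x : 0 <= x <= W ->
  eta * N%:R * (f x ^+ (2 * N + 2 * M + 2))^-1 * h x <= eta * (N%:R / f x ^+ N.+1).
Proof.
move=> xW; rewrite -mulrA -mulrA; apply: ler_wpM2l => //; apply: ler_wpM2l => //.
have -> : (f x ^+ N.+1)^-1 = (f x ^+ (2 * N + 2 * M + 2))^-1 * f x ^+ (N + 2 * M + 1).
  by rewrite powE5 invfM mulfVK// lt0r_neq0// pow_pos.
by apply: ler_wpM2l; [exact: powV_pos|exact: even_h_le].
Qed.

Lemma even_P_le x : 0 <= x <= W -> rad_P x <= eta * z x.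
Proof.
move=> /[dup] xW /andP[x0 xW']; have D := domE (lexx 0) x0 xW'.
suff : rad_P x - rad_P 0 <= eta * z x - eta * z 0 by rewrite P0 prof_z0; lra.
apply: (derive_le_increment x0 (fun t tx => derive_P (dom (D t tx)))
  (fun t tx => is_derive_cmul eta (derive_prof_z N0 (dom (D t tx))))) => t /D tW.
exact: P'_le.
Qed.

Lemma even_h_le2 x : 0 <= x <= W -> h x <= 1 + eta * f x ^+ (N + 2 * M + 1).
Proof.
move=> /[dup] xW /andP[x0 xW']; have D := domE (lexx 0) x0 xW'.
set K := (N + 2 * M + 1)%N.
suff : h x - h 0 <= eta * f x ^+ K - eta * f 0 ^+ K.
  by rewrite H0 f_0E expr1n mulr1; have := e0; lra.
apply: (derive_le_increment x0 (fun t tx => derive_h (dom (D t tx)))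
  (fun t tx => is_derive_cmul eta (is_derive_pow1 K (derive_f (dom (D t tx)))))) => t /D tW.
apply: (@le_trans _ _ (N%:R * f t ^+ (2 * N + 2 * M) * (eta * z t))).
  by apply: ler_wpM2l; [nonneg tW|exact: even_P_le].
have -> : N%:R * f t ^+ (2 * N + 2 * M) * (eta * z t) = eta * (N%:R * f t ^+ K.-1 * f1 t).
  rewrite /prof_z; rewrite powE4 -/K.
  by move: (lt0r_neq0 (pow_pos N tW)); move: (f t ^+ N) => q qq0; field.
apply: ler_wpM2l => //; apply: ler_wpM2r; first exact: f1_pos.
by apply: ler_wpM2r; [nonneg tW|rewrite ler_nat /K -addnA leq_addr].
Qed.

Lemma even_Y_le : rad_Y W <= (gam - eta) * (z W + eta * F ^+ (2 * M) * (N%:R * W)).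
Proof.
pose K := eta * F ^+ (2 * M) * N%:R.
suff : rad_Y W - rad_Y 0 <= (gam - eta) * (z W + K * W) - (gam - eta) * (z 0 + K * 0).
  by rewrite Y0 prof_z0 /K; lra.
apply: (derive_le_increment W0 (fun t tx => derive_Y (dom tx))
  (fun t tx => is_derive_cmul (gam - eta) (is_derive_add (derive_prof_z N0 (dom tx)) (is_derive_scale K t)))) => t tW.
apply: ler_wpM2l => //; rewrite -[leLHS]mulrC.
have := even_h_le2 tW => hl.
apply: (@le_trans _ _ ((1 + eta * f t ^+ (N + 2 * M + 1)) * (N%:R / f t ^+ N.+1))).
  by apply: ler_wpM2r => //; exact: n0.
have -> : (1 + eta * f t ^+ (N + 2 * M + 1)) * (N%:R / f t ^+ N.+1) =
    N%:R / f t ^+ N.+1 + eta * f t ^+ (2 * M) * N%:R.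
  rewrite powE3.
  by move: (lt0r_neq0 (pow_pos N.+1 tW)); move: (f t ^+ N.+1) => q qq0; field.
rewrite lerD2l /K; apply: ler_wpM2r => //; apply: ler_wpM2l => //.
by apply: lerXn2r; [exact: ltW (f_pos tW)|exact: ltW (f_pos WW)|exact: f_leF].
Qed.

(** Up to the factor eta, [rad_P] is close to this function, whose value at W
    is N W / 2 up to O(1 / N). *)
Definition even_T x := 2^-1 * (z x * (f x ^+ N)^-1 + N%:R * x).

Let dT x (xW : 0 <= x <= W) : is_derive x 1 even_T
  (N%:R / (f x * f x ^+ (2 * N)) + N%:R / 2 * (1 - (f x)^-1)).
Proof.
have FI := first_integral N0 (dom xW); have y0 := lt0r_neq0 (f_pos xW).
apply: (is_derive_eq (is_derive_cmul 2^-1 (is_derive_add (is_derive_mul (derive_prof_z N0 (dom xW))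
  (derive_fV N0 N (dom xW))) (is_derive_scale N%:R x)))).
move: FI; rewrite pow2N.
rewrite /prof_z (exprS (f x) N); move: (expf_neq0 N y0).
move: (f1 x) (f x) (f x ^+ N) y0 => t y q y0 qq0 E.
transitivity (2^-1 * (N%:R * (1 - t ^+ 2) / (y * (q * q)) + N%:R)).
  by field; rewrite y0 qq0.
by rewrite E; field; rewrite y0 qq0.
Qed.

Lemma even_P_W_le : rad_P W <= eta * (N%:R * W / 2 + (F ^+ N)^-1 / 2 + eta).
Proof.
suff : rad_P W - rad_P 0 <= eta * (even_T W + eta * z W) - eta * (even_T 0 + eta * z 0).
  have [_ zW] := prof_zW c N0; have z0 := prof_z_ge0 N0 WW.
  rewrite P0 /even_T prof_z0 mulr0 mul0r !mulr0 !addr0 !mulr0 !subr0 => H; apply: (le_trans H).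
  apply: ler_wpM2l => //; have a0 := powV_pos N WW.
  have : z W * (F ^+ N)^-1 <= 1 * (F ^+ N)^-1 by rewrite ler_wpM2r// ltW.
  have : eta * z W <= eta * 1 by rewrite ler_wpM2l// ltW.
  by lra.
apply: (derive_le_increment W0 (fun t tx => derive_P (dom tx))
  (fun t tx => is_derive_cmul eta (is_derive_add (dT tx) (is_derive_cmul eta (derive_prof_z N0 (dom tx)))))) => t tW.
have y1 := f_ge tW; have q0 := powV_pos (2 * N + 2 * M + 2) tW.
rewrite -mulrA -mulrA; apply: ler_wpM2l => //.
apply: (@le_trans _ _ (N%:R * ((f t ^+ (2 * N + 2 * M + 2))^-1 * (1 + eta * f t ^+ (N + 2 * M + 1))))).
  by apply: ler_wpM2l => //; apply: ler_wpM2l => //; exact: even_h_le2.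
have E1 : (f t ^+ (2 * N + 2 * M + 2))^-1 * f t ^+ (N + 2 * M + 1) = (f t ^+ N.+1)^-1.
  by rewrite powE5 invfM mulfVK// lt0r_neq0// pow_pos.
have E2 : (f t ^+ (2 * N + 2 * M + 2))^-1 <= (f t * f t ^+ (2 * N))^-1.
  rewrite powE invfM -[leRHS]mulr1; apply: ler_wpM2l.
    by rewrite invr_ge0 mulr_ge0 ?pow_ge0 ?(ltW (f_pos tW)).
  by rewrite invf_le1 ?pow_pos// exprn_ege1.
have E3 : 0 <= N%:R / 2 * (1 - (f t)^-1).
  by rewrite mulr_ge0// subr_ge0 invf_le1// f_pos.
have E4 : N%:R * (f t ^+ (2 * N + 2 * M + 2))^-1 <= N%:R / (f t * f t ^+ (2 * N)) by apply: ler_wpM2l.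
have -> : N%:R * ((f t ^+ (2 * N + 2 * M + 2))^-1 * (1 + eta * f t ^+ (N + 2 * M + 1))) =
   N%:R * (f t ^+ (2 * N + 2 * M + 2))^-1 + eta * (N%:R / f t ^+ N.+1).
  by rewrite -E1; ring.
by lra.
Qed.

Lemma even_P_W_ge : eta * ((F ^+ (2 * M + 1))^-1 * (N%:R * W / (2 * F))) <= rad_P W.
Proof.
set k := (F ^+ (2 * M + 1))^-1; have k0 : 0 <= k by exact: powV_pos.
pose K := N%:R / 2 * (1 - F^-1).
have F0 := f_pos WW.
suff : eta * (k * (even_T W + (- K) * W)) - eta * (k * (even_T 0 + (- K) * 0)) <= rad_P W - rad_P 0.
  rewrite P0 /even_T prof_z0 mul0r !mulr0 !addr0 !mulr0 !subr0; apply: le_trans.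
  apply: ler_wpM2l => //; apply: ler_wpM2l => //.
  have a0 : 0 <= z W * (F ^+ N)^-1 by rewrite mulr_ge0 ?prof_z_ge0 ?powV_pos.
  have -> : N%:R * W / (2 * F) = 2^-1 * (N%:R * W) + - K * W.
    by rewrite /K; move: (lt0r_neq0 F0) => F0'; field.
  by lra.
apply: (derive_le_increment W0 (fun t tx => is_derive_cmul eta (is_derive_cmul k
  (is_derive_add (dT tx) (is_derive_scale (- K) t)))) (fun t tx => derive_P (dom tx))) => t tW.
rewrite -[leRHS]mulrA -[leRHS]mulrA; apply: ler_wpM2l => //.
have fF := f_leF tW; have y0 := f_pos tW.
have v : F^-1 <= (f t)^-1 by rewrite lef_pV2 ?posrE.
have c1 : N%:R / 2 * (1 - (f t)^-1) <= K by apply: ler_wpM2l => //; lra.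
apply: (@le_trans _ _ (k * (N%:R / (f t * f t ^+ (2 * N))))).
  by apply: ler_wpM2l => //; lra.
have k1 : k <= (f t ^+ (2 * M + 1))^-1.
  rewrite lef_pV2 ?posrE ?pow_pos//.
  by apply: lerXn2r; [exact: ltW|exact: ltW|].
have i0 : 0 <= (f t * f t ^+ (2 * N))^-1 by rewrite invr_ge0 mulr_ge0 ?pow_ge0 ?(ltW y0).
have kh : k * 1 <= (f t ^+ (2 * M + 1))^-1 * h t by apply: ler_pM => //; exact: even_h_ge1.
rewrite powE [X in _ <= _ * (X * _)]invfM.
move: (_^-1) i0 kh => i i0 kh.
have -> : k * (N%:R * i) = N%:R * i * (k * 1) by ring.
by rewrite -[X in _ <= _ * X]mulrA [leRHS]mulrA; apply: ler_wpM2l => //; apply: mulr_ge0.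
Qed.

(** h' is f'' times f ^ (2 M + 1) times the nondecreasing [rad_P]. *)
Lemma even_h_W_le : h W <= 1 + rad_P W * F ^+ (2 * M + 1) * f1 W.
Proof.
set K := rad_P W * F ^+ (2 * M + 1).
have K0 : 0 <= K by rewrite /K; nonneg WW.
suff : h W - h 0 <= K * f1 W - K * f1 0 by rewrite H0 f1_0E; lra.
apply: (derive_le_increment W0 (fun t tx => derive_h (dom tx))
  (fun t tx => is_derive_cmul K (derive_f1 N0 (dom tx)))) => t tW.
rewrite powE2.
have -> : N%:R * (f t ^+ (2 * N).-1 * f t ^+ (2 * M + 1)) * rad_P t =
   (rad_P t * f t ^+ (2 * M + 1)) * (N%:R * f t ^+ (2 * N).-1) by ring.
apply: ler_wpM2r; first by nonneg tW.
have /andP[t0 t1] := tW; apply: ler_pM; [exact: rad_P_ge0|exact: pow_ge0|exact: rad_P_mono|].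
by apply: lerXn2r; [exact: ltW (f_pos tW)|exact: ltW (f_pos WW)|exact: f_leF].
Qed.

(** Integration by parts of P f'', the remainder being at most eta by the bound on
    the derivative of [rad_P]. *)
Lemma even_h_W_ge : 1 + rad_P W * f1 W - eta <= h W.
Proof.
suff : rad_P W * f1 W - rad_P 0 * f1 0 <=
    (h W + eta * ((-1) * (F ^+ N)^-1)) - (h 0 + eta * ((-1) * (f 0 ^+ N)^-1)).
  rewrite P0 mul0r f_0E expr1n invr1 H0.
  have : 0 <= eta * (F ^+ N)^-1 by rewrite mulr_ge0 ?powV_pos.
  by lra.
apply: (derive_le_increment W0 (fun t tx => is_derive_mul (derive_P (dom tx)) (derive_f1 N0 (dom tx)))
  (fun t tx => is_derive_add (derive_h (dom tx)) (is_derive_cmul eta (dFV tx)))) => t tW.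
apply: lerD.
  rewrite mulrC; apply: ler_wpM2r; first exact: rad_P_ge0.
  apply: ler_wpM2l => //; rewrite powE2.
  by rewrite ler_peMr ?pow_ge0// exprn_ege1// f_ge.
rewrite mulrC [leRHS]mulrA; apply: ler_wpM2r; first exact: f1_pos.
exact: P'_le.
Qed.

End Even.
End RadialBounds.

(** ** Elementary inequalities between real numbers *)

Section RealInequalities.
Variable (R : realFieldType).

(** Bounds with crude explicit constants, where r stands for m Log(n) / n.  They are
    stated for free variables to keep each linear problem small. *)
Lemma small_sqr (r : R) : 0 <= r -> r <= 1 / 1000 -> 0 <= r * r <= r / 1000.
Proof. by move=> r0 r1; rewrite mulr_ge0//= ler_wpM2l//; lra. Qed.

Lemma flux_upper (r g eta G X F Z Y : R) : 0 <= r -> r <= 1 / 1000 -> 0 <= g <= 1 + 2 * r -> 0 <= eta <= 6 * r ->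
  0 <= G <= 1 + 8 * r -> 0 <= X <= 2 * F -> F <= 1 + 8 * r -> 1 - 2 * r <= Z ->
  Y <= g * (Z + eta * G * X) -> Y <= (1 + 16 * r) * Z.
Proof.
move=> r0 r1000 /andP[g0 g1] /andP[e0 e1] /andP[G0 G1] /andP[X0 X1] F1 Z1 Y2; apply: (le_trans Y2).
have /andP[r2 r2'] := small_sqr r0 r1000.
have B1 : G * X <= (1 + 8 * r) * (2 * (1 + 8 * r)) by apply: ler_pM => //; clear -X1 F1; lra.
have B1' : G * X <= 21 / 10 by clear -B1 r2 r2' r1000 r0; lra.
have GX : 0 <= G * X by apply: mulr_ge0.
have B2 : eta * (G * X) <= 6 * r * (21 / 10) by apply: ler_pM.
have eGX : 0 <= eta * (G * X) by apply: mulr_ge0.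
have B3 : g * (Z + eta * (G * X)) <= (1 + 2 * r) * (Z + 13 * r).
  by apply: ler_pM => //; [clear -eGX Z1 r1000; lra|clear -B2 r0; lra].
have B4 : r * (99 / 100) <= r * Z by apply: ler_wpM2l => //; clear -Z1 r1000; lra.
by rewrite -mulrA; apply: (le_trans B3); clear -B4 r2' r0; lra.
Qed.

(** The radial function at W: H - 1 is at most [p * E * t], with
    p t close to eta (N / 2) F, that is to m - 1. *)
Lemma radial_upper (r NN mm MM F t v eta p E h : R) : 0 <= r -> r <= 1 / 1000 -> 0 < NN -> 0 <= MM -> mm = MM + 1 ->
  1 <= F -> 0 < t -> t <= 2 * NN * F -> 0 <= v -> v <= 2 / NN -> mm / NN <= 2 * r ->
  0 <= eta -> eta <= 3 * (MM / NN) -> eta * NN / 2 = MM * (1 + mm / NN / 2) ->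
  0 <= E -> F * E <= 1 + 8 * r -> p * t <= eta * (NN * F / 2 + (v / 2 + eta) * t) ->
  h <= 1 + p * E * t -> h <= mm * (1 + 46 * r).
Proof.
move=> r0 r1000 N0 M0 mE F1 t0 t1 v0 v1 mN e0 e3 etaN E0 FE pt H2.
have /andP[r2 r2'] := small_sqr r0 r1000.
have NNv : NN * NN^-1 = 1 by rewrite mulfV// lt0r_neq0.
have F0 : 0 < F by clear -F1; lra.
have B3 : (v / 2 + eta) * t <= (NN^-1 * (1 + 3 * MM)) * (2 * NN * F).
  by apply: ler_pM; [clear -v0 e0; lra|exact: ltW|clear -v1 e3; lra|].
have B4 : (NN^-1 * (1 + 3 * MM)) * (2 * NN * F) = 2 * (1 + 3 * MM) * F.
  by rewrite -[RHS]mulr1 -NNv; ring.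
have B5 : eta * ((v / 2 + eta) * t) <= 3 * (MM / NN) * (6 * mm * F).
  apply: ler_pM => //; first by apply: mulr_ge0; [clear -v0 e0; lra|exact: ltW].
  by apply: (le_trans B3); rewrite B4 ler_pM2r// mE; clear -M0; lra.
have B6 : 3 * (MM / NN) * (6 * mm * F) = MM * F * (18 * (mm / NN)) by ring.
have MF : 0 <= MM * F by apply: mulr_ge0 => //; exact: ltW.
have B7 : MM * F * (18 * (mm / NN)) <= MM * F * (36 * r) by apply: ler_wpM2l => //; clear -mN; lra.
have B8 : MM * (1 + mm / NN / 2) * F <= MM * (1 + r) * F.
  by rewrite ler_pM2r//; apply: ler_wpM2l => //; clear -mN; lra.
have B9 : p * t <= MM * F * (1 + 37 * r).
  have B2 : eta * (NN * F / 2 + (v / 2 + eta) * t) = eta * NN / 2 * F + eta * ((v / 2 + eta) * t) by ring.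
  by rewrite B2 etaN in pt; clear -pt B5 B6 B7 B8; lra.
have B10 : p * t * E <= MM * F * (1 + 37 * r) * E by apply: ler_wpM2r.
have q0 : 0 <= 1 + 37 * r by clear -r0; lra.
have B11 : MM * (1 + 37 * r) * (F * E) <= MM * (1 + 37 * r) * (1 + 8 * r).
  by apply: ler_wpM2l => //; apply: mulr_ge0.
have B12 : MM * ((1 + 37 * r) * (1 + 8 * r)) <= MM * (1 + 46 * r).
  by apply: ler_wpM2l => //; clear -r2' r0; lra.
by rewrite mE; clear -H2 B10 B11 B12 r0; lra.
Qed.

Lemma radial_lower (r q mm MM eta k x h : R) : 0 <= r -> r <= 1 / 1000 ->
  0 <= MM -> mm = MM + 1 -> 0 <= q -> eta <= 6 * r -> 1 - 4 * r <= k ->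
  MM * (1 + q / 2) * k <= x -> 1 + x - eta <= h -> mm * (1 - 10 * r) <= h.
Proof.
move=> r0 r1000 M0 mE q0 e1 k1 B1 H1.
have B3 : MM * 1 * (1 - 4 * r) <= MM * (1 + q / 2) * k.
  apply: ler_pM => //; [by rewrite mulr1|by clear -r1000; lra|].
  by apply: ler_wpM2l => //; clear -q0; lra.
have rM : 0 <= r * MM by exact: mulr_ge0.
by rewrite mE; clear -B1 B3 H1 e1 rM r0; lra.
Qed.

(** The eigenvalue is m - N Y / (Z h): here Y / Z and h / m are
    1 + O(r). *)
Lemma eigenvalue_ratio (r nn NN mm Z Y h : R) : 0 <= r -> r <= 1 / 1000 -> NN <= nn -> 0 < NN -> nn * (1 - r) <= NN -> 0 < mm ->
  1 - 2 * r <= Z -> (1 - 2 * r) * Z <= Y -> Y <= (1 + 16 * r) * Z ->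
  mm * (1 - 10 * r) <= h -> h <= mm * (1 + 46 * r) ->
  `|nn / mm - NN * Y / (Z * h)| <= 80 * (nn / mm * r).
Proof.
move=> r0 r1000 N1 N0 N2 m0 Z1 YL YU hL hU.
have /andP[r2 r2'] := small_sqr r0 r1000.
have q0 : 0 <= 1 - 2 * r by clear -r1000; lra.
have Z0 : 0 < Z by clear -Z1 r1000; lra.
have h0 : 0 < h by apply: lt_le_trans hL; apply: mulr_gt0 => //; clear -r1000; lra.
have n0 : 0 < nn by apply: lt_le_trans N1.
have nZ : 0 <= nn * Z by rewrite ltW// mulr_gt0.
have Zh : 0 < Z * h by apply: mulr_gt0.
have Y0 : 0 <= Y by apply: le_trans YL; apply: mulr_ge0 => //; exact: ltW.
have XU : NN * Y / (Z * h) <= (1 + 80 * r) * (nn / mm).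
  rewrite ler_pdivrMr// mulrA mulrAC ler_pdivlMr//.
  have C1 : NN * Y <= nn * ((1 + 16 * r) * Z) by apply: ler_pM => //; exact: ltW.
  have C2 : NN * Y * mm <= nn * ((1 + 16 * r) * Z) * mm by rewrite ler_pM2r.
  have C3 : (1 + 16 * r) * mm <= (1 + 80 * r) * h.
    have D1 : (1 + 80 * r) * (mm * (1 - 10 * r)) <= (1 + 80 * r) * h by apply: ler_wpM2l => //; clear -r0; lra.
    have D2 : mm * (1 + 16 * r) <= mm * ((1 + 80 * r) * (1 - 10 * r)).
      by rewrite ler_pM2l//; clear -r0 r2'; lra.
    by clear -D1 D2; lra.
  have C4 : nn * Z * ((1 + 16 * r) * mm) <= nn * Z * ((1 + 80 * r) * h) by apply: ler_wpM2l.
  by clear -C2 C4; lra.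
have XL : (1 - 80 * r) * (nn / mm) <= NN * Y / (Z * h).
  rewrite ler_pdivlMr//.
  have -> : (1 - 80 * r) * (nn / mm) * (Z * h) = (1 - 80 * r) * (nn * (Z * h)) / mm by ring.
  rewrite ler_pdivrMr//.
  have C1 : nn * (1 - r) * ((1 - 2 * r) * Z) <= NN * Y.
    apply: ler_pM => //; first by apply: mulr_ge0; [exact: ltW|clear -r1000; lra].
    by apply: mulr_ge0 => //; exact: ltW.
  have C2 : nn * (1 - r) * ((1 - 2 * r) * Z) * mm <= NN * Y * mm by rewrite ler_pM2r.
  have C3 : (1 - 80 * r) * h <= (1 - r) * (1 - 2 * r) * mm.
    have D1 : (1 - 80 * r) * h <= (1 - 80 * r) * (mm * (1 + 46 * r)) by apply: ler_wpM2l => //; clear -r1000; lra.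
    have D2 : mm * ((1 - 80 * r) * (1 + 46 * r)) <= mm * ((1 - r) * (1 - 2 * r)).
      by rewrite ler_pM2l//; clear -r0 r2 r2'; lra.
    by clear -D1 D2; lra.
  have C4 : nn * Z * ((1 - 80 * r) * h) <= nn * Z * ((1 - r) * (1 - 2 * r) * mm) by apply: ler_wpM2l.
  by clear -C2 C4; lra.
rewrite ler_norml; move: (NN * Y / (Z * h)) (nn / mm) XU XL => x y XU XL.
by apply/andP; split; clear -XU XL; lra.
Qed.

Lemma odd_ratio (r NN g p v E eta Y Z h : R) : 0 <= r -> r <= 1 / 1000 -> 0 < NN ->
  1 - 2 * r <= g <= 1 + 2 * r -> 0 <= p -> p * (1 - eta / 2) <= 1 -> eta <= 6 * r ->
  0 <= E <= 1 + 8 * r -> v <= 4 * r -> -1 + g * (1 - v) <= Y -> Y <= -1 + g * (p * E) ->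
  NN / 2 <= h -> 1 - 2 * r <= Z -> `|NN * Y / (Z * h)| <= 33 * r.
Proof.
move=> r0 r1000 N0 /andP[g0 g1] p0 PW e1 /andP[E0 E1] v1 Y1 Y2 hN Z0.
have /andP[r2 r2'] := small_sqr r0 r1000.
have p1 : p <= 1 + 4 * r.
  have q0 : 0 < 1 - 3 * r by clear -r1000; lra.
  rewrite -(ler_pM2r q0); apply: (@le_trans _ _ 1); last by clear -r0 r1000 r2'; lra.
  by apply: le_trans PW; apply: ler_wpM2l => //; clear -e1; lra.
have YL : - (6 * r) <= Y.
  apply: le_trans Y1.
  have : (1 - 2 * r) * (1 - 4 * r) <= g * (1 - v).
    by apply: ler_pM => //; [clear -r1000; lra|clear -r1000; lra|clear -v1; lra].
  by clear -r2 r0; lra.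
have gp : 0 <= g by clear -g0 r1000; lra.
have YU : Y <= 16 * r.
  apply: (le_trans Y2).
  have H1 : p * E <= (1 + 4 * r) * (1 + 8 * r) by apply: ler_pM.
  have H2 : p * E <= 1 + 13 * r by clear -H1 r2' r0; lra.
  have : g * (p * E) <= (1 + 2 * r) * (1 + 13 * r) by apply: ler_pM => //; exact: mulr_ge0.
  by clear -r2' r0; lra.
have zh : (99 / 200) * NN <= Z * h.
  have -> : (99 / 200) * NN = (99 / 100) * (NN / 2) by field.
  by apply: ler_pM => //; [rewrite divr_ge0// ltW|clear -Z0 r1000; lra].
have zh0 : 0 < Z * h by clear -zh N0; lra.
have rzh : r * (99 / 200 * NN) <= r * (Z * h) by apply: ler_wpM2l.
have YN1 : Y * NN <= 16 * r * NN by rewrite ler_pM2r.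
have YN2 : - (6 * r) * NN <= Y * NN by rewrite ler_pM2r.
have rN : 0 <= r * NN by apply: mulr_ge0 => //; exact: ltW.
rewrite ler_norml ler_pdivrMr// ler_pdivlMr//.
by apply/andP; split; clear -rzh YN1 YN2 rN; lra.
Qed.

End RealInequalities.

Section Asymptotics.
Variables (R : realType) (N M : nat) (c : profile R N.+1).
Hypotheses (N0 : (0 < N)%N) (MN : (M < N)%N).
Local Notation f := (cat_f c).
Local Notation f1 := (derive1 (cat_f c)).
Local Notation W := (cat_W c).
Local Notation z := (prof_z c).
Local Notation F := (cat_f c (cat_W c)).
Local Notation nn := (N.+1%:R : R).
Local Notation NN := (N%:R : R).
Local Notation mm := (M.+1%:R : R).
Local Notation MM := (M%:R : R).
Local Notation gam := (rad_gam R N M).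
Local Notation eta := (rad_eta R N M).

Let r : R := mm * ln nn / nn.
Hypotheses (lnge1 : 1 <= ln nn) (n1000 : 1000 <= nn) (r1000 : r <= 1 / 1000).

Let nE : nn = NN + 1. Proof. by rewrite natr1. Qed.
Let mE : mm = MM + 1. Proof. by rewrite natr1. Qed.
Let M0 : 0 <= MM. Proof. exact: ler0n. Qed.
Let N999 : 999 <= NN. Proof. by have := n1000; rewrite nE; lra. Qed.
Let N0R : 0 < NN. Proof. by have := N999; lra. Qed.

Let m_n : mm / nn <= r.
Proof.
rewrite /r -mulrA [ln _ / _]mulrC mulrA; have n0 : 0 < nn by have := n1000; lra.
by rewrite ler_peMr// divr_ge0// ltW.
Qed.

Let m_N : mm / NN <= 2 * r.
Proof.
have n0 : 0 < nn by have := n1000; lra.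
apply: (@le_trans _ _ (2 * (mm / nn))); last by rewrite ler_pM2l.
rewrite ler_pdivrMr// mulrA mulrAC ler_pdivlMr// [2 * mm]mulrC -mulrA ler_wpM2l//.
by have := N999; rewrite nE; lra.
Qed.

Let iN : NN^-1 <= 2 * r.
Proof.
apply: le_trans m_N; rewrite -[leLHS]mul1r ler_wpM2r ?invr_ge0//.
by rewrite mE; have := M0; lra.
Qed.

Let r0 : 0 <= r. Proof. have i0 : 0 < NN^-1 by rewrite invr_gt0.
by have := iN; lra. Qed.

Let M_N : 0 <= MM / NN <= 2 * r.
Proof.
rewrite divr_ge0//=; apply: le_trans m_N.
by rewrite ler_wpM2r ?invr_ge0// mE; lra.
Qed.

Let eta_le : eta <= 3 * (MM / NN).
Proof.
have /andP[a0 a1] := M_N; have := m_N; have := r1000; rewrite /rad_eta => h1 h2.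
by rewrite mulrC ler_wpM2r//; lra.
Qed.

Let eta6 : 0 <= eta <= 6 * r.
Proof. by have /andP[_ a1] := M_N; rewrite rad_eta_ge0/=; have := eta_le; lra. Qed.

Let gam_eta : 1 - 2 * r <= gam - eta <= 1 + 2 * r.
Proof.
have -> : gam - eta = 1 + NN^-1 - MM / NN * (mm / NN).
  by rewrite /rad_gam /rad_eta mE; have := lt0r_neq0 N0R; move: NN MM => k l k0; field.
have /andP[a0 a1] := M_N; have b0 : 0 <= mm / NN by rewrite divr_ge0// ltW.
have ab : MM / NN * (mm / NN) <= 1 * (mm / NN).
  by rewrite ler_wpM2r//; have := r1000; lra.
have ab0 : 0 <= MM / NN * (mm / NN) by rewrite mulr_ge0.
have i0 : 0 < NN^-1 by rewrite invr_gt0.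
by have := iN; have := m_N; lra.
Qed.

Let F1 : 1 <= F. Proof. exact: F_ge1. Qed.
Let F0 : 0 < F. Proof. by have := F1; lra. Qed.

(** F is so close to 1 that even its power 2 m is. *)
Let F_2m : F ^+ (2 * M.+1) <= 1 + 8 * r /\ 1 - 4 * r <= (F ^+ (2 * M.+1))^-1.
Proof.
have n0 : 0 < nn by have := n1000; lra.
have l0 : 0 <= ln F by rewrite ln_ge0.
have lF : (NN - 1) * ln F <= ln nn.
  have -> : NN - 1 = N.-1%:R by rewrite -{1}(prednK N0) -natr1 addrK.
  rewrite mulr_natl -lnXn// ler_ln ?posrE ?exprn_gt0//; exact: F_pow_le.
have m0 : 0 < mm by rewrite ltr0n.
have l4 : ln (F ^+ (2 * M.+1)) <= 4 * r.
  rewrite lnXn//; have -> : ln F *+ (2 * M.+1) = ln F * (2 * mm) by rewrite -[LHS]mulr_natr natrM.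
  have NN1 : 0 < NN - 1 by have := N999; lra.
  rewrite -(ler_pM2l NN1).
  apply: (@le_trans _ _ (2 * mm * ln nn)).
    have -> : (NN - 1) * (ln F * (2 * mm)) = 2 * mm * ((NN - 1) * ln F) by ring.
    by rewrite ler_pM2l// mulr_gt0.
  have -> : (NN - 1) * (4 * r) = (2 * mm * ln nn) * ((NN - 1) * 2 / nn).
    by rewrite /r; move: (lt0r_neq0 n0); move: nn mm (ln nn) NN => a b l k a0; field.
  rewrite ler_peMr//; first by rewrite !mulr_ge0//; have := lnge1; lra.
  by rewrite ler_pdivlMr// nE; have := N999; lra.
have E0 : 0 < F ^+ (2 * M.+1) by rewrite exprn_gt0.
have V : 1 - 4 * r <= (F ^+ (2 * M.+1))^-1.
  rewrite -[X in _ <= X^-1]lnK ?posrE// -expRN.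
  by apply: le_trans (expR_ge1Dx _); lra.
split=> //.
move: (F ^+ (2 * M.+1)) E0 V => E E0; rewrite -(ler_pM2r E0) mulVf ?lt0r_neq0// => V.
have rr : (1 + 8 * r) * (1 - 4 * r) >= 1.
  have rr0 : 0 <= r * (1 / 1000 - r) by apply: mulr_ge0; [exact: r0|rewrite subr_ge0].
  by move: rr0; rewrite mulrBr; have := r0; lra.
have q0 : 0 < 1 - 4 * r by have := r1000; lra.
rewrite -(ler_pM2l q0); apply: (le_trans V); lra.
Qed.

Let F_pow k : (k <= 2 * M.+1)%N -> 1 <= F ^+ k <= 1 + 8 * r.
Proof.
move=> km; rewrite exprn_ege1//=; apply: le_trans F_2m.1.
by rewrite ler_weXn2l.
Qed.

Let F_powV k : (k <= 2 * M.+1)%N -> 1 - 4 * r <= (F ^+ k)^-1.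
Proof.
move=> km; apply: (le_trans F_2m.2).
by rewrite lef_pV2 ?posrE ?exprn_gt0// ler_weXn2l.
Qed.

Let FN : (F ^+ N)^-1 <= 2 / NN.
Proof.
have -> : 2 / NN = (NN / 2)^-1 by rewrite invf_div.
by rewrite lef_pV2 ?posrE ?exprn_gt0 ?divr_gt0//; exact: F_pow_ge.
Qed.

Let f1W_bounds : NN / 2 <= f1 W <= 2 * NN * F.
Proof.
rewrite f1W_ge//=; apply: (le_trans (f1W_le c N0)).
have -> : F ^+ N = F ^+ N.-1 * F by rewrite -exprSr prednK.
rewrite ler_pM2r//.
apply: (le_trans (F_pow_le c N0)); rewrite nE; have := N999; lra.
Qed.

Let zW : 1 - 2 * r <= z W <= 1.
Proof.
have [a b] := prof_zW c N0; rewrite (ltW b) andbT; apply: le_trans a.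
have : 4 / NN ^+ 2 <= NN^-1.
  have k0 := lt0r_neq0 N0R.
  have -> : 4 / NN ^+ 2 = NN^-1 * (4 / NN) by field.
  apply: ler_piMr; first by rewrite invr_ge0 ltW.
  by rewrite ler_pdivrMr//; have := N999; lra.
by have := iN; lra.
Qed.

Lemma odd_asymptotics : 
  `| W * rad_psi1 M c 0 1 W / rad_psi M c 0 1 W - mm| <= 100 * (mm ^+ 2 * ln nn / nn).
Proof.
have h00 : 0 <= (0 : R) <= 1 by rewrite lexx ler01.
have h10 : 0 <= (1 : R) <= 1 by rewrite ler01 lexx.
have /andP[t0 t1] := f1W_bounds; have /andP[Z0 Z1] := zW; have /andP[g0 g1] := gam_eta.
have WW : 0 <= W <= W by rewrite lexx andbT ltW// cat_W_gt0.
have hW := odd_h_ge N0 MN h00 h10 erefl erefl WW.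
have n9 := N999; have r9 := r1000; have r00 := r0.
have h0 : 0 < rad_h M c 0 1 W by lra.
rewrite (rad_eigenvalue N0 MN h00 h10); last exact: lt0r_neq0.
have ge0 : 0 <= gam - eta by lra.
have [Y1 Y2] := odd_Y c N0 MN h00 h10 erefl erefl ge0.
have PW := odd_P_le c N0 MN h00 h10 erefl erefl.
have p0 := rad_P_ge0 N0 MN h00 h10 WW.
have /andP[E0 E1] : 1 <= F ^+ (2 * M + 1) <= 1 + 8 * r.
  by apply: F_pow; rewrite mulnS addn1 ltnS; exact: leqW.
have iNr := iN; have fn := FN; have fn0 : 0 < (F ^+ N)^-1 by rewrite invr_gt0 exprn_gt0.
have v4 : (F ^+ N)^-1 <= 4 * r by apply: (le_trans fn); lra.
have /andP[_ e1] := eta6.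
have E01 : 0 <= F ^+ (2 * M + 1) <= 1 + 8 * r by rewrite (le_trans ler01 E0).
have hN := le_trans t0 hW.
have B := odd_ratio r00 r9 N0R gam_eta p0 PW e1 E01 v4 Y1 Y2 hN Z0.
have -> : mm - NN * rad_Y M c 0 1 W / (z W * rad_h M c 0 1 W) - mm =
   - (NN * rad_Y M c 0 1 W / (z W * rad_h M c 0 1 W)) by ring.
rewrite normrN; apply: (le_trans B).
have m1 : 1 <= mm by rewrite mE lerDr.
apply: (@le_trans _ _ (100 * r)); first by rewrite ler_wpM2r// ler_nat.
have -> : mm ^+ 2 * ln nn / nn = mm * r by rewrite /r expr2; move: (ln nn) (nn^-1) => x y; ring.
apply: ler_wpM2l; first by rewrite ler0n.
by rewrite -[leLHS]mul1r; apply: ler_wpM2r.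
Qed.

Lemma even_asymptotics :
  `| W * rad_psi1 M c 1 0 W / rad_psi M c 1 0 W - (- (nn / mm) + mm)|
    <= 100 * (ln nn + mm ^+ 2 * ln nn / nn).
Proof.
have h00 : 0 <= (1 : R) <= 1 by rewrite lexx ler01.
have h10 : 0 <= (0 : R) <= 1 by rewrite ler01 lexx.
have /andP[t0 t1] := f1W_bounds; have /andP[Z0 Z1] := zW; have /andP[g0 g1] := gam_eta.
have W0 := ltW (cat_W_gt0 c).
have WW : 0 <= W <= W by rewrite lexx andbT.
have n9 := N999; have r9 := r1000; have r00 := r0; have n99 := n1000.
have ge0 : 0 <= gam - eta by lra.
have h1 := even_h_ge1 N0 MN h00 h10 erefl WW.
have h0 : 0 < rad_h M c 1 0 W by lra.
rewrite (rad_eigenvalue N0 MN h00 h10); last exact: lt0r_neq0.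
have Y1 := even_Y_ge N0 MN h00 h10 erefl erefl ge0 WW.
have Y2 := even_Y_le c N0 MN h00 h10 erefl erefl ge0.
have P1 := even_P_W_ge c N0 MN h00 h10 erefl erefl.
have P2 := even_P_W_le c N0 MN h00 h10 erefl erefl ge0.
have H1 := even_h_W_ge c N0 MN h00 h10 erefl erefl ge0.
have H2 := even_h_W_le c N0 MN h00 h10 erefl.
have [E0 E1] : 0 <= F ^+ (2 * M + 1) /\ 1 - 4 * r <= (F ^+ (2 * M + 1))^-1.
  split; first by rewrite exprn_ge0// ltW.
  by apply: F_powV; rewrite mulnS addn1 ltnS; exact: leqW.
have G1 : 0 <= F ^+ (2 * M) <= 1 + 8 * r.
  rewrite exprn_ge0 ?(ltW F0)//=.
  by have /andP[] : 1 <= F ^+ (2 * M) <= 1 + 8 * r by apply: F_pow; rewrite leq_mul2l leqnSn.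
have F8 : F <= 1 + 8 * r.
  by have /andP[] : 1 <= F ^+ 1 <= 1 + 8 * r by apply: F_pow; rewrite mulnS.
have FE : F * F ^+ (2 * M + 1) <= 1 + 8 * r.
  rewrite -exprS; have /andP[] // : 1 <= F ^+ (2 * M + 1).+1 <= 1 + 8 * r.
  by apply: F_pow; rewrite mulnS addn1.
have v0 : 0 <= (F ^+ N)^-1 by rewrite invr_ge0 exprn_ge0// ltW.
have /andP[e0 e1] := eta6; have mN := m_N; have M0' := M0.
have Wt := W_f1 c; have NW0 : 0 <= NN * W by apply: mulr_ge0.
have NWF : 0 <= NN * W <= 2 * F by rewrite NW0 NW_le.
have etaN : eta * NN / 2 = MM * (1 + mm / NN / 2).
  by rewrite /rad_eta; move: (lt0r_neq0 N0R); move: NN MM mm => k l j k0; field.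
have mNN0 : 0 <= mm / NN by rewrite divr_ge0// ltW.
have e06 : 0 <= eta <= 6 * r by rewrite e0.
have g02 : 0 <= gam - eta <= 1 + 2 * r by rewrite ge0.
have t00 := f1W_gt0 c N0.
have YU := flux_upper r00 r9 g02 e06 G1 NWF F8 Z0 Y2.
have YL : (1 - 2 * r) * z W <= rad_Y M c 1 0 W.
  by apply: le_trans Y1; apply: ler_wpM2r; first exact: prof_z_ge0.
have hL : mm * (1 - 10 * r) <= rad_h M c 1 0 W.
  move: P1 H1; move: (rad_P M c 1 0 W) (rad_h M c 1 0 W) => p h P1 H1.
  have B1 : eta * ((F ^+ (2 * M + 1))^-1 * (NN * W / (2 * F))) * f1 W <= p * f1 W by rewrite ler_pM2r.
  have B2 : eta * ((F ^+ (2 * M + 1))^-1 * (NN * W / (2 * F))) * f1 W =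
      MM * (1 + mm / NN / 2) * (F ^+ (2 * M + 1))^-1.
    rewrite -etaN -[X in _ / (2 * X)]Wt; have W0' : W != 0 by rewrite gt_eqF// cat_W_gt0.
    move: ((F ^+ (2 * M + 1))^-1) => k; move: (f1 W) (lt0r_neq0 t00) => s s0; move: W W0' => w w0.
    by field; rewrite w0 s0.
  rewrite B2 in B1; exact: radial_lower r00 r9 M0 mE mNN0 e1 E1 B1 H1.
have pt : rad_P M c 1 0 W * f1 W <= eta * (NN * F / 2 + ((F ^+ N)^-1 / 2 + eta) * f1 W).
  have B1 : rad_P M c 1 0 W * f1 W <= eta * (NN * W / 2 + (F ^+ N)^-1 / 2 + eta) * f1 W by rewrite ler_pM2r.
  apply: (le_trans B1); rewrite -Wt; move: ((F ^+ N)^-1) (f1 W) => v t.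
  by rewrite le_eqVlt; apply/orP; left; apply/eqP; ring.
have hU := radial_upper r00 r9 N0R M0 mE F1 t00 t1 v0 FN mN e0 eta_le etaN E0 FE pt H2.
have m0 : 0 < mm by rewrite ltr0n.
have nn0 : 0 < nn by rewrite ltr0n.
have B1 : nn / mm * r = ln nn.
  by rewrite /r; move: nn mm (ln nn) (lt0r_neq0 nn0) (lt0r_neq0 m0) => a b l a0 b0; field; rewrite a0 b0.
have rn : 1 <= nn * r.
  rewrite mulrC; have := m_n; rewrite ler_pdivrMr// => mn; apply: le_trans mn.
  by rewrite mE; lra.
have Nn : NN <= nn by rewrite nE; lra.
have Nn2 : nn * (1 - r) <= NN by rewrite mulrBr mulr1; move: rn; rewrite nE; lra.
have := eigenvalue_ratio r00 r9 Nn N0R Nn2 m0 Z0 YL YU hL hU.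
rewrite B1; move: (NN * _ / _) (nn / mm) => x y B.
have -> : mm - x - (- y + mm) = y - x by ring.
have L1 : 0 <= mm ^+ 2 * ln nn / nn.
  have LL := lnge1; apply: mulr_ge0; last by rewrite invr_ge0 ltW.
  by apply: mulr_ge0; [exact: exprn_ge0|exact: le_trans LL].
apply: (le_trans B); rewrite mulrDr -[leLHS]addr0; apply: lerD; last by rewrite mulr_ge0.
by apply: ler_wpM2r; [exact: le_trans ler01 lnge1|rewrite ler_nat].
Qed.

End Asymptotics.

Section SteklovEigenvalues.
Variables (R : realType) (k M : nat) (c : profile R k.+2).
Hypothesis MN : (M < k.+1)%N.
Local Notation W := (cat_W c).

Lemma is_Lambda_rad (s h0 h1 l : R) (b : bfun R k.+2) (g : 'rV[R]_k.+2 -> R) :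
  0 <= h0 <= 1 -> 0 <= h1 <= 1 -> s * h0 = h0 -> s * h1 = - h1 -> s * s = 1 ->
  rad_h M c h0 h1 W != 0 -> @harmonics R k.+2 M.+1 g ->
  (forall w, b.1 w = g w) -> (forall w, b.2 w = s * g w) ->
  ~ beq b (fun=> 0, fun=> 0) -> DN c b (bscale l b) ->
  l = W * rad_psi1 M c h0 h1 W / rad_psi M c h0 h1 W.
Proof.
move=> h00 h10 s0 s1 s2 hW hg b1 b2 bn0 DNb; have N0 : (0 < k.+1)%N by [].
have [pN p1N] := rad_psi_parity c N0 MN h00 h10 s0 s1.
have pW : rad_psi M c h0 h1 W != 0.
  rewrite /rad_psi mulf_neq0// invr_neq0// expf_neq0// gt_eqF// f_gt0//; exact: W_domain.
exact: (steklov_eigenvalue hg (ndiff1_rad_psi c N0 MN h00 h10)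
  (fun x dx => derive_rad_psi N0 MN h00 h10 dx) (fun x dx => derive_rad_psi1 N0 MN h00 h10 dx)
  (fun _ _ => erefl) s2 pN p1N pW b1 b2 bn0 DNb).
Qed.

Lemma is_Lambda0E l : is_Lambda0 c M.+1 l ->
  l = W * rad_psi1 M c 1 0 W / rad_psi M c 1 0 W.
Proof.
have h00 : 0 <= (1 : R) <= 1 by rewrite lexx ler01.
have h10 : 0 <= (0 : R) <= 1 by rewrite ler01 lexx.
have WW : 0 <= W <= W by rewrite lexx andbT ltW// cat_W_gt0.
move=> [b [[g hg ->] bn0 DNb]]; apply: (is_Lambda_rad (s := 1)) DNb => //; rewrite ?mul1r ?oppr0//.
  by rewrite gt_eqF// (lt_le_trans ltr01)// (even_h_ge1 _ MN h00 h10 erefl WW).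
by move=> w; rewrite mul1r.
Qed.

Lemma is_Lambda1E l : is_Lambda1 c M.+1 l ->
  l = W * rad_psi1 M c 0 1 W / rad_psi M c 0 1 W.
Proof.
have h00 : 0 <= (0 : R) <= 1 by rewrite lexx ler01.
have h10 : 0 <= (1 : R) <= 1 by rewrite ler01 lexx.
have WW : 0 <= W <= W by rewrite lexx andbT ltW// cat_W_gt0.
move=> [b [[g hg ->] bn0 DNb]]; apply: (is_Lambda_rad (s := -1)) DNb => //; rewrite ?mulr0 ?mulN1r ?opprK//.
  by rewrite gt_eqF// (lt_le_trans (f1W_gt0 c _))// (odd_h_ge _ MN h00 h10 erefl erefl WW).
by move=> w; rewrite mulN1r.
Qed.

End SteklovEigenvalues.

Lemma ln_ge_half (R : realType) (x : R) : 2 <= x -> 1 / 2 <= ln x.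
Proof.
move=> x2; have x0 : 0 < x by lra.
rewrite -ler_expR lnK ?posrE//; apply: le_trans x2.
have e0 := expR_gt0 (1 / 2 : R).
have : 1 - 1 / 2 <= (expR (1 / 2 : R))^-1 by rewrite -expRN; exact: expR_ge1Dx.
rewrite -(ler_pM2r e0) mulVf ?lt0r_neq0//; lra.
Qed.

Lemma ln_ge1 (R : realType) (x : R) : 4 <= x -> 1 <= ln x.
Proof.
move=> x4; have x0 : 0 < x / 2 by lra.
have -> : x = 2 * (x / 2) by field.
rewrite lnM ?posrE//.
have : 1 / 2 <= ln (2 : R) by apply: ln_ge_half.
have : 1 / 2 <= ln (x / 2) by apply: ln_ge_half; lra.
by lra.
Qed.

Theorem mainTheorem3 (R : realType) :
  exists A C : R, 0 < A /\
    forall n m : nat, (2 <= n)%N -> (1 <= m)%N ->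
      m%:R < n%:R / (A * ln n%:R) ->
      forall c : profile R n,
        (forall l : R, is_Lambda0 c m l ->
           `|l - (- (n%:R / m%:R) + m%:R)|
             <= C * (ln n%:R + m%:R ^+ 2 * ln n%:R / n%:R)) /\
        (forall l : R, is_Lambda1 c m l ->
           `|l - m%:R| <= C * (m%:R ^+ 2 * ln n%:R / n%:R)).
Proof.
(* The bound on m gives m Log(n) / n < 1 / 2000, and then n > 1000 as
   Log(n) >= 1 / 2. *)
exists 2000, 100; split; first by rewrite ltr0n.
move=> [|[|k]]// [//|M] _ _ mn c.
have N0 : (0 < k.+1)%N by [].
have n2 : 2 <= k.+2%:R :> R by rewrite ler_nat.
have m1 : 1 <= M.+1%:R :> R by rewrite ler1n.
have l2 := ln_ge_half n2.
have m0 : 0 < M.+1%:R :> R by rewrite ltr0n.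
have n0 : 0 < k.+2%:R :> R by rewrite ltr0n.
have A0 : 0 < 2000 * ln k.+2%:R :> R by lra.
move: mn; rewrite (ltr_pdivlMr _ _ A0) => mn.
have mln : M.+1%:R * (1 / 2) <= M.+1%:R * ln k.+2%:R :> R by rewrite ler_pM2l.
have mlnE : M.+1%:R * (2000 * ln k.+2%:R) = 2000 * (M.+1%:R * ln k.+2%:R) :> R by ring.
have n1000 : 1000 <= k.+2%:R :> R by move: mn mln; rewrite mlnE; lra.
have MN : (M < k.+1)%N.
  by rewrite -ltnS -(ltr_nat R); move: mn mln; rewrite mlnE; lra.
have lnge1 : 1 <= ln (k.+2%:R : R) by apply: ln_ge1; lra.
have r1000 : M.+1%:R * ln k.+2%:R / k.+2%:R <= 1 / 1000 :> R.
  by rewrite ler_pdivrMr//; move: mn; rewrite mlnE; lra.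
split=> l Hl.
  by rewrite (is_Lambda0E MN Hl); exact: even_asymptotics.
by rewrite (is_Lambda1E MN Hl); exact: odd_asymptotics.
Qed.
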